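(* Let $m\ge 2$ be a real number and let $z:\mathbb{R}^2\to\mathbb{R}$ be a nonnegative function, homogeneous of order $m$, with $z\in C^\infty(\mathbb{R}^2\setminus\{0\})$, so that in polar coordinates $z=r^mP(\theta)$ with $P\in C^\infty(S^1)$. Let $S=\{R(s,t)=(s,t,z(s,t)):(s,t)\in\mathbb{R}^2\}$. Assume $S$ has nonnegative Gaussian curvature and no asymptotic curves (so that $P(\theta)>0$ for all $\theta$), and that there is a finite set $\{\theta_1,\dots,\theta_\ell\}$ such that $$m^2P(\theta)^2+mP(\theta)P''(\theta)-(m-1)P'(\theta)^2>0\qquad\text{for all }\theta\notin\{\theta_1,\dots,\theta_\ell\}.$$ Let $b,c_1,c_2$ be the functions of $\theta$ and $b_1,b_2$ the numbers attached to $z$ defined in the context, and suppose that $c_1,c_2\in L^1([0,2\pi])$ and $$b_1-b_2\notin\pi\mathbb{Z}\quad\text{and}\quad(2m-1)b_1-b_2\notin\pi\mathbb{Z}.$$ Then for every $k\in\mathbb{N}$ there exist $U^1,U^2\in C^k(\mathbb{R}^2,\mathbb{R}^3)$ such that the deformation of $S$ given by the position vector $$R(s,t)+2\epsilon U^1(s,t)+2\epsilon^2U^2(s,t)$$ is a nontrivial infinitesimal bending of $S$ of order $2$.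
   Context: Polar coordinates: $s=r\cos\theta$, $t=r\sin\theta$. Define (the expressions are independent of $r$ by homogeneity, and $'$ denotes $d/d\theta$) $$H(\theta)=\begin{pmatrix} h_{11} & h_{12} \\ h_{21} & h_{22} \end{pmatrix}=\frac{1}{(m^2-m)r^{m-2}P(\theta)}\begin{pmatrix} z_{tt} & -z_{st} \\ -z_{st} & z_{ss} \end{pmatrix},\qquad b(\theta)=\sqrt{\det H(\theta)},$$ $$c_1=\frac{-h_{21}}{b}\,\frac{h_{11}'}{h_{11}},\qquad c_2=\frac{-h_{21}}{b}\,\frac{h_{22}'}{h_{22}}\qquad(\theta\ne\theta_i),$$ $$b_1=\int_0^{2\pi}b(\theta)\,d\theta,\qquad b_2=-\frac14\int_0^{2\pi}\big(c_1(\theta)-c_2(\theta)\big)\,d\theta.$$ A deformation $R_\epsilon=R+2\sum_{j=1}^{q}\epsilon^jU^j$ is an infinitesimal bending of $S$ of order $q$ if $dR_\epsilon^2=dR^2+o(\epsilon^q)$ as $\epsilon\to0$; equivalently $dR\cdot dU^1=0$ and $dR\cdot dU^j=-\sum_{i=1}^{j-1}dU^i\cdot dU^{j-i}$ for $2\le j\le q$. Trivial bendings are those generated by rigid motions of $\mathbb{R}^3$; the trivial first order fields are $U^1=A\times R+B$ with constant $A,B\in\mathbb{R}^3$. The bending is nontrivial if $U^1$ is not of this form. *)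

(* Defs.v *)
From mathcomp Require Import all_boot all_order all_algebra.
From mathcomp Require Import all_classical all_reals all_analysis.

Set Implicit Arguments.
Unset Strict Implicit.
Unset Printing Implicit Defensive.

Import Order.TTheory GRing.Theory Num.Theory.
Import numFieldNormedType.Exports.

Local Open Scope classical_set_scope.
Local Open Scope ring_scope.

Section Plane.
Variable R : realType.

Definition ds : R * R := (1, 0).
Definition dt : R * R := (0, 1).

(* Meant for D open: all iterated partial derivatives of order at most k exist
   and are continuous on D. *)
Fixpoint Ck (V : normedModType R) (k : nat) (D : set (R * R))
    (f : R * R -> V) : Prop :=
  (forall p, D p -> {for p, continuous f}) /\
  match k with
  | 0 => True
  | k'.+1 =>
      [/\ forall p, D p -> derivable f p ds /\ derivable f p dt,
          Ck k' D ('D_ds f) & Ck k' D ('D_dt f)]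
  end.

End Plane.

Section Space.
Variable R : realType.
Implicit Types u v : 'rV[R]_3.

Definition vec3 (a b c : R) : 'rV[R]_3 :=
  \row_(i < 3) nth 0 [:: a; b; c] i.

Definition dot u v : R := \sum_(i < 3) u 0 i * v 0 i.

Definition cross u v : 'rV[R]_3 :=
  let x i := u 0 (inord i) in let y i := v 0 (inord i) in
  vec3 (x 1%N * y 2%N - x 2%N * y 1%N)
       (x 2%N * y 0%N - x 0%N * y 2%N)
       (x 0%N * y 1%N - x 1%N * y 0%N).

(* The library norm on row vectors is the sup norm. *)
Definition enorm u : R := Num.sqrt (dot u u).

End Space.

Section Surface.
Variables (R : realType) (X : R * R -> 'rV[R]_3).
Implicit Types (p v : R * R).

Definition unit_normal p : 'rV[R]_3 :=
  let n := cross ('D_(ds R) X p) ('D_(dt R) X p) in (enorm n)^-1 *: n.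

Definition ffE p := dot ('D_(ds R) X p) ('D_(ds R) X p).
Definition ffF p := dot ('D_(ds R) X p) ('D_(dt R) X p).
Definition ffG p := dot ('D_(dt R) X p) ('D_(dt R) X p).

Definition sfL p := dot ('D_(ds R) ('D_(ds R) X) p) (unit_normal p).
Definition sfM p := dot ('D_(dt R) ('D_(ds R) X) p) (unit_normal p).
Definition sfN p := dot ('D_(dt R) ('D_(dt R) X) p) (unit_normal p).

Definition gauss_curvature p : R :=
  (sfL p * sfN p - sfM p ^+ 2) / (ffE p * ffG p - ffF p ^+ 2).

Definition second_form p v : R :=
  sfL p * v.1 ^+ 2 + 2 * sfM p * v.1 * v.2 + sfN p * v.2 ^+ 2.

(* [g] is the expression in the parameter plane of the space curve [X \o g];
   D is the set of parameters at which X is a smooth immersion. *)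
Definition asymptotic_curve (D : set (R * R)) (a b : R) (g : R -> R * R) :=
  a < b /\
  forall x, a < x < b ->
    [/\ D (g x),
        forall n, derivable (derive1n n g) x 1,
        derive1 g x != 0 &
        second_form (g x) (derive1 g x) = 0].

(* dXe_e ^ 2 = dX ^ 2 + o(e ^ q), as quadratic forms in v at each p. *)
Definition infinitesimal_bending (q : nat) (Xe : R -> R * R -> 'rV[R]_3) :=
  (forall e p, differentiable (Xe e) p) /\
  forall p v, forall e : R,
    dot ('D_v (Xe e) p) ('D_v (Xe e) p) - dot ('D_v X p) ('D_v X p)
      =o_(e \near nbhs (0 : R)) (e ^+ q).

Definition deformation (q : nat) (U : nat -> R * R -> 'rV[R]_3)
    (e : R) (p : R * R) : 'rV[R]_3 :=
  X p + 2 *: \sum_(1 <= j < q.+1) e ^+ j *: U j p.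

Definition trivial_field (U1 : R * R -> 'rV[R]_3) :=
  exists A B : 'rV[R]_3, forall p, U1 p = cross A (X p) + B.

Definition nontrivial_bending (q : nat) (U : nat -> R * R -> 'rV[R]_3) :=
  infinitesimal_bending q (deformation q U) /\ ~ trivial_field (U 1%N).

End Surface.

Section Homogeneous.
Variables (R : realType) (m : R) (z : R * R -> R).

Definition homogeneous := forall (l : R) (p : R * R),
  0 < l -> z (l *: p) = (l `^ m) * z p.

Definition graph (p : R * R) : 'rV[R]_3 := vec3 p.1 p.2 (z p).

Definition polar (r th : R) : R * R := (r * cos th, r * sin th).

Definition Pz (th : R) : R := z (polar 1 th).

Definition zss := 'D_(ds R) ('D_(ds R) z).
Definition zst := 'D_(dt R) ('D_(ds R) z).
Definition ztt := 'D_(dt R) ('D_(dt R) z).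

(* For homogeneous z of order m this does not depend on r > 0. *)
Definition Hpolar (r th : R) : 'M[R]_2 :=
  ((m ^+ 2 - m) * (r `^ (m - 2)) * Pz th)^-1 *:
  \matrix_(i, j)
    let p := polar r th in
    if (i == 0) && (j == 0) then ztt p
    else if (i == 1) && (j == 1) then zss p
    else - zst p.

Definition Hz (th : R) : 'M[R]_2 := Hpolar 1 th.

Definition h11 (th : R) : R := Hz th 0 0.
Definition h21 (th : R) : R := Hz th 1 0.
Definition h22 (th : R) : R := Hz th 1 1.

Definition bz (th : R) : R := Num.sqrt (\det (Hz th)).

(* Division by 0 yields 0 in the library, so c1 and c2 are total; their values
   at the finitely many zeros of b affect neither integrability nor b2. *)
Definition c1 (th : R) : R := (- h21 th / bz th) * (derive1 h11 th / h11 th).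
Definition c2 (th : R) : R := (- h21 th / bz th) * (derive1 h22 th / h22 th).

Definition b1 : R :=
  Rintegral (@lebesgue_measure R) `[0, 2 * pi] bz.
Definition b2 : R :=
  - 4^-1 * Rintegral (@lebesgue_measure R) `[0, 2 * pi]
             (fun th => c1 th - c2 th).

Definition L1_circle (f : R -> R) : Prop :=
  (@lebesgue_measure R).-integrable `[0, 2 * pi] (EFin \o f).

End Homogeneous.

(* Main.v *)
Require Import Defs.
From HB Require Import structures.
From mathcomp Require Import all_boot all_order all_algebra.
From mathcomp Require Import all_classical all_reals all_analysis.
From mathcomp Require Import ring lra.

(** Why the theorem is true. In polar coordinates the surface is z = r^m P(theta),
with P > 0: a zero of P is a minimum, so the Hessian of z annihilates the ray
above it and that ray would be an asymptotic curve (Pz_gt0). A bending field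
is sought with vertical component r^l W and horizontal components of degree
l + m - 1. The radial and mixed equations of dR.dU = Q determine the
horizontal components from W algebraically, and the angular equation becomes
a second order linear equation for W (bending_eqs_of_op). The substitution
W = P^((l-1)/m) G removes its first order term, and what is left is Hill's
equation

   G'' + (1 + mu kappa) G = h,      mu = (l - 1)(l + m - 1),

whose weight kappa is the determinant of the normalised Hessian, i.e. the
square of the function b of the introduction (bending_op_of_hill). By the
strict inequality kappa is positive off a finite set of angles, hence
nonnegative by continuity (hill_weight_ge0). Everything therefore reduces to a regular periodic
Sturm-Liouville problem with a nonnegative weight.

First order. There are arbitrarily large mu for which Hill's equation has a
2 pi-periodic solution (periodic_eigenvalue): the phase at 2 pi of the
Dirichlet solution is continuous in mu and unbounded, at its passages through
even and odd multiples of pi the trace of the monodromy matrix is >= 2 and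
<= -2 respectively, so the trace takes the value 2 in between. A large mu
means a large degree l, hence a field U^1 as smooth at the origin as desired,
and one that is not affine in its vertical component, hence nontrivial.

Second order. The quadratic form - dU^1.dU^1 is the sum of two homogeneous
parts, of degrees 2(l + m - 2) and 2(l - 1), and each is solved for
separately, with degrees 2l + m - 2 and 2l - m of the vertical component. If
the corresponding mu is resonant, a term r^l log r is added to the unknown.
Its effect on Hill's equation is to differentiate it with respect to l, which
adds a nonzero multiple of kappa G1, for G1 a periodic solution of the
homogeneous equation. As the integral of kappa G1^2 is positive, this is
exactly what the Fredholm alternative needs, and the problem is solvable for
every right-hand side (hill_resonant, bending_eqs_solvable).

Functions r^a (f0(theta) + log r f1(theta)) with f0 and f1 smooth and
periodic are stable under differentiation, with a replaced by a - 1, and are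
C^k on the whole plane as soon as k < a (powlog_Ck). All fields belong to this
class, so that the equations of bending are identities between functions of
theta alone (dot_graph_polar_field). *)

Set Implicit Arguments.
Unset Strict Implicit.
Unset Printing Implicit Defensive.

Import Order.TTheory GRing.Theory Num.Theory.
Import numFieldNormedType.Exports.

Local Open Scope classical_set_scope.
Local Open Scope ring_scope.

(** * Differentiation rules and primitives *)

Section DeriveRules.
Variable R : realType.
Variable V : normedModType R.
Implicit Types (f g : V -> R) (h : R -> R) (x v : V).

Lemma der_cst (c : R) x v : is_derive x v (fun _ : V => c) 0.
Proof. exact: is_derive_cst. Qed.

Lemma der_add f g x v a b : is_derive x v f a -> is_derive x v g b ->
  is_derive x v (fun y => f y + g y) (a + b).
Proof. by move=> ? ?; exact: is_deriveD. Qed.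

Lemma der_sub f g x v a b : is_derive x v f a -> is_derive x v g b ->
  is_derive x v (fun y => f y - g y) (a - b).
Proof. by move=> ? ?; exact: is_deriveB. Qed.

Lemma der_opp f x v a : is_derive x v f a -> is_derive x v (fun y => - f y) (- a).
Proof. by move=> ?; exact: is_deriveN. Qed.

Lemma der_mul f g x v a b : is_derive x v f a -> is_derive x v g b ->
  is_derive x v (fun y => f y * g y) (a * g x + f x * b).
Proof.
move=> fd gd; have := @is_deriveM _ _ f g x v a b fd gd.
by congr is_derive; rewrite /GRing.scale /=; ring.
Qed.

Lemma der_inv f x v a : is_derive x v f a -> f x != 0 ->
  is_derive x v (fun y => (f y)^-1) (- a / (f x ^+ 2)).
Proof.
move=> [fd <-] f0; split; first exact: derivableV.
by rewrite deriveV // /GRing.scale /=; ring.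
Qed.

Lemma der_exprn f x v a n : is_derive x v f a ->
  is_derive x v (fun y => f y ^+ n) (n%:R * f x ^+ n.-1 * a).
Proof.
move=> fd; rewrite (_ : (fun y => _) = f ^+ n); first exact: is_deriveX.
by apply/funext => y; rewrite exprfctE.
Qed.

End DeriveRules.

Section OneVar.
Variable R : realType.
Implicit Types (f g h : R -> R) (x : R).

Lemma der_id (x : R) : is_derive x 1 (fun y : R => y) 1.
Proof. exact: is_derive_id. Qed.

Lemma der_comp f g x a b : is_derive x 1 g b -> is_derive (g x) 1 f a ->
  is_derive x 1 (fun y => f (g y)) (a * b).
Proof. by move=> ? ?; exact: is_derive1_comp. Qed.

Lemma der_sin f x a : is_derive x 1 f a ->
  is_derive x 1 (fun y => sin (f y)) (cos (f x) * a).
Proof. by move=> ?; apply: der_comp; apply: is_derive_sin. Qed.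

Lemma der_cos f x a : is_derive x 1 f a ->
  is_derive x 1 (fun y => cos (f y)) (- sin (f x) * a).
Proof. by move=> ?; apply: der_comp; apply: is_derive_cos. Qed.

Lemma der_expR f x a : is_derive x 1 f a ->
  is_derive x 1 (fun y => expR (f y)) (expR (f x) * a).
Proof. by move=> ?; apply: der_comp; apply: is_derive_expR. Qed.

Lemma der_atan f x a : is_derive x 1 f a ->
  is_derive x 1 (fun y => atan (f y)) ((1 + f x ^+ 2)^-1 * a).
Proof. by move=> ?; apply: der_comp; apply: is_derive1_atan. Qed.

Lemma der_ln f x a : is_derive x 1 f a -> 0 < f x ->
  is_derive x 1 (fun y => ln (f y)) ((f x)^-1 * a).
Proof. by move=> ? ?; apply: der_comp; apply: is_derive1_ln. Qed.

Lemma is_derive_cont f x a : is_derive x 1 f a -> {for x, continuous f}.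
Proof.
by move=> [fd _]; apply/differentiable_continuous/derivable1_diffP.
Qed.

Lemma is_derive_derive1 f x a : is_derive x 1 f a -> derive1 f x = a.
Proof. by move=> ?; rewrite derive1E derive_val. Qed.

Lemma derivable_is_derive f x :
  derivable f x 1 -> is_derive x 1 f (derive1 f x).
Proof. by move=> fd; rewrite derive1E; exact: derivableP. Qed.

Lemma derive_le f g f' g' (a b : R) : a <= b ->
  (forall x, is_derive x 1 f (f' x)) -> (forall x, is_derive x 1 g (g' x)) ->
  (forall x, a <= x <= b -> f' x <= g' x) -> f b - f a <= g b - g a.
Proof.
move=> ab fd gd le.
have d x : is_derive x 1 (fun x => g x - f x) (g' x - f' x).
  exact: der_sub.
have [|c /[!in_itv]/= cab] := MVT_segment (f := fun x => g x - f x) ab (fun x _ => d x).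
  by apply: continuous_subspaceT => x; apply: is_derive_cont.
move=> h; rewrite -subr_ge0.
have -> : g b - g a - (f b - f a) = g b - f b - (g a - f a) by ring.
by rewrite h mulr_ge0 // subr_ge0 // le.
Qed.

Lemma derive0_eq f (a b : R) : a <= b ->
  (forall x, a <= x <= b -> is_derive x 1 f 0) -> f a = f b.
Proof.
move=> ab d.
have fd x : x \in `]a, b[ -> is_derive x 1 f 0.
  by rewrite in_itv /= => /andP[/ltW ax /ltW xb]; apply: d; rewrite ax.
have fc : {within `[a, b], continuous f}.
  apply: continuous_in_subspaceT => x; rewrite inE /= in_itv /= => /d.
  exact: is_derive_cont.
have [c _] := MVT_segment ab fd fc.
by rewrite mul0r => /eqP; rewrite subr_eq0 => /eqP.
Qed.

(** The integral is taken from - n with n depending on the point,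
    because the fundamental theorem of calculus differentiates only strictly to
    the right of the base point; subtracting the value at 0 makes the choices
    of n agree. *)
Lemma antiderivative f : continuous f ->
  exists F, F 0 = 0 /\ forall x, is_derive x 1 F (f x).
Proof.
move=> fc.
have ci a b : (@lebesgue_measure R).-integrable `[a, b] (EFin \o f).
  apply: continuous_compact_integrable; first exact: segment_compact.
  exact: continuous_subspaceT.
pose G (a x : R) := (\int[@lebesgue_measure R]_(t in `[a, x]) f t)%R.
have Gd a x : a < x -> is_derive x 1 (G a) (f x).
  move=> ax.
  have xu : x < x + 1 by rewrite ltrDl.
  have [d e] := continuous_FTC1_closed xu (ci a _) ax (fc x).
  by rewrite -e; exact: derivable_is_derive.
pose F (n : nat) x := G (- n%:R) x - G (- n%:R) 0.
have Fd (n : nat) x : - n%:R < x -> is_derive x 1 (F n) (f x).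
  move=> nx; rewrite -[f x]subr0; apply: der_sub; exact: Gd.
have Feq (n k : nat) x : (0 < n)%N -> (n <= k)%N -> - n%:R < x -> F n x = F k x.
  move=> n0 nk nx.
  have n0' : - n%:R < 0 :> R by rewrite oppr_lt0 ltr0n.
  have kn : - k%:R <= - n%:R :> R by rewrite lerN2 ler_nat.
  pose d y := F n y - F k y.
  have dd (y : R) : - n%:R < y -> is_derive y 1 d 0.
    move=> ny; rewrite -[0](subrr (f y)); apply: der_sub; apply: Fd => //.
    exact: le_lt_trans kn ny.
  have d0 : d 0 = 0 by rewrite /d /F !subrr.
  suff : d x = 0 by move/eqP; rewrite subr_eq0 => /eqP.
  rewrite -d0; case: (leP 0 x) => x0.
    symmetry; apply: derive0_eq x0 _ => y /andP[y0 _].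
    by apply: dd; apply: lt_le_trans y0.
  apply: derive0_eq (ltW x0) _ => y /andP[y0 _].
  by apply: dd; apply: lt_le_trans y0.
(* the base point - N x stays to the left of a whole neighbourhood of x *)
pose N x := (Num.truncn `|x|).+2.
have Nx x : - (N x)%:R < x - 1.
  have := truncnS_gt `|x|; rewrite /N => h.
  have : - `|x| <= x by rewrite lerNl ler_normr lexx orbT.
  by rewrite -[(_.+2)%:R]natr1; lra.
exists (fun x => F (N x) x); split; first by rewrite /F subrr.
move=> x.
apply: (@near_eq_is_derive _ _ _ (F (N x).+1)); last first.
  apply: Fd; apply: lt_trans (_ : - (N x)%:R < _); first by rewrite ltrN2 ltr_nat.
  by apply: lt_trans (Nx x) _; lra.
have : \forall y \near x, x - 1 < y < x + 1.
  near=> y.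
  have : `|x - y| < 1 by near: y; apply: (@nbhsx_ballx _ _ x 1).
  by rewrite ltr_norml => /andP[? ?]; lra.
apply: filterS => y /andP[xy yx].
have h : - (N x)%:R < y by apply: lt_trans (Nx x) _.
have h' : - (N y)%:R < y by apply: lt_trans (Nx y) _; lra.
have -> : F (N x).+1 y = F (N x) y by symmetry; apply: Feq.
by case: (leqP (N x) (N y)) => [?|/ltnW ?]; [|symmetry]; apply: Feq.
Unshelve. all: by end_near. Qed.

End OneVar.

(** Separates the derivative produced by the rules from its final form. *)
Lemma der_eq (R : realType) (V : normedModType R) (f : V -> R) (x v : V) (a b : R) :
  is_derive x v f a -> a = b -> is_derive x v f b.
Proof. by move=> + <-. Qed.

Lemma der_mulc (R : realType) (c x : R) : is_derive x 1 ( *%R c) c.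
Proof. by have := der_mul (der_cst c x 1) (der_id x); rewrite mul0r add0r mulr1. Qed.

Lemma der_addc (R : realType) (c x : R) : is_derive x 1 ( +%R c) 1.
Proof. by have := der_add (der_cst c x 1) (der_id x); rewrite add0r. Qed.

Lemma der_oppr (R : realType) (x : R) : is_derive x 1 ( -%R ) (-1).
Proof. exact: (der_opp (der_id x)). Qed.

(** One syntax-directed differentiation step. Type class resolution is kept
    out because it could close a goal with a derivative of another shape. *)
Ltac der_step :=
  match goal with
  | |- is_derive _ _ ( *%R _) _ => notypeclasses refine (der_mulc _ _)
  | |- is_derive _ _ ( +%R _) _ => notypeclasses refine (der_addc _ _)
  | |- is_derive _ _ ( -%R ) _ => notypeclasses refine (der_oppr _)
  | |- is_derive ?t _ sin _ => notypeclasses refine (is_derive_sin t)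
  | |- is_derive ?t _ cos _ => notypeclasses refine (is_derive_cos t)
  | |- is_derive ?t _ expR _ => notypeclasses refine (is_derive_expR t)
  | |- is_derive ?t _ atan _ => notypeclasses refine (is_derive1_atan t)
  | |- is_derive _ _ (fun _ => ?c) _ => notypeclasses refine (der_cst c _ _)
  | |- is_derive _ _ (fun x => x) _ => notypeclasses refine (der_id _)
  | |- is_derive _ _ (fun x => _ - _) _ => notypeclasses refine (der_sub _ _)
  | |- is_derive _ _ (fun x => _ + _) _ => notypeclasses refine (der_add _ _)
  | |- is_derive _ _ (fun x => - _) _ => notypeclasses refine (der_opp _)
  | |- is_derive _ _ (fun x => _ * _) _ => notypeclasses refine (der_mul _ _)
  | |- is_derive _ _ (fun x => _ ^+ _) _ => notypeclasses refine (der_exprn _ _)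
  | |- is_derive _ _ (fun x => _ ^-1) _ => notypeclasses refine (der_inv _ _)
  | |- is_derive _ _ (fun x => sin _) _ => notypeclasses refine (der_sin _)
  | |- is_derive _ _ (fun x => cos _) _ => notypeclasses refine (der_cos _)
  | |- is_derive _ _ (fun x => expR _) _ => notypeclasses refine (der_expR _)
  | |- is_derive _ _ (fun x => atan _) _ => notypeclasses refine (der_atan _)
  | |- is_derive _ _ (fun x => ln _) _ => notypeclasses refine (der_ln _ _)
  | H : forall x, is_derive x _ ?f _ |- is_derive ?t _ ?f _ => notypeclasses refine (H t)
  | H : forall x, is_derive x _ ?f _ |- is_derive ?t _ (fun x => ?f x) _ =>
      notypeclasses refine (H t)
  | H : forall x, is_derive x _ ?f _ |- is_derive ?t _ (fun x => ?f _) _ =>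
      notypeclasses refine (der_comp _ (H _))
  | H : is_derive ?t _ ?f _ |- is_derive ?t _ ?f _ => notypeclasses refine H
  | H : is_derive ?t _ ?f _ |- is_derive ?t _ (fun x => ?f x) _ =>
      notypeclasses refine H
  end.
Ltac der := notypeclasses refine (der_eq _ _); [repeat der_step|cbv beta].

(** * Global solutions of bounded Lipschitz equations *)

Section Picard.
Variable R : realType.
Implicit Types (f g h : R -> R) (x t : R).

(** Passage to the limit in an estimate with a geometric error. *)
Lemma geometric_le (A D E : R) :
  (forall n : nat, A <= D + E * 2^-1 ^+ n) -> A <= D.
Proof.
move=> H; rewrite leNgt; apply/negP => DA.
have [E0|E0] := leP E 0.
  have := H 0%N; rewrite expr0 mulr1; lra.
have e0 : 0 < (A - D) / E by rewrite divr_gt0 // subr_gt0.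
have : (2^-1 : R) ^+ n @[n --> \oo] --> 0.
  by apply: cvg_expr; rewrite ger0_norm; lra.
move=> /cvgr0_norm_lt /(_ _ e0) [n _ /(_ n (leqnn n))] /=.
rewrite ger0_norm ?exprn_ge0 // ltr_pdivlMr // => h.
by have := H n; lra.
Qed.

(** The weight exp (L |t|) is the one for which integrating gains a factor
    1 / L; with L twice the Lipschitz constant, Picard iteration then contracts
    by 1/2 on the whole line at once. *)
Lemma exp_weighted_bound f f' (C L : R) t : 0 <= C -> 0 < L -> f 0 = 0 ->
  (forall t, is_derive t 1 f (f' t)) ->
  (forall t, `|f' t| <= C * L * expR (L * `|t|)) ->
  `|f t| <= C * expR (L * `|t|).
Proof.
move=> C0 L0 f0.
have pos h h' s : h 0 = 0 -> 0 <= s -> (forall t, is_derive t 1 h (h' t)) ->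
    (forall t, `|h' t| <= C * L * expR (L * `|t|)) -> h s <= C * expR (L * s).
  move=> h0 s0 hd hb.
  have gd (x : R) : is_derive x 1 (fun t => C * expR (L * t)) (C * L * expR (L * x)).
    by der; ring.
  have := derive_le s0 hd gd; rewrite h0 subr0 mulr0 expR0 mulr1.
  have H x : 0 <= x <= s -> h' x <= C * L * expR (L * x).
    move=> /andP[x0 _]; have := hb x; rewrite (ger0_norm x0).
    by apply: le_trans; exact: ler_norm.
  by move=> /(_ H); lra.
move=> fd fb; rewrite ler_norml; apply/andP; split.
  rewrite lerNl; have [t0|t0] := leP 0 t.
    rewrite (ger0_norm t0).
    apply: (pos (fun t => - f t) (fun t => - f' t)) => //.
    - by rewrite f0 oppr0.
    - by move=> x; rewrite normrN.
  rewrite -[X in f X]opprK (ltr0_norm t0).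
  apply: (pos (fun t => - f (- t)) (fun t => f' (- t))) => //.
  - by rewrite oppr0 f0 oppr0.
  - by rewrite oppr_ge0 ltW.
  - move=> x; by der; ring.
  - by move=> x; have := fb (- x); rewrite normrN.
have [t0|t0] := leP 0 t.
  by rewrite (ger0_norm t0); exact: (pos f f').
rewrite -[X in f X]opprK (ltr0_norm t0).
apply: (pos (fun t => f (- t)) (fun t => - f' (- t))) => //.
- by rewrite oppr0 f0.
- by rewrite oppr_ge0 ltW.
- move=> x; by der; ring.
- by move=> x; have := fb (- x); rewrite !normrN.
Qed.

Lemma lipschitz_continuous f (C : R) : 0 <= C ->
  (forall x y, `|f x - f y| <= C * `|x - y|) -> continuous f.
Proof.
move=> C0 fl x; apply/cvgrPdist_lt => e e0.
have C1 : 0 < C + 1 by lra.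
near=> y; apply: le_lt_trans (fl x y) _.
have : `|x - y| < e / (C + 1).
  by near: y; apply: (@nbhsx_ballx _ _ x); rewrite divr_gt0.
rewrite ltr_pdivlMr // => h; apply: le_lt_trans h.
by rewrite mulrC ler_wpM2l //; lra.
Unshelve. all: by end_near. Qed.

(** Picard iteration in the norm weighted by exp (2 K |t|). Since F is bounded,
    the iterates have a common Lipschitz constant, which makes their pointwise
    limit continuous without a theorem on uniform limits. *)
Lemma picard (F : R -> R -> R) (K B a : R) : 0 < K ->
  (forall t x, `|F t x| <= B) ->
  (forall t x y, `|F t x - F t y| <= K * `|x - y|) ->
  (forall x : R -> R, continuous x -> continuous (fun t => F t (x t))) ->
  exists phi : R -> R,
    phi 0 = a /\ forall t, is_derive t 1 phi (F t (phi t)).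
Proof.
move=> K0 Fb Fl Fc.
have /choice[T HT] : forall x : R -> R, exists y : R -> R, continuous x ->
    y 0 = a /\ forall t, is_derive t 1 y (F t (x t)).
  move=> x; have [xc|] := pselect (continuous x); last by exists x.
  have [G [G0 Gd]] := antiderivative (Fc _ xc).
  exists (fun t => a + G t) => _; rewrite G0 addr0; split => // t.
  by der; rewrite add0r.
pose x n := iter n T (fun=> a).
have xc n : continuous (x n).
  elim: n => [|n IH]; first by move=> ?; exact: cvg_cst.
  by move=> t; apply: is_derive_cont; apply: (HT _ IH).2.
have x0 n : x n 0 = a by case: n => // n; exact: (HT _ (xc n)).1.
have xd n t : is_derive t 1 (x n.+1) (F t (x n t)) by apply: (HT _ (xc n)).2.
have B0 : 0 <= B by apply: le_trans (Fb 0 0).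
pose L := 2 * K; have L0 : 0 < L by rewrite mulr_gt0.
pose C := B / L; have C0 : 0 <= C by rewrite divr_ge0 // ltW.
pose E t := expR (L * `|t|).
have E1 t : 1 <= E t by rewrite -expR0 ler_expR mulr_ge0 // ltW.
have half n : 0 <= 2^-1 ^+ n :> R by rewrite exprn_ge0.
have step n t : `|x n.+1 t - x n t| <= C * 2^-1 ^+ n * E t.
  elim: n t => [|n IH] t.
    rewrite expr0 mulr1.
    have H s : `|F s (x 0%N s) - 0| <= C * L * expR (L * `|s|).
      rewrite subr0 /C divfK ?gt_eqF //; apply: le_trans (Fb _ _) _.
      by rewrite ler_peMr // (E1 s).
    apply: (@exp_weighted_bound (fun t => x 1%N t - x 0%N t) (fun t => F t (x 0%N t) - 0) _ _ t
      C0 L0 _ _ H); first by cbv beta; rewrite !x0 subrr.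
  have H s : `|F s (x n.+1 s) - F s (x n s)| <= C * 2^-1 ^+ n.+1 * L * expR (L * `|s|).
    apply: le_trans (Fl _ _ _) _.
    apply: le_trans (_ : K * (C * 2^-1 ^+ n * E s) <= _); first by rewrite ler_pM2l.
    by rewrite exprS /L -/(E s) le_eqVlt; apply/orP; left; apply/eqP; field.
  apply: (@exp_weighted_bound (fun t => x n.+2 t - x n.+1 t) (fun t => F t (x n.+1 t) - F t (x
    n t)) _ _ t _ L0 _ _ H); first by rewrite mulr_ge0.
    by cbv beta; rewrite !x0 subrr.
have far n k t : `|x (n + k)%N t - x n t| <= 2 * C * E t * 2^-1 ^+ n * (1 - 2^-1 ^+ k).
  elim: k => [|k IH]; first by rewrite addn0 subrr normr0 expr0 subrr mulr0.
  rewrite addnS -[_ - _](subrKA (x (n + k)%N t)).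
  apply: le_trans (ler_normD _ _) _; apply: le_trans (lerD (step _ _) IH) _.
  by rewrite exprD exprS le_eqVlt; apply/orP; left; apply/eqP; field.
have far' n m t : (n <= m)%N -> `|x m t - x n t| <= 2 * C * E t * 2^-1 ^+ n.
  move=> nm; rewrite -(subnKC nm); apply: le_trans (far _ _ _) _.
  have E0 : 0 <= E t by exact: le_trans ler01 (E1 t).
  by rewrite ler_piMr // mulr_ge0 // mulr_ge0 // mulr_ge0.
have cx t : cvg (x n t @[n --> \oo]).
  apply: cauchy_cvg; apply: cauchy_exP => e e0.
  have : 2 * C * E t * (2^-1 : R) ^+ n @[n --> \oo] --> 2 * C * E t * 0.
    apply: cvgM; first exact: cvg_cst.
    by apply: cvg_expr; rewrite ger0_norm; lra.
  rewrite mulr0 => /cvgr0_norm_lt /(_ _ e0) [N _ /(_ N (leqnn N))] /= hN.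
  exists (x N t); exists N => // m /= Nm.
  rewrite /ball /= distrC; apply: le_lt_trans (far' _ _ _ Nm) _.
  by apply: le_lt_trans hN; exact: ler_norm.
pose phi t := lim (x n t @[n --> \oo]).
have pn n t : `|phi t - x n t| <= 2 * C * E t * 2^-1 ^+ n.
  have : `|x m t - x n t| @[m --> \oo] --> `|phi t - x n t|.
    by apply: cvg_norm; apply: cvgB; [exact: cx|exact: cvg_cst].
  move=> h; rewrite -(cvg_lim _ h) //; apply: limr_le; first by apply/cvg_ex; eexists; exact: h.
  by exists n => // m /= nm; exact: far'.
have pc : continuous phi.
  apply: (@lipschitz_continuous _ B) => // s t.
  apply: (@geometric_le _ _ (2 * C * E s + 2 * C * E t)) => n.
  have xl : `|x n s - x n t| <= B * `|s - t|.
    case: n => [|n]; first by rewrite subrr normr0 mulr_ge0.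
    wlog st : s t / t <= s.
      by move=> H; case: (leP t s) => [/H//|/ltW/H]; rewrite distrC [X in _ * X]distrC.
    rewrite (ger0_norm (_ : 0 <= s - t)) ?subr_ge0 //.
    have bd c (y : R) : is_derive y 1 (fun u => c * u) c.
by der; ring.
    have := derive_le st (xd n) (bd B) (fun y _ => le_trans (ler_norm _) (Fb _ _)).
    have Fb' y : - B <= F y (x n y).
      by rewrite lerNl; apply: le_trans (Fb y (x n y)); rewrite -normrN ler_norm.
    have := derive_le st (bd (- B)) (xd n) (fun y _ => Fb' y).
    by move=> h1 h2; rewrite ler_norml; apply/andP; split; lra.
  have -> : phi s - phi t = (phi s - x n s) + (x n s - x n t) - (phi t - x n t) by ring.
  apply: le_trans (ler_normB _ _) _.
  apply: le_trans (lerD (ler_normD _ _) (lexx _)) _.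
  by have := pn n s; have := pn n t; lra.
have [F0 Fd] := HT _ pc.
have eq t : phi t = T phi t.
  apply/eqP; rewrite -subr_eq0 -normr_le0.
  apply: (@geometric_le _ _ (2 * C * E t)) => n; rewrite add0r.
  have h : `|x n.+1 t - T phi t| <= C * 2^-1 ^+ n * E t.
    have H s : `|F s (x n s) - F s (phi s)| <= C * 2^-1 ^+ n * L * expR (L * `|s|).
      apply: le_trans (Fl _ _ _) _; rewrite distrC.
      apply: le_trans (_ : K * (2 * C * E s * 2^-1 ^+ n) <= _); first by rewrite ler_pM2l.
      by rewrite /L -/(E s) le_eqVlt; apply/orP; left; apply/eqP; ring.
    apply: (@exp_weighted_bound (fun t => x n.+1 t - T phi t) (fun t => F t (x n t) - F t (phi
      t)) _ _ t _ L0 _ _ H); first by rewrite mulr_ge0.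
      by cbv beta; rewrite x0 F0 subrr.
  have -> : phi t - T phi t = (phi t - x n.+1 t) + (x n.+1 t - T phi t) by ring.
  apply: le_trans (ler_normD _ _) _.
  have := pn n.+1 t; rewrite exprS => h2; apply: le_trans (lerD h2 h) _.
  by rewrite le_eqVlt; apply/orP; left; apply/eqP; field.
exists phi; split; first by rewrite eq F0.
by move=> t; have := Fd t; congr is_derive; apply/funext => s; rewrite eq.
Qed.

End Picard.

(** * The phase of solutions of Hill equations *)

Section Prufer.
Variable R : realType.
Implicit Types (f g h : R -> R) (x y t : R).

Lemma sin_lipschitz x y : `|sin x - sin y| <= `|x - y| :> R.
Proof.
wlog xy : x y / y <= x.
  by move=> H; case: (leP y x) => [/H//|/ltW/H]; rewrite distrC [X in _ <= X]distrC.
rewrite [X in _ <= X]ger0_norm ?subr_ge0 // ler_norml; apply/andP; split.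
  have nd (c : R) : is_derive c 1 (fun t => - sin t : R) (- cos c) by der.
  have := derive_le xy nd (@der_id R); rewrite /= => H.
  suff : - sin x - - sin y <= x - y by lra.
  by apply: H => c _; rewrite lerNl; exact: cos_geN1.
by have := derive_le xy (@is_derive_sin R) (@der_id R); apply => c _; exact: cos_le1.
Qed.

Lemma cos_lipschitz x y : `|cos x - cos y| <= `|x - y| :> R.
Proof.
rewrite -!sinDpihalf; apply: le_trans (sin_lipschitz _ _) _.
by have -> : x + pi / 2 - (y + pi / 2) = x - y by ring.
Qed.

Lemma sin_sqr_lipschitz x y : `|sin x ^+ 2 - sin y ^+ 2| <= 2 * `|x - y| :> R.
Proof.
rewrite subr_sqr normrM mulrC; apply: ler_pM => //; last exact: sin_lipschitz.
by apply: le_trans (ler_normD _ _) _; have := sin_max x; have := sin_max y; lra.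
Qed.

Lemma sin_cos_lipschitz x y : `|sin x * cos x - sin y * cos y| <= 2 * `|x - y| :> R.
Proof.
have -> : sin x * cos x - sin y * cos y =
  (sin x - sin y) * cos x + sin y * (cos x - cos y) by ring.
apply: le_trans (ler_normD _ _) _; rewrite !normrM.
have h1 : `|sin x - sin y| * `|cos x| <= `|x - y| * 1.
  by apply: ler_pM => //; [exact: sin_lipschitz|exact: cos_max].
have h2 : `|sin y| * `|cos x - cos y| <= 1 * `|x - y|.
  by apply: ler_pM => //; [exact: sin_max|exact: cos_lipschitz].
lra.
Qed.

Variables (kappa : R -> R) (K : R).
Hypothesis kc : continuous kappa.
Hypothesis k0 : forall t, 0 <= kappa t.
Hypothesis kK : forall t, kappa t <= K.

Let K0 : 0 <= K. Proof. exact: le_trans (k0 0) (kK 0). Qed.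

(** The phase p.1 and the logarithmic amplitude p.2 of a solution
    y = e^p.2 sin p.1, y' = e^p.2 cos p.1 of y'' + (1 + mu kappa) y = 0. The
    equation of the phase does not involve the amplitude and is bounded and
    Lipschitz, so the linear equation is solved through it. *)
Lemma prufer_exists (mu a : R) : exists p : (R -> R) * (R -> R),
  [/\ p.1 0 = a, p.2 0 = 0,
   forall t, is_derive t 1 p.1 (1 + mu * kappa t * sin (p.1 t) ^+ 2) &
   forall t, is_derive t 1 p.2 (- mu * kappa t * (sin (p.1 t) * cos (p.1 t)))].
Proof.
have sc (phi : R -> R) : continuous phi -> continuous (fun t => sin (phi t)).
  by move=> pc t; apply: continuous_comp; [exact: pc|exact: continuous_sin].
have cc (phi : R -> R) : continuous phi -> continuous (fun t => cos (phi t)).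
  by move=> pc t; apply: continuous_comp; [exact: pc|exact: continuous_cos].
have mc nu : continuous (fun t => nu * kappa t).
  by move=> t; apply: cvgM; [exact: cvg_cst|exact: kc].
have kn t : `|mu * kappa t| <= `|mu| * K.
  by rewrite normrM ler_wpM2l // ger0_norm.
have M0 : 0 < 2 * (`|mu| * K) + 1.
  by apply: ltr_wpDl => //; rewrite !mulr_ge0.
have [|||phi [phi0 phid]] := @picard R (fun t x => 1 + mu * kappa t * sin x ^+ 2)
    (2 * (`|mu| * K) + 1) (1 + `|mu| * K) a M0.
- move=> t x; apply: le_trans (ler_normD _ _) _; rewrite normr1 lerD2l normrM.
  rewrite -[X in _ <= X]mulr1; apply: ler_pM => //.
  by rewrite normrX expr_le1 // sin_max.
- move=> t x y; have -> : 1 + mu * kappa t * sin x ^+ 2 - (1 + mu * kappa t * sin y ^+ 2)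
     = mu * kappa t * (sin x ^+ 2 - sin y ^+ 2) by ring.
  rewrite normrM; apply: le_trans (_ : (`|mu| * K) * (2 * `|x - y|) <= _).
    by apply: ler_pM => //; exact: sin_sqr_lipschitz.
  by have := normr_ge0 (x - y); lra.
- move=> x xc t; apply: cvgD; first exact: cvg_cst.
  by apply: cvgM; [exact: mc|apply: cvgM; exact: sc].
have pc : continuous phi by move=> t; exact: is_derive_cont.
have [|s [s0 sd]] := @antiderivative R
  (fun t => - mu * kappa t * (sin (phi t) * cos (phi t))).
  move=> t; apply: cvgM; first exact: mc.
  by apply: cvgM; [exact: sc|exact: cc].
by exists (phi, s).
Qed.

(** Gronwall: the square of the difference of two phases, multiplied by
    exp (- c t), has a derivative of order (mu - nu)^2. The amplitude is a
    primitive in which the phase enters in a Lipschitz way. *)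
Lemma prufer_lipschitz (a N T : R) : 0 <= N -> 0 <= T -> exists C, 0 <= C /\
  forall mu nu (p q : (R -> R) * (R -> R)),
  `|mu| <= N -> `|nu| <= N ->
  [/\ p.1 0 = a, p.2 0 = 0,
   forall t, is_derive t 1 p.1 (1 + mu * kappa t * sin (p.1 t) ^+ 2) &
   forall t, is_derive t 1 p.2 (- mu * kappa t * (sin (p.1 t) * cos (p.1 t)))] ->
  [/\ q.1 0 = a, q.2 0 = 0,
   forall t, is_derive t 1 q.1 (1 + nu * kappa t * sin (q.1 t) ^+ 2) &
   forall t, is_derive t 1 q.2 (- nu * kappa t * (sin (q.1 t) * cos (q.1 t)))] ->
  `|p.1 T - q.1 T| <= C * `|mu - nu| /\ `|p.2 T - q.2 T| <= C * `|mu - nu|.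
Proof.
move=> N0 T0; pose c := 4 * (N * K) + 1.
(* any S with S^2 >= T exp (c T) will do *)
pose S := 1 + T * expR (c * T).
have NK0 : 0 <= N * K by rewrite mulr_ge0.
have c0 : 0 <= c by rewrite /c; lra.
have S1 : 1 <= S by rewrite /S lerDl mulr_ge0 // expR_ge0.
exists (K * S + T * (K + 2 * (N * K) * (K * S))); split.
  by rewrite addr_ge0 // mulr_ge0 ?addr_ge0 ?mulr_ge0 //; lra.
move=> mu nu [p1 p2] [q1 q2] /= muN nuN [p10 p20 p1d p2d] [q10 q20 q1d q2d].
pose e := K * `|mu - nu|; have e0 : 0 <= e by rewrite mulr_ge0.
have dif w w' t d : `|w| <= 1 -> `|w - w'| <= 2 * d -> 0 <= d ->
    `|mu * kappa t * w - nu * kappa t * w'| <= e + 2 * (N * K) * d.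
  move=> w1 ww d0.
  have -> : mu * kappa t * w - nu * kappa t * w' =
    (mu - nu) * kappa t * w + nu * kappa t * (w - w') by ring.
  apply: le_trans (ler_normD _ _) _; rewrite !normrM (ger0_norm (k0 t)).
  apply: lerD.
    rewrite -[X in _ <= X]mulr1; apply: ler_pM; rewrite ?mulr_ge0 //.
    by rewrite /e mulrC ler_pM.
  apply: le_trans (_ : (N * K) * (2 * d) <= _); last by lra.
  by apply: ler_pM; rewrite ?mulr_ge0 //; apply: ler_pM.
pose D t := p1 t - q1 t.
have Dd t : is_derive t 1 D (mu * kappa t * sin (p1 t) ^+ 2 - nu * kappa t * sin (q1 t) ^+ 2).
  by rewrite /D; der; ring.
have Db t : `|mu * kappa t * sin (p1 t) ^+ 2 - nu * kappa t * sin (q1 t) ^+ 2| <=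
   e + 2 * (N * K) * `|D t|.
  apply: dif => //; last exact: sin_sqr_lipschitz.
  by rewrite normrX expr_le1 // sin_max.
have Dle t : 0 <= t <= T -> `|D t| <= e * S.
  move=> /andP[t0 tT].
  have gd (x : R) : is_derive x 1 (fun t => D t ^+ 2 * expR (- c * t))
     ((2 * D x * (mu * kappa x * sin (p1 x) ^+ 2 - nu * kappa x * sin (q1 x) ^+ 2)
       - c * D x ^+ 2) * expR (- c * x)).
    by der; rewrite /=; ring.
  have D0 : D 0 = 0 by rewrite /D p10 q10 subrr.
  have ed (x : R) : is_derive x 1 (fun t => e ^+ 2 * t) (e ^+ 2) by der; ring.
  have := derive_le t0 gd ed; rewrite D0 expr0n /= !mul0r mulr0 !subr0.
  move=> H.
  have {}H : D t ^+ 2 * expR (- c * t) <= e ^+ 2 * t.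
    apply: H => x /andP[x0 _].
    have E1 : expR (- c * x) <= 1.
      by rewrite -expR0 ler_expR mulNr oppr_le0 mulr_ge0.
    set u := 2 * D x * _ - _.
    have [u0|u0] := leP u 0.
      by apply: le_trans (_ : 0 <= _); [rewrite mulr_le0_ge0 // expR_ge0|exact: sqr_ge0].
    apply: le_trans (_ : u <= _); first by rewrite ler_piMr // ltW.
    rewrite /u; set v := mu * _ * _ - _.
    have h : D x * v <= `|D x| * (e + 2 * (N * K) * `|D x|).
      by apply: le_trans (ler_norm _) _; rewrite normrM ler_wpM2l //; exact: Db.
    have : 2 * `|D x| * e <= `|D x| ^+ 2 + e ^+ 2 by have := sqr_ge0 (`|D x| - e); rewrite
      sqrrB; lra.
    have -> : D x ^+ 2 = `|D x| ^+ 2 by rewrite real_normK ?num_real.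
    by rewrite /c; lra.
  have {}H : D t ^+ 2 <= e ^+ 2 * t * expR (c * t).
    rewrite -ler_pdivrMr ?expR_gt0 // -expRN -mulNr; exact: H.
  have : D t ^+ 2 <= (e * S) ^+ 2.
    apply: le_trans H _; rewrite [(e * S) ^+ 2]exprMn -mulrA ler_wpM2l ?sqr_ge0 //.
    have h : t * expR (c * t) <= S - 1.
      have -> : S - 1 = T * expR (c * T) by rewrite /S; ring.
      have E0 : 0 <= expR (c * t) by exact: expR_ge0.
      by apply: ler_pM => //; rewrite ler_expR ler_wpM2l.
    apply: le_trans h _; rewrite expr2; apply: le_trans (_ : S * 1 <= _); first lra.
    by rewrite ler_wpM2l //; lra.
  have eS0 : 0 <= e * S by apply: mulr_ge0 => //; exact: le_trans ler01 S1.
  move=> H2; have : `|D t| ^+ 2 <= (e * S) ^+ 2 by rewrite real_normK ?num_real.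
  by rewrite ler_sqr ?nnegrE.
have eE : e = K * `|mu - nu| by [].
have TT : 0 <= T <= T by rewrite T0 lexx.
split.
  apply: le_trans (Dle _ TT) _; rewrite eE.
  have : 0 <= T * (K + 2 * (N * K) * (K * S)) * `|mu - nu|.
    by rewrite !(mulr_ge0, addr_ge0) //; lra.
  lra.
pose B := e + 2 * (N * K) * (e * S).
have sd (x : R) : is_derive x 1 (fun t => p2 t - q2 t)
  (- (mu * kappa x * (sin (p1 x) * cos (p1 x)) - nu * kappa x * (sin (q1 x) * cos (q1 x)))).
  by der; ring.
have sb x : 0 <= x <= T ->
  `|mu * kappa x * (sin (p1 x) * cos (p1 x)) - nu * kappa x * (sin (q1 x) * cos (q1 x))| <= B.
  move=> xT; apply: le_trans (dif _ _ _ (`|D x|) _ _ _) _ => //.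
  - by rewrite normrM mulr_ile1 // ?sin_max ?cos_max.
  - exact: sin_cos_lipschitz.
  - by rewrite lerD2l ler_wpM2l ?mulr_ge0 //; exact: Dle.
have bd b (x : R) : is_derive x 1 (fun t => b * t) b by der; ring.
have BT : B * T <= (K * S + T * (K + 2 * (N * K) * (K * S))) * `|mu - nu|.
  have : 0 <= K * S * `|mu - nu| by rewrite !mulr_ge0 //; lra.
  by rewrite /B eE; lra.
apply: le_trans BT; rewrite ler_norml.
have := derive_le T0 sd (bd B); have := derive_le T0 (bd (- B)) sd.
rewrite !mulr0 !subr0 p20 q20 subrr subr0 => h1 h2; apply/andP; split.
  by rewrite -mulNr; apply: h1 => x /sb; rewrite ler_norml => /andP[? ?]; lra.
by apply: h2 => x /sb; rewrite ler_norml => /andP[? ?]; lra.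
Qed.

Lemma local_lipschitz_continuous f :
  (forall N, 0 <= N -> exists C, 0 <= C /\ forall x y, `|x| <= N -> `|y| <= N ->
     `|f x - f y| <= C * `|x - y|) -> continuous f.
Proof.
move=> H x; have N0 : 0 <= `|x| + 1 by rewrite addr_ge0.
have [C [C0 fl]] := H _ N0.
have C1 : 0 < C + 1 by lra.
apply/cvgrPdist_lt => e e0; near=> y.
have h1 : `|x - y| < e / (C + 1).
  by near: y; apply: (@nbhsx_ballx _ _ x); rewrite divr_gt0.
have h2 : `|x - y| < 1 by near: y; apply: (@nbhsx_ballx _ _ x).
have yN : `|y| <= `|x| + 1.
  have -> : y = x - (x - y) by ring.
  by apply: le_trans (ler_normB _ _) _; rewrite lerD2l ltW.
apply: le_lt_trans (fl _ _ _ yN) _; first by rewrite lerDl.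
move: h1; rewrite ltr_pdivlMr // => h; apply: le_lt_trans h.
by rewrite mulrC ler_wpM2l //; lra.
Unshelve. all: by end_near. Qed.

(** The angle of (w y, y') grows at least at speed w where
    1 + mu kappa >= w^2. It differs from the phase phi, the angle of (y, y'), by
    an arctangent, hence by at most pi / 2 at each end. *)
Lemma phase_growth (mu w a b : R) (phi : R -> R) : 0 < w -> a <= b ->
  (forall t, is_derive t 1 phi (1 + mu * kappa t * sin (phi t) ^+ 2)) ->
  (forall t, a <= t <= b -> w ^+ 2 <= 1 + mu * kappa t) ->
  w * (b - a) - pi <= phi b - phi a.
Proof.
move=> w0 ab pd wk.
pose s t := sin (phi t); pose c t := cos (phi t).
have cs t : c t ^+ 2 = 1 - s t ^+ 2 by rewrite /c /s cos2sin2.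
pose p' t := 1 + mu * kappa t * s t ^+ 2.
have sd t : is_derive t 1 s (c t * p' t) by rewrite /s; der.
have cd t : is_derive t 1 c (- s t * p' t) by rewrite /c; der.
pose n t := (w - 1) * (s t * c t); pose d t := c t ^+ 2 + w * s t ^+ 2.
have s20 t : 0 <= s t ^+ 2 by exact: sqr_ge0.
have c20 t : 0 <= c t ^+ 2 by exact: sqr_ge0.
have pos v t : 0 < v -> 0 < c t ^+ 2 + v * s t ^+ 2.
  move=> v0; rewrite cs; have [s1|s1] := ltP (s t ^+ 2) 1.
    by apply: ltr_pwDl; [rewrite subr_gt0|apply: mulr_ge0 => //; exact: ltW].
  apply: ltr_wpDl; first by rewrite -cs.
  by rewrite mulr_gt0 //; lra.
have d0 t : 0 < d t by exact: pos.
have dn0 t : d t != 0 by rewrite gt_eqF.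
have nd t : is_derive t 1 n ((w - 1) * (c t ^+ 2 - s t ^+ 2) * p' t).
  by rewrite /n; der; ring.
have dd t : is_derive t 1 d (2 * (w - 1) * (s t * c t) * p' t).
  by rewrite /d; der; rewrite /=; ring.
pose g t := c t ^+ 2 + w ^+ 2 * s t ^+ 2.
have g0 t : 0 < g t by rewrite pos // exprn_gt0.
(* phi + atan (n / d) is the angle of (w y, y') *)
have chid (t : R) : is_derive t 1 (fun t => phi t + atan (n t / d t)) (w * p' t / g t).
  der; first exact: dn0.
  rewrite -/(s t) -/(p' t).
  have e : d t ^+ 2 + n t ^+ 2 = g t.
    rewrite /d /n /g !exprMn; move: (cs t) => /[dup] e ->.
    ring.
  have dg : 1 + (n t / d t) ^+ 2 = g t / d t ^+ 2 by rewrite -e; field; exact: dn0.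
  have gn0 : g t != 0 by rewrite gt_eqF.
  have wg : w = g t + (w - 1) * (c t ^+ 2 - w * s t ^+ 2) by rewrite /g cs; ring.
  rewrite dg; apply: (@mulfI _ (g t)) => //.
  have -> : g t * (w * p' t / g t) = w * p' t by field.
  rewrite [X in _ = X * _]wg.
  have h : (c t ^+ 2 - s t ^+ 2) * d t - n t * (2 * (s t * c t)) = c t ^+ 2 - w * s t ^+ 2.
    rewrite /d /n.
    have -> : (w - 1) * (s t * c t) * (2 * (s t * c t)) = 2 * (w - 1) * s t ^+ 2 * c t ^+ 2 by ring.
    by rewrite cs; ring.
  rewrite -h; field; apply/andP; split; [exact: dn0|exact: gn0].
have ld (t : R) : is_derive t 1 (fun t => w * t) w by der; ring.
have := derive_le ab ld chid.
have ap x : - (pi / 2) < atan x < pi / 2 by rewrite atan_gtNpi2 atan_ltpi2.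
move=> H; have {}H : w * b - w * a <= phi b + atan (n b / d b) - (phi a + atan (n a / d a)).
  apply: H => t tab; rewrite ler_pdivlMr //.
  rewrite -subr_ge0 -mulrBr; apply: mulr_ge0; first exact: ltW.
  rewrite /g /p' cs.
  have := wk _ tab; rewrite -subr_ge0 => h.
  have -> : 1 + mu * kappa t * s t ^+ 2 - (1 - s t ^+ 2 + w ^+ 2 * s t ^+ 2) =
    (1 + mu * kappa t - w ^+ 2) * s t ^+ 2 by ring.
  by apply: mulr_ge0.
have /andP[h1 h2] := ap (n b / d b); have /andP[h3 h4] := ap (n a / d a).
by rewrite mulrBr; lra.
Qed.

End Prufer.

(** * Two-dimensional symplectic linear algebra *)

Section LinearAlgebra.
Variable F : fieldType.

Lemma mulmx2E m n (A : 'M[F]_(m, 2)) (B : 'M[F]_(2, n)) i j :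
  (A *m B) i j = A i 0 * B 0 j + A i 1 * B 1 j.
Proof.
rewrite !mxE !big_ord_recl big_ord0 addr0.
by have -> : lift (ord0 : 'I_2) ord0 = 1 by apply: val_inj.
Qed.

Lemma ord2P (P : 'I_2 -> Prop) : P 0 -> P 1 -> forall i, P i.
Proof.
move=> P0 P1 [[|[|//]] i]; first by rewrite (_ : Ordinal i = 0) //; exact: val_inj.
by rewrite (_ : Ordinal i = 1) //; exact: val_inj.
Qed.

(** A vector w annihilated by the image of x |-> x (M - 1) is fixed by M; as
    det M = 1, the rotated vector V is fixed on the other side and
    V N w^T is the symplectic product of V N and V. If the latter is nonzero
    for every fixed V, nothing annihilates both images and they span the
    plane. *)
Lemma symplectic_fredholm (M N : 'M[F]_2) :
  M 0 0 * M 1 1 - M 0 1 * M 1 0 = 1 ->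
  (forall V : 'rV[F]_2, V *m M = V ->
     (V *m N) 0 0 * V 0 1 - (V *m N) 0 1 * V 0 0 = 0 -> V = 0) ->
  forall Y : 'rV[F]_2, exists x V : 'rV[F]_2,
    V *m M = V /\ x *m (M - 1%:M) + V *m N = Y.
Proof.
move=> detM1 H Y.
pose K := kermx (M - 1%:M).
pose A := col_mx (M - 1%:M) (K *m N).
have fA : row_full A.
  rewrite /row_full -mxrank_tr -/(row_free A^T) -kermx_eq0.
  apply/rowV0P => w /sub_kermxP wA.
  have : A *m w^T = 0 by rewrite -[A]trmxK -trmx_mul wA trmx0.
  rewrite mul_col_mx -[0 in RHS](@vsubmxK _ 2 2 1) => /eq_col_mx[].
  rewrite linear0 linear0 mulmxBl mul1mx => /eqP; rewrite subr_eq0 => /eqP Mw KN.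
  (* w rotated by a quarter turn *)
  pose V : 'rV[F]_2 := \row_j (if j == 0 then - w 0 1 else w 0 0).
  have V0 : V 0 0 = - w 0 1 by rewrite mxE.
  have V1 : V 0 1 = w 0 0 by rewrite mxE.
  have Mw0 : M 0 0 * w 0 0 + M 0 1 * w 0 1 = w 0 0.
    by move/matrixP: Mw => /(_ 0 0); rewrite mulmx2E !mxE.
  have Mw1 : M 1 0 * w 0 0 + M 1 1 * w 0 1 = w 0 1.
    by move/matrixP: Mw => /(_ 1 0); rewrite mulmx2E !mxE.
  have VM : V *m M = V.
    apply/rowP; apply: ord2P; rewrite mulmx2E V0 V1.
      have : M 0 0 * (M 1 0 * w 0 0 + M 1 1 * w 0 1) - M 1 0 * (M 0 0 * w 0 0 + M 0 1 * w 0 1)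
         = w 0 1 by rewrite -[RHS]mul1r -detM1; ring.
      by rewrite Mw0 Mw1 => h; rewrite -[in RHS]h; ring.
    have : M 1 1 * (M 0 0 * w 0 0 + M 0 1 * w 0 1) - M 0 1 * (M 1 0 * w 0 0 + M 1 1 * w 0 1)
       = w 0 0 by rewrite -[RHS]mul1r -detM1; ring.
    by rewrite Mw0 Mw1 => h; rewrite -[in RHS]h; ring.
  have [c Vc] : exists c, V = c *m K.
    apply/submxP/sub_kermxP; rewrite mulmxBr mulmx1 VM; exact: subrr.
  have VN : V *m N *m w^T = 0 by rewrite Vc -(mulmxA c K N) -mulmxA KN mulmx0.
  have : V = 0.
    apply: H => //; move/matrixP: VN => /(_ 0 0); rewrite mulmx2E !mxE => h.
    rewrite /= -[RHS]h; ring.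
  move=> V00; apply/rowP; apply: ord2P; rewrite [RHS]mxE.
    by rewrite -V1 V00 mxE.
  by apply/eqP; rewrite -oppr_eq0 -V0 V00 mxE.
have /submxP[z ->] : (Y <= A)%MS by exact: submx_full.
exists (lsubmx z), (rsubmx z *m K); split.
  have := mulmx_ker (M - 1%:M); rewrite mulmxBr mulmx1 -/K => /eqP; rewrite subr_eq0 => /eqP KM.
  by rewrite -mulmxA KM.
by rewrite -{3}[z]hsubmxK mul_row_col mulmxA.
Qed.
End LinearAlgebra.

(** * Periodic solutions of Hill equations *)

Section Hill.
Variable R : realType.
Implicit Types (f g h q : R -> R) (x t : R) (y u v : (R -> R) * (R -> R)).

(** Solutions are carried as pairs (y, y'). *)
Definition hill q h y :=
  (forall t, is_derive t 1 y.1 (y.2 t)) /\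
  (forall t, is_derive t 1 y.2 (h t - q t * y.1 t)).

Lemma hill_cont q h y : hill q h y -> continuous y.1 /\ continuous y.2.
Proof. by move=> [y1 y2]; split=> t; apply: is_derive_cont. Qed.

Lemma hill_eq q g h y : (forall t, g t = h t) -> hill q g y -> hill q h y.
Proof. by move=> /funext ->. Qed.

(** Green's identity, differentiated: the boundary term of y and v has
    derivative h v when v solves the homogeneous equation. *)
Lemma green_identity q h y v : hill q h y -> hill q (fun=> 0) v ->
  forall t, is_derive t 1 (fun t => y.2 t * v.1 t - y.1 t * v.2 t) (h t * v.1 t).
Proof. by move=> [y1 y2] [v1 v2] t; der; ring. Qed.

Lemma wronskian q y v : hill q (fun=> 0) y -> hill q (fun=> 0) v ->
  forall s t, y.2 t * v.1 t - y.1 t * v.2 t = y.2 s * v.1 s - y.1 s * v.2 s.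
Proof.
move=> hy hv s t.
apply: (@is_derive_0_is_cst _ (fun t => y.2 t * v.1 t - y.1 t * v.2 t)) => x.
by apply: der_eq; [exact: green_identity hy hv x|rewrite mul0r].
Qed.

Definition fundamental q u v :=
  [/\ hill q (fun=> 0) u, hill q (fun=> 0) v,
      u.1 0 = 1 /\ u.2 0 = 0 & v.1 0 = 0 /\ v.2 0 = 1].

Lemma fundamental_wronskian q u v : fundamental q u v ->
  forall t, u.1 t * v.2 t - u.2 t * v.1 t = 1.
Proof.
move=> [hu hv [u1 u2] [v1 v2]] t.
by have := wronskian hu hv 0 t; rewrite u1 u2 v1 v2 => H; lra.
Qed.

(** The Wronskians of y with a fundamental system are constant, hence zero,
    and they are the coordinates of y. *)
Lemma hill_unique q u v y s : fundamental q u v -> hill q (fun=> 0) y ->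
  y.1 s = 0 -> y.2 s = 0 -> forall t, y.1 t = 0 /\ y.2 t = 0.
Proof.
move=> fuv hy y1 y2 t; have W := fundamental_wronskian fuv t.
case: fuv => [hu hv _ _].
have := wronskian hy hu s t; rewrite y1 y2 !mul0r subrr => Wu.
have := wronskian hy hv s t; rewrite y1 y2 !mul0r subrr => Wv.
split.
  rewrite -[LHS]mulr1 -W.
  have -> : y.1 t * (u.1 t * v.2 t - u.2 t * v.1 t) =
    v.1 t * (y.2 t * u.1 t - y.1 t * u.2 t) - u.1 t * (y.2 t * v.1 t - y.1 t * v.2 t) by ring.
  by rewrite Wu Wv; ring.
rewrite -[LHS]mulr1 -W.
have -> : y.2 t * (u.1 t * v.2 t - u.2 t * v.1 t) =
  v.2 t * (y.2 t * u.1 t - y.1 t * u.2 t) - u.2 t * (y.2 t * v.1 t - y.1 t * v.2 t) by ring.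
by rewrite Wu Wv; ring.
Qed.

(** Variation of parameters. *)
Lemma hill_particular q h u v : fundamental q u v -> continuous h ->
  exists y, [/\ hill q h y, y.1 0 = 0 & y.2 0 = 0].
Proof.
move=> fuv hc; have W := fundamental_wronskian fuv.
case: fuv => [[u1 u2] [v1 v2] _ _].
have [|A [A0 Ad]] := @antiderivative R (fun t => v.1 t * h t).
  by move=> t; apply: cvgM; [exact: is_derive_cont (v1 t)|exact: hc].
have [|B [B0 Bd]] := @antiderivative R (fun t => u.1 t * h t).
  by move=> t; apply: cvgM; [exact: is_derive_cont (u1 t)|exact: hc].
exists ((fun t => v.1 t * B t - u.1 t * A t), (fun t => v.2 t * B t - u.2 t * A t)).
split; rewrite /= ?A0 ?B0 ?mulr0 ?subrr //; split=> t /=; first by der; ring.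
der; rewrite -[h t in RHS]mulr1 -(W t); ring.
Qed.

Variables (kappa : R -> R) (K : R).
Hypothesis kc : continuous kappa.
Hypothesis k0 : forall t, 0 <= kappa t.
Hypothesis kK : forall t, kappa t <= K.
Let q mu t := 1 + mu * kappa t.

Let prufer_spec (mu a : R) (p : (R -> R) * (R -> R)) := [/\ p.1 0 = a, p.2 0 = 0,
   forall t, is_derive t 1 p.1 (1 + mu * kappa t * sin (p.1 t) ^+ 2) &
   forall t, is_derive t 1 p.2 (- mu * kappa t * (sin (p.1 t) * cos (p.1 t)))].

Lemma prufer_hill mu a p : prufer_spec mu a p ->
  hill (q mu) (fun=> 0) ((fun t => expR (p.2 t) * sin (p.1 t)),
                         (fun t => expR (p.2 t) * cos (p.1 t))).
Proof.
have cs t : cos t ^+ 2 = 1 - sin t ^+ 2 :> R by rewrite cos2sin2.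
move=> [_ _ p1 p2]; split=> t /=; der.
  have -> : expR (p.2 t) * (- mu * kappa t * (sin (p.1 t) * cos (p.1 t))) * sin (p.1 t) +
   expR (p.2 t) * (cos (p.1 t) * (1 + mu * kappa t * sin (p.1 t) ^+ 2)) =
   expR (p.2 t) * cos (p.1 t) by ring.
  by [].
rewrite /q.
have -> : expR (p.2 t) * (- mu * kappa t * (sin (p.1 t) * cos (p.1 t))) * cos (p.1 t) +
   expR (p.2 t) * (- sin (p.1 t) * (1 + mu * kappa t * sin (p.1 t) ^+ 2)) =
   expR (p.2 t) * sin (p.1 t) * (- mu * kappa t * cos (p.1 t) ^+ 2 - 1 - mu * kappa t * sin
     (p.1 t) ^+ 2) by ring.
rewrite cs; ring.
Qed.

Lemma prufer_fundamental mu p r : prufer_spec mu (pi / 2) p -> prufer_spec mu 0 r ->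
  fundamental (q mu) ((fun t => expR (p.2 t) * sin (p.1 t)), (fun t => expR (p.2 t) * cos (p.1 t)))
    ((fun t => expR (r.2 t) * sin (r.1 t)), (fun t => expR (r.2 t) * cos (r.1 t))).
Proof.
move=> hp hr; split; [exact: prufer_hill hp|exact: prufer_hill hr|..].
  case: hp => p1 p2 _ _.
  by rewrite /= p1 p2 expR0 sin_pihalf cos_pihalf mulr1 mulr0.
case: hr => r1 r2 _ _.
by rewrite /= r1 r2 expR0 sin0 cos0 mulr1 mulr0.
Qed.

Lemma fundamental_exists mu : exists u v, fundamental (q mu) u v.
Proof.
have [p hp] := prufer_exists kc k0 kK mu (pi / 2).
have [r hr] := prufer_exists kc k0 kK mu 0.
by eexists; eexists; exact: prufer_fundamental hp hr.
Qed.

Variables (T a b del : R).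
Hypothesis a0 : 0 <= a.
Hypothesis ab : a < b.
Hypothesis bT : b <= T.
Hypothesis del0 : 0 < del.
Hypothesis kdel : forall t, a <= t <= b -> del <= kappa t.

Lemma IVT_continuous f (x y c : R) : continuous f -> x <= y -> f x <= c <= f y \/ f y <= c <= f x ->
  exists z, x <= z <= y /\ f z = c.
Proof.
move=> fc xy H; have [||z] := @IVT R f x y c xy.
- exact: continuous_subspaceT.
- by rewrite ge_min le_max; case: H => /andP[-> ->]; rewrite ?orbT.
- by rewrite in_itv /= => zxy fz; exists z.
Qed.

(** When the phase of the Dirichlet solution v at T is a multiple of pi,
    v(T) = 0 and the monodromy matrix is triangular with diagonal u(T), v'(T)
    of product 1; its trace is then >= 2 or <= -2 according to the parity of the
    multiple. By the intermediate value theorem both occur for arbitrarily large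
    mu, and so does trace 2, which means eigenvalue 1. *)
Lemma periodic_eigenvalue M : exists mu y, [/\ M < mu, hill (q mu) (fun=> 0) y,
  y.1 T = y.1 0 /\ y.2 T = y.2 0 & ~ (y.1 0 = 0 /\ y.2 0 = 0)].
Proof.
have T0 : 0 <= T by apply: le_trans bT; apply: le_trans (ltW ab).
have /choice[p hp] : forall mu, exists p, prufer_spec mu (pi / 2) p.
  by move=> mu; exact: prufer_exists.
have /choice[r hr] : forall mu, exists p, prufer_spec mu 0 p.
  by move=> mu; exact: prufer_exists.
have cont (c : R) (w : R -> (R -> R) * (R -> R)) : (forall mu, prufer_spec mu c (w mu)) ->
    continuous (fun mu => (w mu).1 T) /\ continuous (fun mu => (w mu).2 T).
  move=> hw; split; apply: local_lipschitz_continuous => N N0;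
  have [C [C0 HC]] := prufer_lipschitz k0 kK c N0 T0; exists C; split => // x z xN zN;
  have [] := HC _ _ _ _ xN zN (hw x) (hw z); by [].
have [p1c p2c] := cont _ _ hp; have [r1c r2c] := cont _ _ hr.
pose ph mu := (r mu).1 T.
pose tr mu := expR ((p mu).2 T) * sin ((p mu).1 T) + expR ((r mu).2 T) * cos ((r mu).1 T).
have trc : continuous tr.
  move=> mu; apply: cvgD; apply: cvgM; (apply: continuous_comp; first by [exact: p2c|exact:
    p1c|exact: r2c|exact: r1c]);
  by [exact: continuous_expR|exact: continuous_sin|exact: continuous_cos].
have grow mu w : 0 <= mu -> 0 < w -> w ^+ 2 <= mu * del -> w * (b - a) - pi <= ph mu.
  move=> mu0 w0 wmu; have [r10 _ rd _] := hr mu.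
  have := phase_growth w0 (ltW ab) rd.
  have mon s t : s <= t -> (r mu).1 s <= (r mu).1 t.
    move=> st; rewrite -subr_ge0.
    have := @derive_le R (fun=> 0) (r mu).1 (fun=> 0) _ s t st (fun x => der_cst 0 x 1) rd.
    rewrite subrr; apply=> x _; rewrite addr_ge0 // mulr_ge0 ?sqr_ge0 //.
    by rewrite mulr_ge0.
  have := mon _ _ a0; have := mon _ _ bT; rewrite r10 -/(ph mu) => h1 h2 H.
  have : w * (b - a) - pi <= (r mu).1 b - (r mu).1 a; last by lra.
  apply: H => t /kdel h; have : mu * del <= mu * kappa t by rewrite ler_wpM2l.
  lra.
have big L M' : exists mu, M' <= mu /\ L <= ph mu.
  have ba0 : 0 < b - a by rewrite subr_gt0.
  (* w (b - a) - pi exceeds L, and mu >= w^2 / del makes w admissible on [a, b] *)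
  pose w := (`|L| + pi + 1) / (b - a).
  have w0 : 0 < w by rewrite divr_gt0 // ltr_pwDr // addr_ge0 // pi_ge0.
  exists (`|M'| + w ^+ 2 / del); split.
    by apply: le_trans (ler_norm _) _; rewrite lerDl divr_ge0 ?sqr_ge0 // ltW.
  apply: le_trans (grow _ w _ w0 _).
  - rewrite /w divfK ?gt_eqF //; have := ler_norm L; lra.
  - by rewrite addr_ge0 // divr_ge0 ?sqr_ge0 // ltW.
  - by rewrite mulrDl divfK ?gt_eqF // lerDr mulr_ge0 // ltW.
have W mu : expR ((p mu).2 T) * sin ((p mu).1 T) * (expR ((r mu).2 T) * cos ((r mu).1 T)) -
  expR ((p mu).2 T) * cos ((p mu).1 T) * (expR ((r mu).2 T) * sin ((r mu).1 T)) = 1.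
  exact: fundamental_wronskian (prufer_fundamental (hp mu) (hr mu)) T.
pose M0 := `|M| + 1.
have [n hn] : exists n : nat, ph M0 <= (pi *+ 2) *+ n.
  exists (Num.truncn `|ph M0|).+1.
  apply: le_trans (ler_norm _) _; apply: le_trans (ltW (truncnS_gt _)) _.
  rewrite -[(pi *+ 2) *+ _]mulr_natl ler_peMr // mulr2n.
  by have := pi_ge2 R; lra.
(* m1 and m2 are consecutive passages of the phase through multiples of pi *)
have [B1 [MB1 phB1]] := big ((pi *+ 2) *+ n) M0.
have [m1 [/andP[Mm1 m1B1] ph1]] : exists z, M0 <= z <= B1 /\ ph z = (pi *+ 2) *+ n.
  by apply: IVT_continuous => //; left; rewrite hn.
have [B2 [MB2 phB2]] := big ((pi *+ 2) *+ n + pi) m1.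
have [m2 [/andP[Mm2 m2B2] ph2]] : exists z, m1 <= z <= B2 /\ ph z = (pi *+ 2) *+ n + pi.
  by apply: IVT_continuous => //; left; rewrite phB2 ph1 lerDl pi_ge0.
have cosn : cos ((pi *+ 2) *+ n) = 1 :> R.
  by rewrite -[X in cos X]add0r (periodicn (@cosD2pi R)) cos0.
have sinn : sin ((pi *+ 2) *+ n) = 0 :> R.
  by rewrite -[X in sin X]add0r (periodicn (@sinD2pi R)) sin0.
have tr1 : 2 <= tr m1.
  have := W m1; rewrite -/(ph m1) ph1 cosn sinn !mulr0 subr0 mulr1 /tr -/(ph m1) ph1 cosn mulr1.
  move: (_ * sin _) (expR_gt0 ((r m1).2 T)); move: (expR _) => d c d0 cd.
  have dc : c = d^-1 by apply: (mulIf (lt0r_neq0 d0)); rewrite cd mulVf ?gt_eqF.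
  have : 0 <= (d - 1) ^+ 2 / d by rewrite divr_ge0 ?sqr_ge0 // ltW.
  have -> : (d - 1) ^+ 2 / d = c + d - 2 by rewrite dc; field; rewrite gt_eqF.
  by rewrite subr_ge0.
have tr2 : tr m2 <= - 2.
  have := W m2; rewrite -/(ph m2) ph2 cosDpi sinDpi cosn sinn oppr0 !mulr0 subr0 /tr -/(ph m2)
    ph2 cosDpi cosn.
  move: (_ * sin _) (expR_gt0 ((r m2).2 T)); move: (expR _) => d c d0 cd.
  have dc : c = - d^-1.
    by apply: (mulIf (lt0r_neq0 d0)); rewrite mulNr mulVf ?gt_eqF // -cd; ring.
  have : 0 <= (d - 1) ^+ 2 / d by rewrite divr_ge0 ?sqr_ge0 // ltW.
  have -> : (d - 1) ^+ 2 / d = - (c - d) - 2 by rewrite dc; field; rewrite gt_eqF.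
  by lra.
have [mu [/andP[m1mu _] trmu]] : exists z, m1 <= z <= m2 /\ tr z = 2.
  by apply: IVT_continuous => //; right; rewrite tr1 andbT; lra.
have Mmu : M < mu.
  apply: lt_le_trans m1mu; apply: lt_le_trans Mm1; rewrite /M0.
  by have := ler_norm M; lra.
have := prufer_fundamental (hp mu) (hr mu); move: (W mu) trmu; rewrite /tr.
set u := (X in fundamental _ X _); set v := (X in fundamental _ _ X).
move=> _ trmu' fuv.
have Wuv : u.1 T * v.2 T - u.2 T * v.1 T = 1 by exact: fundamental_wronskian fuv T.
have tuv : u.1 T + v.2 T = 2 by exact: trmu'.
have [hu hv [u1 u2] [v1 v2]] := fuv.
clear trmu' fuv; clearbody u v.
have sol (c d : R) : c * (u.1 T - 1) + d * v.1 T = 0 ->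
   c * u.2 T + d * (v.2 T - 1) = 0 -> ~ (c = 0 /\ d = 0) ->
  exists mu y, [/\ M < mu, hill (q mu) (fun=> 0) y,
  y.1 T = y.1 0 /\ y.2 T = y.2 0 & ~ (y.1 0 = 0 /\ y.2 0 = 0)].
  move=> e1 e2 cd.
  exists mu, ((fun t => c * u.1 t + d * v.1 t), (fun t => c * u.2 t + d * v.2 t)).
  split=> //.
  - case: hu hv => hu1 hu2 [hv1 hv2]; split=> t /=; der; ring.
  - by rewrite /= u1 u2 v1 v2; split; [move: e1|move: e2]; lra.
  - by rewrite /= u1 u2 v1 v2 => -[]; rewrite !mulr0 !mulr1 ?addr0 ?add0r => ? ?; apply: cd.
have [[v0 uu]|nz] := pselect (v.1 T = 0 /\ 1 - u.1 T = 0).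
  apply: (sol 0 1); first by rewrite v0; ring.
    by move: tuv uu; lra.
  by move=> [_] /eqP; rewrite oner_eq0.
(* an explicit eigenvector; it is zero only in the case treated above *)
apply: (sol (v.1 T) (1 - u.1 T)) => //; first by ring.
have -> : v.1 T * u.2 T + (1 - u.1 T) * (v.2 T - 1) =
  (u.1 T + v.2 T) - 1 - (u.1 T * v.2 T - u.2 T * v.1 T) by ring.
by rewrite Wuv tuv; ring.
Qed.

Lemma local_cst_derive f (c d x y : R) : (forall t, x < t < y -> f t = 0) -> x < c < y ->
  is_derive c 1 f d -> d = 0.
Proof.
move=> f0 /andP[xc cy] fd.
have : is_derive c 1 (fun _ : R => 0 : R) d.
  apply: near_eq_is_derive fd; near=> t; apply: f0.
  by near: t; apply: (@near_in_itvoo _ x y); rewrite in_itv /= xc.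
by move=> [_ <-]; rewrite derive_cst.
Unshelve. all: by end_near. Qed.

(** The unknown y1 is the coefficient of the logarithm. With N the map
    sending initial data of y1 to the final data of the response to
    - k kappa y1, the symplectic product of V N and V is, by Green's identity
    and up to sign, k times the integral of kappa y1^2. It vanishes only if y1 = 0 on the interval
    where kappa is bounded below, hence everywhere, so symplectic_fredholm
    applies. *)
Lemma hill_resonant mu k h : k != 0 -> continuous h ->
  exists y0 y1, [/\ hill (q mu) (fun=> 0) y1,
    hill (q mu) (fun t => h t - k * kappa t * y1.1 t) y0,
    y0.1 T = y0.1 0 /\ y0.2 T = y0.2 0 & y1.1 T = y1.1 0 /\ y1.2 T = y1.2 0].
Proof.
move=> kn0 hc.
have T0 : 0 <= T by apply: le_trans bT; apply: le_trans (ltW ab).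
have [u [v fuv]] := fundamental_exists mu.
have Wuv := fundamental_wronskian fuv T.
have [hu hv [u1 u2] [v1 v2]] := fuv.
have [uc _] := hill_cont hu; have [vc _] := hill_cont hv.
have gc w : continuous w -> continuous (fun t => - k * kappa t * w t).
  move=> wc t; apply: cvgM; last exact: wc.
  by apply: cvgM; [exact: cvg_cst|exact: kc].
have [p [hp p10 p20]] := hill_particular fuv hc.
have [f [hf f10 f20]] := hill_particular fuv (gc _ uc).
have [g [hg g10 g20]] := hill_particular fuv (gc _ vc).
pose mk (x y z w : R) : 'M[R]_2 := \matrix_(i, j)
  if i == 0 then (if j == 0 then x else y) else (if j == 0 then z else w).
pose M := mk (u.1 T) (u.2 T) (v.1 T) (v.2 T).
pose N := mk (f.1 T) (f.2 T) (g.1 T) (g.2 T).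
have mkE (x y z w : R) : [/\ mk x y z w 0 0 = x, mk x y z w 0 1 = y, mk x y z w 1 0 = z & mk x
  y z w 1 1 = w].
  by rewrite !mxE.
have [M00 M01 M10 M11] := mkE (u.1 T) (u.2 T) (v.1 T) (v.2 T).
have [N00 N01 N10 N11] := mkE (f.1 T) (f.2 T) (g.1 T) (g.2 T).
have comb c d : hill (q mu) (fun=> 0) ((fun t => c * u.1 t + d * v.1 t), (fun t => c * u.2 t +
  d * v.2 t)).
  by case: hu hv => hu1 hu2 [hv1 hv2]; split=> t /=; der; ring.
have ndeg (V : 'rV[R]_2) : V *m M = V ->
     (V *m N) 0 0 * V 0 1 - (V *m N) 0 1 * V 0 0 = 0 -> V = 0.
  move=> VM; rewrite !mulmx2E N00 N01 N10 N11 => VN.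
  pose c := V 0 0; pose d := V 0 1.
  have Mc : c * u.1 T + d * v.1 T = c.
    by have := congr1 (fun V : 'rV[R]_2 => V 0 0) VM; rewrite mulmx2E M00 M10.
  have Md : c * u.2 T + d * v.2 T = d.
    by have := congr1 (fun V : 'rV[R]_2 => V 0 1) VM; rewrite mulmx2E M01 M11.
  pose w : (R -> R) * (R -> R) := ((fun t => c * u.1 t + d * v.1 t), (fun t => c * u.2 t + d *
    v.2 t)).
  have hw : hill (q mu) (fun=> 0) w by exact: comb.
  pose G : (R -> R) * (R -> R) := ((fun t => c * f.1 t + d * g.1 t), (fun t => c * f.2 t + d *
    g.2 t)).
  have hG : hill (q mu) (fun t => - k * kappa t * w.1 t) G.
    by case: hf hg => hf1 hf2 [hg1 hg2]; rewrite /w; split=> t /=; der; ring.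
  (* E is the integral of kappa w^2, by Green's identity *)
  pose E t := - k^-1 * (G.2 t * w.1 t - G.1 t * w.2 t).
  have Ed t : is_derive t 1 E (kappa t * w.1 t ^+ 2).
    notypeclasses refine (der_eq (der_mul (der_cst _ _ _) (green_identity hG hw t)) _).
    by cbv beta; field.
  have E0 : E 0 = 0 by rewrite /E /= f10 f20 g10 g20; ring.
  have ET : E T = 0.
    rewrite /E /= Mc Md; have -> : (c * f.2 T + d * g.2 T) * c - (c * f.1 T + d * g.1 T) * d =
      - ((c * f.1 T + d * g.1 T) * d - (c * f.2 T + d * g.2 T) * c) by ring.
    by rewrite VN; ring.
  have mon s t : s <= t -> E s <= E t.
    move=> st; rewrite -subr_ge0.
    have := @derive_le R (fun=> 0) E (fun=> 0) _ s t st (fun x => der_cst 0 x 1) Ed.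
    by rewrite subrr; apply=> x _; rewrite mulr_ge0 ?sqr_ge0.
  have Ez t : 0 < t < T -> E t = 0.
    move=> /andP[t0 tT]; have := mon t T (ltW tT); have := mon 0 t (ltW t0).
    by rewrite ET E0 => h1 h2; apply/eqP; rewrite eq_le h1 h2.
  have wz t : a < t < b -> w.1 t = 0.
    move=> /andP[at' tb].
    have tT : 0 < t < T by rewrite (le_lt_trans a0 at') (lt_le_trans tb bT).
    have /eqP := local_cst_derive Ez tT (Ed t).
    rewrite mulf_eq0 sqrf_eq0 => /orP[/eqP kt|/eqP //].
    have atb : a <= t <= b by rewrite !ltW.
    by move: (kdel atb); rewrite kt leNgt del0.
  pose s := (a + b) / 2; have sab : a < s < b by rewrite /s; move: ab; lra.
  have w2s : w.2 s = 0 by exact: local_cst_derive wz sab (hw.1 s).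
  have := hill_unique fuv hw (wz s sab) w2s 0.
  rewrite /= u1 u2 v1 v2 !mulr1 !mulr0 addr0 add0r => -[c0 d0].
  by apply/rowP; apply: ord2P; rewrite mxE.
have detM : M 0 0 * M 1 1 - M 0 1 * M 1 0 = 1 by rewrite M00 M01 M10 M11.
pose Y : 'rV[R]_2 := \row_j (if j == 0 then - p.1 T else - p.2 T).
have [x [V [VM xV]]] := symplectic_fredholm detM ndeg Y.
have VMc j := congr1 (fun V : 'rV[R]_2 => V 0 j) VM.
have xVc j := congr1 (fun V : 'rV[R]_2 => V 0 j) xV.
pose c := V 0 0; pose d := V 0 1.
pose y1 : (R -> R) * (R -> R) := ((fun t => c * u.1 t + d * v.1 t), (fun t => c * u.2 t + d *
  v.2 t)).
pose y0 : (R -> R) * (R -> R) :=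
  ((fun t => p.1 t + c * f.1 t + d * g.1 t + x 0 0 * u.1 t + x 0 1 * v.1 t),
   (fun t => p.2 t + c * f.2 t + d * g.2 t + x 0 0 * u.2 t + x 0 1 * v.2 t)).
exists y0, y1; split.
- exact: comb.
- case: hu hv hp => hu1 hu2 [hv1 hv2] [hp1 hp2]; case: hf hg => hf1 hf2 [hg1 hg2].
  by split=> t /=; der; ring.
- have addE (A B : 'rV[R]_2) j : (A + B) 0 j = A 0 j + B 0 j by rewrite mxE.
  have subE i j : (M - 1%:M) i j = M i j - (i == j)%:R.
    by rewrite mxE [X in _ + X]mxE [X in - X]mxE.
  have Y0 : Y 0 0 = - p.1 T by rewrite mxE.
  have Y1 : Y 0 1 = - p.2 T by rewrite mxE.
  have := xVc 0; rewrite addE !mulmx2E !subE N00 N10 M00 M10 Y0 /= => e0.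
  have := xVc 1; rewrite addE !mulmx2E !subE N01 N11 M01 M11 Y1 /= => e1.
  rewrite /= p10 p20 f10 f20 g10 g20 u1 u2 v1 v2; split.
    by move: e0; rewrite /c /d; lra.
  by move: e1; rewrite /c /d; lra.
- rewrite /= u1 u2 v1 v2 !mulr1 !mulr0 addr0 add0r; split.
    by have := VMc 0; rewrite mulmx2E M00 M10.
  by have := VMc 1; rewrite mulmx2E M01 M11.
Qed.

Hypothesis kper : forall t, kappa (t + T) = kappa t.

(** A shift by the period gives a second solution with the same data at 0. *)
Lemma hill_periodic mu h y : hill (q mu) h y -> (forall t, h (t + T) = h t) ->
  y.1 T = y.1 0 -> y.2 T = y.2 0 -> forall t, y.1 (t + T) = y.1 t.
Proof.
move=> [hy1 hy2] hp e1 e2 t.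
have [u [v fuv]] := fundamental_exists mu.
pose w : (R -> R) * (R -> R) := ((fun t => y.1 (t + T) - y.1 t), (fun t => y.2 (t + T) - y.2 t)).
have hw : hill (q mu) (fun=> 0) w.
  by split=> s /=; der; rewrite /= ?hp /q ?kper; ring.
have [||/eqP +_] := hill_unique (s := 0) fuv hw _ _ t; rewrite /= ?add0r ?e1 ?e2 ?subrr //.
by rewrite subr_eq0 => /eqP.
Qed.

End Hill.

(** * Smooth periodic functions *)

Section Smooth.
Variable R : realType.
Implicit Types (f g h : R -> R) (x t : R).

(** Differentiability to a finite order is what induction can reach;
    smoothness is the conjunction over all orders. *)
Fixpoint smooth_upto (n : nat) f : Prop :=
  if n is n'.+1 then (forall x, derivable f x 1) /\ smooth_upto n' (derive1 f) else True.

Definition smper f := (forall n, smooth_upto n f) /\ (forall t, f (t + 2 * pi) = f t).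

Lemma smooth_uptoI n f f' : (forall x, is_derive x 1 f (f' x)) -> smooth_upto n f' ->
  smooth_upto n.+1 f.
Proof.
move=> fd sf; split=> [x|]; first by case: (fd x).
by rewrite (_ : derive1 f = f') //; apply/funext => x; exact: is_derive_derive1.
Qed.

Lemma smooth_uptoW n f : smooth_upto n.+1 f -> smooth_upto n f.
Proof. by elim: n f => //= n IH f [fd /IH]. Qed.

Lemma smooth_upto_is_derive n f : smooth_upto n.+1 f -> forall x, is_derive x 1 f (derive1 f x).
Proof. by move=> [fd _] x; exact: derivable_is_derive. Qed.

Lemma smooth_upto_cst n c : smooth_upto n (fun _ => c).
Proof.
elim: n c => // n IH c; notypeclasses refine (smooth_uptoI (f' := fun=> 0) _ _) => // x.
exact: der_cst.
Qed.

Lemma smooth_uptoD n f g : smooth_upto n f -> smooth_upto n g -> smooth_upto n (fun x => f x + g x).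
Proof.
elim: n f g => // n IH f g sf sg.
have fd := smooth_upto_is_derive sf; have gd := smooth_upto_is_derive sg.
notypeclasses refine (smooth_uptoI (f' := fun x => derive1 f x + derive1 g x) _ _).
  by move=> x; der.
by apply: IH; [case: sf|case: sg].
Qed.

Lemma smooth_uptoM n f g : smooth_upto n f -> smooth_upto n g -> smooth_upto n (fun x => f x * g x).
Proof.
elim: n f g => // n IH f g sf sg.
have fd := smooth_upto_is_derive sf; have gd := smooth_upto_is_derive sg.
notypeclasses refine (smooth_uptoI (f' := fun x => derive1 f x * g x + f x * derive1 g x) _ _).
  by move=> x; der.
by apply: smooth_uptoD; apply: IH; [case: sf|exact: smooth_uptoW|exact: smooth_uptoW|case: sg].
Qed.

Lemma smooth_uptoV n f : (forall x, f x != 0) -> smooth_upto n f -> smooth_upto n (fun x => (f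
  x)^-1).
Proof.
move=> f0; elim: n => // n IH sf; have fd := smooth_upto_is_derive sf.
notypeclasses refine (smooth_uptoI (f' := fun x => (-1) * derive1 f x * ((f x)^-1 * (f x)^-1)) _ _).
  by move=> x; der; [exact: f0|field; exact: f0].
apply: smooth_uptoM; first by apply: smooth_uptoM; [exact: smooth_upto_cst|case: sf].
by apply: smooth_uptoM; apply: IH; exact: smooth_uptoW.
Qed.

Lemma smooth_upto_sin_cos n : smooth_upto n (fun t => sin t : R) /\ smooth_upto n (fun t => cos
  t : R).
Proof.
elim: n => // n [IHs IHc]; split.
  by notypeclasses refine (smooth_uptoI (f' := fun t => cos t) _ _) => // x; exact: is_derive_sin.
notypeclasses refine (smooth_uptoI (f' := fun t => (-1) * sin t) _ _).
  by move=> x; der; ring.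
by apply: smooth_uptoM => //; exact: smooth_upto_cst.
Qed.

Lemma smooth_upto_expR n f : smooth_upto n f -> smooth_upto n (fun x => expR (f x)).
Proof.
elim: n => // n IH sf; have fd := smooth_upto_is_derive sf.
notypeclasses refine (smooth_uptoI (f' := fun x => expR (f x) * derive1 f x) _ _).
  by move=> x; der.
by apply: smooth_uptoM; [apply: IH; exact: smooth_uptoW|case: sf].
Qed.

Lemma smooth_upto_ln n f : (forall x, 0 < f x) -> smooth_upto n f -> smooth_upto n (fun x => ln
  (f x)).
Proof.
move=> f0; case: n => // n sf; have fd := smooth_upto_is_derive sf.
notypeclasses refine (smooth_uptoI (f' := fun x => (f x)^-1 * derive1 f x) _ _).
  by move=> x; der; first exact: f0.
apply: smooth_uptoM; last by case: sf.
by apply: smooth_uptoV; [move=> x; rewrite gt_eqF|exact: smooth_uptoW].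
Qed.

(** Bootstrap: y and y' gain one derivative at a time from the equation. *)
Lemma hill_smooth q h (y : (R -> R) * (R -> R)) : (forall n, smooth_upto n q) -> (forall n,
  smooth_upto n h) ->
  hill q h y -> forall n, smooth_upto n y.1.
Proof.
move=> sq sh [y1 y2] n; suff : smooth_upto n y.1 /\ smooth_upto n y.2 by case.
elim: n => // n [IH1 IH2]; split; first exact: smooth_uptoI y1 IH2.
notypeclasses refine (smooth_uptoI (f' := fun t => h t + (-1) * (q t * y.1 t)) _ _).
  by move=> x; der; ring.
apply: smooth_uptoD => //; apply: smooth_uptoM; first exact: smooth_upto_cst.
exact: smooth_uptoM.
Qed.

Lemma smper_cst c : smper (fun=> c).
Proof. by split=> // n; exact: smooth_upto_cst. Qed.
Lemma smperD f g : smper f -> smper g -> smper (fun x => f x + g x).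
Proof. by move=> [sf pf] [sg pg]; split=> [n|t]; [exact: smooth_uptoD|rewrite pf pg]. Qed.
Lemma smperM f g : smper f -> smper g -> smper (fun x => f x * g x).
Proof. by move=> [sf pf] [sg pg]; split=> [n|t]; [exact: smooth_uptoM|rewrite pf pg]. Qed.
Lemma smperN f : smper f -> smper (fun x => - f x).
Proof.
move=> sf; rewrite (_ : (fun x => - f x) = (fun x => (-1) * f x)).
  by apply: smperM => //; exact: smper_cst.
by apply/funext => x; ring.
Qed.
Lemma smperB f g : smper f -> smper g -> smper (fun x => f x - g x).
Proof. by move=> sf /smperN sg; exact: smperD. Qed.
Lemma smperX f n : smper f -> smper (fun x => f x ^+ n).
Proof.
move=> sf; elim: n => [|n IH]; first exact: smper_cst.
rewrite (_ : (fun x => f x ^+ n.+1) = (fun x => f x * f x ^+ n)); first exact: smperM.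
by apply/funext => x; rewrite exprS.
Qed.
Lemma smperV f : (forall x, f x != 0) -> smper f -> smper (fun x => (f x)^-1).
Proof. by move=> f0 [sf pf]; split=> [n|t]; [exact: smooth_uptoV|rewrite pf]. Qed.
Lemma smper_ln f : (forall x, 0 < f x) -> smper f -> smper (fun x => ln (f x)).
Proof. by move=> f0 [sf pf]; split=> [n|t]; [exact: smooth_upto_ln|rewrite pf]. Qed.
Lemma smper_expR f : smper f -> smper (fun x => expR (f x)).
Proof. by move=> [sf pf]; split=> [n|t]; [exact: smooth_upto_expR|rewrite pf]. Qed.
Lemma smper_sin : smper (fun t => sin t).
Proof.
split=> [n|t]; first exact: (smooth_upto_sin_cos n).1.
by rewrite mulr_natl sinD2pi.
Qed.
Lemma smper_cos : smper (fun t => cos t).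
Proof.
split=> [n|t]; first exact: (smooth_upto_sin_cos n).2.
by rewrite mulr_natl cosD2pi.
Qed.
Lemma smper_is_derive f : smper f -> forall t, is_derive t 1 f (derive1 f t).
Proof. by move=> [sf _]; exact: smooth_upto_is_derive (sf 1%N). Qed.
Lemma smper_derive1 f : smper f -> smper (derive1 f).
Proof.
move=> sf; have fd := smper_is_derive sf; have [smf pf] := sf; split=> [n|t].
  by case: (smf n.+1).
have h : is_derive t 1 (fun s => f (s + 2 * pi)) (derive1 f (t + 2 * pi)).
  by der; ring.
rewrite (_ : (fun s => _) = f) in h; last by apply/funext => s; rewrite pf.
by rewrite (is_derive_derive1 h).
Qed.
Lemma smper_continuous f : smper f -> continuous f.
Proof. by move=> /smper_is_derive fd t; exact: is_derive_cont (fd t). Qed.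

Lemma periodic_int f (n : int) t : (forall t, f (t + 2 * pi) = f t) ->
  f (t + n%:~R * (2 * pi)) = f t.
Proof.
move=> pf.
have pfn (k : nat) u : f (u + k%:R * (2 * pi)) = f u.
  elim: k => [|k IH]; first by rewrite mul0r addr0.
  by rewrite -[RHS]IH -[RHS]pf -[k.+1%:R]natr1; congr f; ring.
case: n => n; first by rewrite pmulrn pfn.
rewrite NegzE mulrNz -[t in RHS](subrK (n.+1%:R * (2 * pi))) pfn.
by congr f; rewrite pmulrn; ring.
Qed.

(** Two numbers with the same cosine and sine differ by a multiple of
    2 pi, so a periodic function of the angle does not depend on the branch. *)
Lemma periodic_angle f s t : (forall t, f (t + 2 * pi) = f t) ->
  cos s = cos t -> sin s = sin t -> f s = f t.
Proof.
move=> pf cst sst.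
pose d := s - t.
have cd : cos d = 1.
  by rewrite /d cosB cst sst -!expr2 cos2Dsin2.
have p2 : 0 < 2 * pi :> R by rewrite mulr_gt0 // pi_gt0.
pose n := Num.floor (d / (2 * pi)).
pose e := d - n%:~R * (2 * pi).
have e0 : 0 <= e by rewrite /e subr_ge0 -ler_pdivlMr // floor_le.
have e1 : e < 2 * pi.
  rewrite /e ltrBlDl -[X in _ + X]mul1r -mulrDl -ltr_pdivrMr //.
  by have := floorD1_gt (d / (2 * pi)); rewrite intrD.
have de : d = e + n%:~R * (2 * pi) by rewrite /e subrK.
have ce : cos e = 1.
  by rewrite -cd de periodic_int // => u; rewrite mulr_natl cosD2pi.
have e2 : sin (e / 2) = 0.
  have : cos (e / 2 + e / 2) = 1 by rewrite -[RHS]ce; congr cos; field.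
  rewrite cosD -!expr2 cos2sin2 => h.
  by apply/eqP; rewrite -sqrf_eq0; apply/eqP; move: h; lra.
have {}e0 : e = 0.
  apply/eqP; rewrite eq_le e0 andbT leNgt; apply/negP => ep.
  have := @sin_gt0_pi R (e / 2); rewrite e2 ltxx => H.
  suff : false by []; apply: H; apply/andP; split; lra.
have -> : s = t + n%:~R * (2 * pi) by rewrite -[s](subrK t) -/d de e0; ring.
exact: periodic_int.
Qed.
End Smooth.

(** * Differentiability in the plane *)

Section Lines.
Variables (R : realType) (V W : normedModType R).

(** Reduces directional derivatives to derivatives of functions of one
    variable. *)
Lemma is_derive_line (f : V -> W) (p v : V) (s : R) (d : W) :
  is_derive (p + s *: v) v f d <-> is_derive s 1 (fun h : R => f (p + h *: v)) d.
Proof.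
have e : (fun h : R => h^-1 *: ((f \o shift (p + s *: v)) (h *: v) - f (p + s *: v))) =
   (fun h : R => h^-1 *: (((fun h : R => f (p + h *: v)) \o shift s) (h *: (1 : R)) - f (p + s
     *: v))).
  apply/funext => h /=; congr (_ *: (f _ - _)).
  by rewrite scalerDl addrCA [h *: 1]mulr1.
split=> -[a b]; split.
- by rewrite /derivable -e.
- by rewrite /derive -e.
- by rewrite /derivable e.
- by rewrite /derive e.
Qed.

Lemma is_derive_line0 (f : V -> W) (p v : V) (d : W) :
  is_derive (0 : R) 1 (fun h : R => f (p + h *: v)) d -> is_derive p v f d.
Proof. by move=> /is_derive_line; rewrite scale0r addr0. Qed.

Lemma differentiableI (f : V -> W) (df : {linear V -> W}) x : continuous df ->
  (forall e : R, 0 < e ->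
     \forall h \near (0 : V), `|f (h + x) - (f x + df h)| <= e * `|h|) ->
  differentiable f x /\ 'd f x = df :> (V -> W).
Proof.
move=> dfc H.
have D : f \o shift x = cst (f x) + df +o_ 0 id by apply/eqaddoP => e e0; exact: H.
have Deq : 'd f x = df :> (V -> W) by exact: diff_unique.
by split=> //; apply/diff_locallyP; rewrite Deq.
Qed.

End Lines.

Section PlaneDiff.
Variable R : realType.
Implicit Types (f g : R * R -> R) (p q v : R * R).

Definition lin_form (a b : R) v : R := a * v.1 + b * v.2.

Fact lin_form_linear a b : linear (lin_form a b).
Proof. move=> c u v; rewrite /lin_form (_ : (c *: u + v).1 = c * u.1 + v.1) //.
rewrite (_ : (c *: u + v).2 = c * u.2 + v.2) //.
rewrite (_ : c *: (a * u.1 + b * u.2) = c * (a * u.1 + b * u.2)) //; ring. Qed.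
HB.instance Definition _ a b :=
  GRing.isLinear.Build R (R * R)%type R _ (lin_form a b) (lin_form_linear a b).

Lemma mvt_line f p v (x : R) :
  (forall s : R, `|s| <= `|x| -> derivable f (p + s *: v) v) ->
  exists2 s : R, `|s| <= `|x| & f (p + x *: v) - f p = 'D_v f (p + s *: v) * x.
Proof.
move=> fd.
pose g (h : R) := f (p + h *: v).
have gd (s : R) : `|s| <= `|x| -> is_derive s 1 g ('D_v f (p + s *: v)).
  by move=> /fd /derivableP /is_derive_line.
have g0 : g 0 = f p by rewrite /g scale0r addr0.
have gc (s : R) : `|s| <= `|x| -> {for s, continuous g} by move=> sx; exact: (is_derive_cont
  (gd s sx)).
have [x0|x0] := leP 0 x.
  have sx (s : R) : s \in `[0, x] -> `|s| <= `|x|.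
    by rewrite in_itv /= => /andP[s0 sx]; rewrite !ger0_norm.
  have d (s : R) : s \in `]0, x[ -> is_derive s 1 g ('D_v f (p + s *: v)).
    by move=> sx'; apply/gd/sx; apply: subset_itv_oo_cc.
  have c : {within `[0, x], continuous g}.
    by apply: continuous_in_subspaceT => s; rewrite inE => /sx /gc.
  have [s s0x] := MVT_segment x0 d c; rewrite g0 subr0 => e.
  by exists s => //; exact: sx.
have sx (s : R) : s \in `[x, 0] -> `|s| <= `|x|.
  by rewrite in_itv /= => /andP[s0 sx]; rewrite !ler0_norm ?lerN2 // ltW.
have d (s : R) : s \in `]x, 0[ -> is_derive s 1 g ('D_v f (p + s *: v)).
  by move=> sx'; apply/gd/sx; apply: subset_itv_oo_cc.
have c : {within `[x, 0], continuous g}.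
  by apply: continuous_in_subspaceT => s; rewrite inE => /sx /gc.
have [s s0x] := MVT_segment (ltW x0) d c; rewrite g0 sub0r => e.
exists s; first exact: sx.
by apply: oppr_inj; rewrite opprB e; ring.
Qed.

(** Continuous partial derivatives imply differentiability: the increment is
    split along a horizontal and a vertical segment, and the mean value theorem
    is used on each. *)
Lemma C1_differentiable f (D : set (R * R)) p : open D -> D p -> Ck 1 D f ->
  differentiable f p /\ forall v, 'D_v f p = lin_form ('D_(ds R) f p) ('D_(dt R) f p) v.
Proof.
move=> Do Dp [_ [fd [sc _] [tc _]]].
pose a := 'D_(ds R) f p; pose b := 'D_(dt R) f p.
have lc : continuous (lin_form a b).
  move=> v; apply: cvgD; (apply: cvgM; first exact: cvg_cst).
    exact: cvg_fst.
  exact: cvg_snd.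
have [df Deq] : differentiable f p /\ 'd f p = lin_form a b :> (R * R -> R).
  apply: (@differentiableI _ _ _ f (lin_form a b)) => // e e0.
  have e2 : 0 < e / 2 by rewrite divr_gt0.
  have /cvgrPdist_lt /(_ _ e2) := sc _ Dp.
  have /cvgrPdist_lt /(_ _ e2) := tc _ Dp.
  have : nbhs p D by apply: open_nbhs_nbhs.
  move=> /nbhs_ballP[r1 /= r10 h1] /nbhs_ballP[r2 /= r20 h2] /nbhs_ballP[r3 /= r30 h3].
  pose r := Num.min r1 (Num.min r2 r3).
  have r0 : 0 < r by rewrite !lt_min r10 r20 r30.
  have hb (q : R * R) : `|q| < r -> [/\ D (p + q),
      `|b - 'D_(dt R) f (p + q)| < e / 2 & `|a - 'D_(ds R) f (p + q)| < e / 2].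
    rewrite !lt_min => /and3P[q1 q2 q3].
    have bq (s : R) : `|q| < s -> ball p s (p + q).
      by move=> qs; rewrite -ball_normE /= opprD addNKr normrN.
    by split; [apply: h1|apply: h2|apply: h3]; apply: bq.
  apply/nbhs_ballP; exists r => //= h.
  rewrite -ball_normE /= sub0r normrN => hr.
  have [hn1 hn2] : `|h.1| <= `|h| /\ `|h.2| <= `|h|.
    by rewrite prod_normE !le_max !lexx orbT.
  have small (x y : R) : `|x| <= `|h.1| -> `|y| <= `|h.2| -> `|((x, y) : R * R)| < r.
    move=> xh yh; rewrite prod_normE gt_max /=.
    by rewrite (le_lt_trans (le_trans xh hn1) hr) (le_lt_trans (le_trans yh hn2) hr).
  have ptE (x y : R) : p + (x, y) = p + (0, y) + x *: ds R.
    rewrite -addrA; congr (p + _); apply/pair_equal_spec; split => /=.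
      by rewrite add0r [x *: 1]mulr1.
    by rewrite [x *: 0]mulr0 addr0.
  have ptE' (y : R) : p + ((0, y) : R * R) = p + y *: dt R.
    congr (p + _); apply/pair_equal_spec; split => /=.
      by rewrite [y *: 0]mulr0.
    by rewrite [y *: 1]mulr1.
  have [|x xh ex] := @mvt_line f (p + (0, h.2)) (ds R) h.1.
    move=> s sh; rewrite -ptE; apply: (fd _ _).1.
    by have [] := hb _ (small s h.2 sh (lexx _)).
  have [|y yh ey] := @mvt_line f p (dt R) h.2.
    move=> s sh; rewrite -ptE'; apply: (fd _ _).2.
    by have [] := hb _ (small 0 s _ sh); rewrite ?normr0.
  rewrite -!ptE in ex; rewrite -!ptE' in ey.
  have -> : f (h + p) - (f p + lin_form a b h) =
    ('D_(ds R) f (p + (x, h.2)) - a) * h.1 + ('D_(dt R) f (p + (0, y)) - b) * h.2.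
    rewrite addrC (_ : h + p = p + (h.1, h.2)); last by rewrite addrC; case: h {hr hn1 hn2
      small ex ey xh yh}.
    rewrite /lin_form !mulrBl -ex -ey; ring.
  have [_ _ ax] := hb _ (small x h.2 xh (lexx _)).
  have [_ by' _] : [/\ D (p + (0, y)), `|b - 'D_(dt R) f (p + (0, y))| < e / 2 &
     `|a - 'D_(ds R) f (p + (0, y))| < e / 2].
    by apply: hb; apply: small; rewrite ?normr0.
  apply: le_trans (ler_normD _ _) _; rewrite !normrM.
  rewrite [e]splitr mulrDl; apply: lerD; apply: ler_pM => //; rewrite distrC ltW //.
by split => // v; rewrite deriveE // Deq.
Qed.

Lemma polar_neq0 (t : R) : polar 1 t != 0.
Proof.
apply/eqP => -[]; rewrite !mul1r => c0 s0.
by have := cos2Dsin2 t; rewrite c0 s0 expr0n addr0 => /eqP; rewrite eq_sym oner_eq0.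
Qed.

(** The derivative of f (cos t, sin t) is a combination of the same
    expressions for the partial derivatives of f. *)
Lemma polar_smooth f : (forall k, Ck k [set p | p != 0] f) ->
  forall n, smooth_upto n (fun t => f (polar 1 t)).
Proof.
move=> fk n; elim: n f fk => // n IH f fk.
have Do : open [set p : R * R | p != 0].
  rewrite openE => p /= p0; apply/nbhs_ballP; exists `|p|; first by rewrite /= normr_gt0.
  move=> q; rewrite -ball_normE /= => pq; apply/eqP => q0.
  by move: pq; rewrite q0 subr0 ltxx.
have pn0 t : [set p : R * R | p != 0] (polar 1 t) by exact: polar_neq0.
notypeclasses refine (smooth_uptoI (f' := fun t => 'D_(ds R) f (polar 1 t) * (- sin t) + 'D_(dt
  R) f (polar 1 t) * cos t) _ _).
  move=> t; have [df dfE] := C1_differentiable Do (pn0 t) (fk 1%N).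
  have pd : is_diff t (polar 1 : R -> R * R) (fun h => (h * - sin t, h * cos t)).
    have cd : differentiable (fun t : R => 1 * cos t) t.
      by apply/derivable1_diffP; have [] : is_derive t 1 (fun t : R => 1 * cos t) (- sin t) by
        der; ring.
    have sd : differentiable (fun t : R => 1 * sin t) t.
      by apply/derivable1_diffP; have [] : is_derive t 1 (fun t : R => 1 * sin t) (cos t) by
        der; ring.
    split; first exact: differentiable_pair.
    rewrite diff_pair //; apply/funext => h.
    have H1 : 'd (fun t : R => 1 * cos t) t h = h * - sin t.
      rewrite -[h in LHS]mulr1 -[h * 1]/(h *: (1:R)) linearZ /= -deriveE //; congr (_ * _).
      by have [_ ->] : is_derive t 1 (fun t : R => 1 * cos t) (- sin t) by der; ring.
    have H2 : 'd (fun t : R => 1 * sin t) t h = h * cos t.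
      rewrite -[h in LHS]mulr1 -[h * 1]/(h *: (1:R)) linearZ /= -deriveE //; congr (_ * _).
      by have [_ ->] : is_derive t 1 (fun t : R => 1 * sin t) (cos t) by der; ring.
    by rewrite H1 H2.
  have [pdd pdE] := pd.
  split; first by apply/derivable1_diffP; exact: differentiable_comp.
  rewrite deriveE; last exact: differentiable_comp.
  rewrite diff_comp // pdE /= !mul1r -deriveE // dfE /lin_form /=; ring.
apply: smooth_uptoD; apply: smooth_uptoM.
- by apply: (IH ('D_(ds R) f)) => k; have [_ []] := fk k.+1.
- rewrite (_ : (fun x => - sin x) = (fun x => (-1) * sin x)); last by apply/funext => x; ring.
  by apply: smooth_uptoM; [exact: smooth_upto_cst|exact: (smooth_upto_sin_cos R n).1].
- by apply: (IH ('D_(dt R) f)) => k; have [_ []] := fk k.+1.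
- exact: (smooth_upto_sin_cos R n).2.
Qed.

End PlaneDiff.

(** * Powers of the radius times functions of the angle *)

Section Polar.
Variable R : realType.
Implicit Types (f g : R -> R) (p q v : R * R).

Definition radius p : R := Num.sqrt (p.1 ^+ 2 + p.2 ^+ 2).
(** A branch with values in [-pi, pi]; its jump is harmless since only periodic
    functions are applied to it. *)
Definition angle p : R :=
  if 0 <= p.2 then acos (p.1 / radius p) else - acos (p.1 / radius p).

Lemma radius_ge0 p : 0 <= radius p. Proof. exact: sqrtr_ge0. Qed.

Lemma radius_sq p : radius p ^+ 2 = p.1 ^+ 2 + p.2 ^+ 2.
Proof. by rewrite sqr_sqrtr // addr_ge0 // sqr_ge0. Qed.

Lemma radius0 : radius 0 = 0.
Proof. by rewrite /radius /= expr0n /= addr0 sqrtr0. Qed.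

Lemma radius_gt0 p : p != 0 -> 0 < radius p.
Proof.
move=> p0; rewrite sqrtr_gt0 lt_def addr_ge0 ?sqr_ge0 // andbT.
apply: contra p0; rewrite paddr_eq0 ?sqr_ge0 // !sqrf_eq0 => /andP[/eqP a /eqP b].
by case: p a b => x y /= -> ->.
Qed.

Lemma radiusZ (h : R) v : radius (h *: v) = `|h| * radius v.
Proof.
rewrite /radius /= -sqrtr_sqr -sqrtrM ?sqr_ge0 //; congr Num.sqrt.
by rewrite -[h *: v.1]/(h * v.1) -[h *: v.2]/(h * v.2); ring.
Qed.

Lemma radius_angleE p : p != 0 ->
  p.1 = radius p * cos (angle p) /\ p.2 = radius p * sin (angle p).
Proof.
move=> /radius_gt0 r0; have rn0 : radius p != 0 by rewrite gt_eqF.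
pose x := p.1 / radius p.
have x2 : x ^+ 2 = 1 - (p.2 / radius p) ^+ 2.
  rewrite /x !expr_div_n radius_sq; have : radius p ^+ 2 != 0 by rewrite sqrf_eq0.
  by rewrite radius_sq => h; field.
have x1 : -1 <= x <= 1.
  by rewrite -ler_norml -(@expr_le1 _ 2) // real_normK ?num_real // x2 gerBl sqr_ge0.
have cx : cos (acos x) = x by rewrite acosK // in_itv.
have sx : sin (acos x) = `|p.2| / radius p.
  by rewrite sin_acos // x2 opprB addrC subrK sqrtr_sqr normrM normfV (gtr0_norm r0).
rewrite /angle -/x; case: ifPn => p2.
  by rewrite cx sx ger0_norm // /x; split; field.
rewrite -ltNge in p2.
by rewrite cosN sinN cx sx ltr0_norm // /x; split; field.
Qed.

Lemma angle_bound p : `|angle p| <= pi.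
Proof.
have [->|p0] := eqVneq p 0.
  rewrite /angle radius0 invr0 mulr0 acos0 /= lexx.
  by rewrite ger0_norm ?divr_ge0 ?pi_ge0 //; have := pi_ge0 R; lra.
have r0 := radius_gt0 p0.
have x1 : -1 <= p.1 / radius p <= 1.
  rewrite -ler_norml -(@expr_le1 _ 2) // real_normK ?num_real // expr_div_n ler_pdivrMr
    ?exprn_gt0 //.
  by rewrite mul1r radius_sq lerDl sqr_ge0.
have h1 := acos_ge0 x1; have h2 := acos_lepi x1.
by rewrite /angle; case: ifP => _; rewrite ?normrN ger0_norm.
Qed.

Lemma radius_polar r t : 0 <= r -> radius (polar r t) = r.
Proof.
move=> r0; rewrite /radius /= !exprMn -mulrDr cos2Dsin2 mulr1 sqrtr_sqr ger0_norm //.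
Qed.

(** The components of v in the orthonormal frame of the polar coordinates
    at p. *)
Definition radial p v : R := v.1 * cos (angle p) + v.2 * sin (angle p).
Definition angular p v : R := - v.1 * sin (angle p) + v.2 * cos (angle p).

Lemma radial_angular_sq p q : radial p q ^+ 2 + angular p q ^+ 2 = radius q ^+ 2.
Proof.
rewrite radius_sq /radial /angular; set th := angle p.
transitivity ((q.1 ^+ 2 + q.2 ^+ 2) * (cos th ^+ 2 + sin th ^+ 2)); first by ring.
by rewrite cos2Dsin2 mulr1.
Qed.

Lemma radial_gt0_neq0 p q : 0 < radial p q -> q != 0.
Proof. by apply: contraTneq => ->; rewrite /radial /= !mul0r addr0 ltxx. Qed.

Lemma cos_sin_angle_polar r t : 0 < r ->
  cos (angle (polar r t)) = cos t /\ sin (angle (polar r t)) = sin t.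
Proof.
move=> r0; have rE : radius (polar r t) = r by rewrite radius_polar // ltW.
have p0 : polar r t != 0 by apply: contraTneq r0 => p0; rewrite -rE p0 radius0 ltxx.
have [e1 e2] := radius_angleE p0.
by split; apply: (mulfI (lt0r_neq0 r0)); rewrite -{1}rE -?e1 -?e2.
Qed.

Lemma smper_angle_polar f r t : smper f -> 0 < r -> f (angle (polar r t)) = f t.
Proof. by move=> [_ pf] /(cos_sin_angle_polar t)[ct st]; exact: periodic_angle. Qed.

(** Seen from p, the angle of a nearby q is the angle of p plus an arctangent
    of the angular over the radial component of q. This is the smooth local
    branch through which everything is differentiated. *)
Lemma angle_local f p q : (forall t, f (t + 2 * pi) = f t) -> p != 0 ->
  let X := radial p q in
  let Y := angular p q in
  0 < X -> f (angle q) = f (angle p + atan (Y / X)).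
Proof.
move=> pf p0 X Y X0.
have q0 : q != 0 by exact: radial_gt0_neq0 X0.
have rq := radius_gt0 q0; have [q1 q2] := radius_angleE q0.
have XY : X ^+ 2 + Y ^+ 2 = radius q ^+ 2 by exact: radial_angular_sq.
set th := angle p.
have Xn0 : X != 0 by rewrite gt_eqF.
have rn0 : radius q != 0 by rewrite gt_eqF.
have ca : cos (atan (Y / X)) = X / radius q.
  rewrite cos_atan.
  have -> : 1 + (Y / X) ^+ 2 = (radius q / X) ^+ 2 by rewrite !expr_div_n -XY; field.
  by rewrite sqrtr_sqr ger0_norm ?divr_ge0 ?ltW // invf_div.
have sa : sin (atan (Y / X)) = Y / radius q.
  have := atanK (Y / X); rewrite /tan ca => h.
  have cn0 : X / radius q != 0 by rewrite mulf_neq0 // invr_neq0.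
  rewrite -[LHS](divfK cn0) h; field; exact/andP.
apply: periodic_angle => //.
  rewrite cosD ca sa; apply: (mulfI rn0); rewrite -q1.
  have -> : radius q * (cos th * (X / radius q) - sin th * (Y / radius q)) = cos th * X - sin
    th * Y by field.
  rewrite /X /Y /radial /angular -/th.
  have -> : cos th * (q.1 * cos th + q.2 * sin th) - sin th * (- q.1 * sin th + q.2 * cos th) =
    q.1 * (cos th ^+ 2 + sin th ^+ 2) by ring.
  by rewrite cos2Dsin2 mulr1.
rewrite sinD ca sa; apply: (mulfI rn0); rewrite -q2.
have -> : radius q * (sin th * (X / radius q) + cos th * (Y / radius q)) = sin th * X + cos th
  * Y by field.
rewrite /X /Y /radial /angular -/th.
have -> : sin th * (q.1 * cos th + q.2 * sin th) + cos th * (- q.1 * sin th + q.2 * cos th) =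
  q.2 * (cos th ^+ 2 + sin th ^+ 2) by ring.
by rewrite cos2Dsin2 mulr1.
Qed.

(** The class of functions in which all computations take place. It vanishes
    at the origin when a is not 0. *)
Definition powlog (a : R) f0 f1 p : R :=
  radius p `^ a * (f0 (angle p) + ln (radius p) * f1 (angle p)).

Lemma powlog0 a f0 f1 : a != 0 -> powlog a f0 f1 0 = 0.
Proof. by move=> a0; rewrite /powlog radius0 powR0 // mul0r. Qed.

Lemma powlog_local a f0 f1 p q : smper f0 -> smper f1 -> p != 0 ->
  let X := radial p q in
  let Y := angular p q in
  let L := 2^-1 * ln (X ^+ 2 + Y ^+ 2) in
  0 < X -> powlog a f0 f1 q =
    expR (a * L) * (f0 (angle p + atan (Y / X)) + L * f1 (angle p + atan (Y / X))).
Proof.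
move=> [_ p0] [_ p1] pn0 X Y L X0.
have rq : 0 < radius q by apply: radius_gt0; exact: radial_gt0_neq0 X0.
have XY : X ^+ 2 + Y ^+ 2 = radius q ^+ 2 by exact: radial_angular_sq.
have LE : L = ln (radius q).
  by rewrite /L XY lnXn // mulr2n; field.
rewrite /powlog LE (angle_local p0 pn0 X0) (angle_local p1 pn0 X0) -/X -/Y.
by rewrite /powR gt_eqF.
Qed.

Lemma radial_self p : p != 0 -> radial p p = radius p /\ angular p p = 0.
Proof.
move=> p0; have [p1 p2] := radius_angleE p0; rewrite /radial /angular p1 p2; split; last by ring.
have -> : radius p * cos (angle p) * cos (angle p) + radius p * sin (angle p) * sin (angle p) =
  radius p * (cos (angle p) ^+ 2 + sin (angle p) ^+ 2) by ring.
by rewrite cos2Dsin2 mulr1.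
Qed.

Lemma powlog_near a f0 f1 p : smper f0 -> smper f1 -> p != 0 ->
  \forall q \near p, powlog a f0 f1 q =
    expR (a * (2^-1 * ln (radial p q ^+ 2 + angular p q ^+ 2))) *
     (f0 (angle p + atan (angular p q / radial p q)) +
      2^-1 * ln (radial p q ^+ 2 + angular p q ^+ 2) * f1 (angle p + atan (angular p q / radial
        p q))).
Proof.
move=> s0 s1 p0; have [e0 _] := radial_self p0; have r0 := radius_gt0 p0.
have ec : {for p, continuous (radial p)}.
  apply: cvgD; (apply: cvgM; last exact: cvg_cst); [exact: cvg_fst|exact: cvg_snd].
have : \forall q \near p, 0 < radial p q.
  by apply: (cvgr_gt _ ec); rewrite e0.
by apply: filterS => q q0; exact: powlog_local.
Qed.

Lemma powlog_continuous a f0 f1 p : smper f0 -> smper f1 -> p != 0 ->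
  {for p, continuous (powlog a f0 f1)}.
Proof.
move=> s0 s1 p0; have [e0 t0] := radial_self p0; have r0 := radius_gt0 p0.
have ec : radial p q @[q --> p] --> radial p p.
  apply: cvgD; (apply: cvgM; last exact: cvg_cst); [exact: cvg_fst|exact: cvg_snd].
have tc : angular p q @[q --> p] --> angular p p.
  apply: cvgD; (apply: cvgM; last exact: cvg_cst); [apply: cvgN; exact: cvg_fst|exact: cvg_snd].
have H := powlog_near a s0 s1 p0.
pose G q := expR (a * (2^-1 * ln (radial p q ^+ 2 + angular p q ^+ 2))) *
     (f0 (angle p + atan (angular p q / radial p q)) +
      2^-1 * ln (radial p q ^+ 2 + angular p q ^+ 2) * f1 (angle p + atan (angular p q / radial
        p q))).
have HG : \forall q \near p, G q = powlog a f0 f1 q by apply: filterS H => q ->.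
suff : G q @[q --> p] --> G p.
  rewrite (nbhs_singleton HG) => Gc.
  by apply: cvg_trans Gc; apply: near_eq_cvg; apply: filterS HG => q ->.
have Lc : 2^-1 * ln (radial p q ^+ 2 + angular p q ^+ 2) @[q --> p] --> 2^-1 * ln (radial p p
  ^+ 2 + angular p p ^+ 2).
  apply: cvgM; first exact: cvg_cst.
  apply: continuous_cvg.
    by apply: continuous_ln; rewrite e0 t0 expr0n addr0 exprn_gt0.
  by apply: cvgD; apply: cvgM.
have Ac f : smper f -> f (angle p + atan (angular p q / radial p q)) @[q --> p] --> f (angle p
  + atan (angular p p / radial p p)).
  move=> /smper_continuous fc; apply: continuous_cvg; first exact: fc.
  apply: cvgD; first exact: cvg_cst.
  apply: continuous_cvg; first exact: continuous_atan.
  by apply: cvgM => //; apply: cvgV => //; rewrite e0 gt_eqF.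
apply: cvgM.
  apply: continuous_cvg; first exact: continuous_expR.
  by apply: cvgM => //; exact: cvg_cst.
by apply: cvgD; [exact: Ac|apply: cvgM => //; exact: Ac].
Qed.

(** With powlog_d1, the two angular factors of the derivative of
    powlog a f0 f1 in direction v. *)
Definition powlog_d0 (a : R) f0 f1 v t : R :=
  (a * f0 t + f1 t) * (v.1 * cos t + v.2 * sin t) + derive1 f0 t * (- v.1 * sin t + v.2 * cos t).
Definition powlog_d1 (a : R) f1 v t : R :=
  a * f1 t * (v.1 * cos t + v.2 * sin t) + derive1 f1 t * (- v.1 * sin t + v.2 * cos t).

Lemma powlog_is_derive_neq0 a f0 f1 p v : smper f0 -> smper f1 -> p != 0 ->
  is_derive p v (powlog a f0 f1) (powlog (a - 1) (powlog_d0 a f0 f1 v) (powlog_d1 a f1 v) p).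
Proof.
move=> s0 s1 p0; have [e0 t0] := radial_self p0; have r0 := radius_gt0 p0.
have rn0 : radius p != 0 by rewrite gt_eqF.
apply: is_derive_line0.
pose X (h : R) := radius p + h * radial p v; pose Y (h : R) := h * angular p v.
have XE h : radial p (p + h *: v) = X h.
  rewrite /X -e0 /radial /= -[h *: v.1]/(h * v.1) -[h *: v.2]/(h * v.2); ring.
have YE h : angular p (p + h *: v) = Y h.
  rewrite /Y -[RHS]add0r -t0 /angular /= -[h *: v.1]/(h * v.1) -[h *: v.2]/(h * v.2); ring.
have Xd (h : R) : is_derive h 1 X (radial p v) by rewrite /X; der; ring.
have Yd (h : R) : is_derive h 1 Y (angular p v) by rewrite /Y; der; ring.
have X00 : X 0 = radius p by rewrite /X mul0r addr0.
have Y00 : Y 0 = 0 by rewrite /Y mul0r.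
apply: (@near_eq_is_derive _ _ _ (fun h => expR (a * (2^-1 * ln (X h ^+ 2 + Y h ^+ 2))) *
     (f0 (angle p + atan (Y h / X h)) +
      2^-1 * ln (X h ^+ 2 + Y h ^+ 2) * f1 (angle p + atan (Y h / X h))))).
  have Xc : {for 0, continuous X} by exact: is_derive_cont (Xd 0).
  have : \forall h \near 0, 0 < X h by apply: (cvgr_gt _ Xc); rewrite X00.
  by apply: filterS => h h0; rewrite (powlog_local a s0 s1 p0) XE // YE.
have f0d := smper_is_derive s0; have f1d := smper_is_derive s1.
der.
- by rewrite X00 Y00 expr0n addr0 exprn_gt0.
- by rewrite X00.
- by rewrite X00 Y00 expr0n addr0 exprn_gt0.
- by rewrite X00.
rewrite X00 Y00 !mul0r atan0 addr0 expr0n addr0 lnXn //= mulr2n.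
have -> : 2^-1 * (ln (radius p) + ln (radius p)) = ln (radius p) by field.
rewrite /powlog /powlog_d0 /powlog_d1 -/(radial p v) -/(angular p v) /powR gt_eqF //.
have -> : expR ((a - 1) * ln (radius p)) = expR (a * ln (radius p)) / radius p.
  by rewrite mulrBl mul1r expRB lnK // posrE.
field; rewrite rn0 /=.
by [].
Qed.

Lemma powlog_d0_smper a f0 f1 v : smper f0 -> smper f1 -> smper (powlog_d0 a f0 f1 v).
Proof.
move=> s0 s1; have [d0 d1] := (smper_derive1 s0, smper_derive1 s1).
have e1 : smper (fun t => v.1 * cos t + v.2 * sin t).
  by apply: smperD; apply: smperM; [exact: smper_cst|exact: smper_cos|exact: smper_cst|exact:
    smper_sin].
have e2 : smper (fun t => - v.1 * sin t + v.2 * cos t).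
  by apply: smperD; apply: smperM; [exact: smper_cst|exact: smper_sin|exact: smper_cst|exact:
    smper_cos].
apply: smperD; apply: smperM => //; apply: smperD => //; apply: smperM => //; exact: smper_cst.
Qed.

Lemma powlog_d1_smper a f1 v : smper f1 -> smper (powlog_d1 a f1 v).
Proof.
move=> s1; have d1 := smper_derive1 s1.
have e1 : smper (fun t => v.1 * cos t + v.2 * sin t).
  by apply: smperD; apply: smperM; [exact: smper_cst|exact: smper_cos|exact: smper_cst|exact:
    smper_sin].
have e2 : smper (fun t => - v.1 * sin t + v.2 * cos t).
  by apply: smperD; apply: smperM; [exact: smper_cst|exact: smper_sin|exact: smper_cst|exact:
    smper_cos].
apply: smperD; apply: smperM => //; apply: smperM => //; exact: smper_cst.
Qed.

Lemma smper_angle_bounded f : smper f -> exists B, 0 <= B /\ forall p, `|f (angle p)| <= B.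
Proof.
move=> /smper_continuous fc.
have ab : - pi <= pi :> R by have := pi_ge0 R; lra.
have c : {within `[- pi, pi], continuous (fun t => `|f t|)}.
  apply: continuous_subspaceT => t; apply: cvg_norm; exact: fc.
have [t _ H] := EVT_max ab c.
exists `|f t|; split => // p; apply: H.
by rewrite in_itv /= -ler_norml angle_bound.
Qed.

(** Half of the exponent absorbs the logarithm. *)
Lemma powlog_bound a f0 f1 : 0 < a -> smper f0 -> smper f1 -> exists C, 0 <= C /\
  forall p, radius p <= 1 -> `|powlog a f0 f1 p| <= C * radius p `^ (a / 2).
Proof.
move=> a0 /smper_angle_bounded[B0 [b0 H0]] /smper_angle_bounded[B1 [b1 H1]].
have a2 : 0 < a / 2 by rewrite divr_gt0.
exists (B0 + 2 / a * B1); split; first by rewrite addr_ge0 // mulr_ge0 // divr_ge0 // ltW.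
move=> p p1.
have [->|p0] := eqVneq p 0.
  by rewrite powlog0 ?gt_eqF // normr0 radius0 powR0 ?gt_eqF // mulr0.
have r0 := radius_gt0 p0.
have ae : a = a / 2 + a / 2 by field.
have P0 : 0 < radius p `^ (a / 2) by exact: powR_gt0.
have PE : radius p `^ a = radius p `^ (a / 2) * radius p `^ (a / 2).
  by rewrite {1}ae powRD // implybE gt_eqF ?addr_gt0.
have P1 : radius p `^ (a / 2) <= 1.
  have r01 : 0 < radius p <= 1 by rewrite r0.
  by have := ger_powR r01 (ltW a2); rewrite powRr0.
have lnb : radius p `^ (a / 2) * `|ln (radius p)| <= 2 / a.
  rewrite ler0_norm; last by exact: ln_le0.
  have -> : - ln (radius p) = 2 / a * ln ((radius p `^ (a / 2))^-1).
    by rewrite lnV ?posrE // ln_powR; field; rewrite gt_eqF.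
  have := ltW (ln_sublinear (_ : 0 < (radius p `^ (a / 2))^-1)); rewrite invr_gt0 => /(_ P0) h.
  rewrite mulrCA -[X in _ <= X]mulr1; apply: ler_wpM2l; first by rewrite divr_ge0 // ltW.
  by rewrite mulrC -ler_pdivlMr // div1r.
rewrite /powlog PE !normrM (gtr0_norm P0).
apply: le_trans (_ : radius p `^ (a / 2) * radius p `^ (a / 2) * (B0 + `|ln (radius p)| * B1) <= _).
  rewrite ler_wpM2l ?mulr_ge0 ?powR_ge0 //.
  apply: le_trans (ler_normD _ _) _; apply: lerD => //; rewrite normrM ler_wpM2l //.
rewrite [X in _ <= X]mulrC -mulrA ler_wpM2l ?powR_ge0 // mulrDr; apply: lerD.
  by rewrite ler_piMl.
by rewrite mulrA ler_wpM2r.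
Qed.

Lemma powR_small (c e : R) : 0 < c -> 0 < e ->
  exists d, 0 < d /\ forall x, 0 <= x < d -> x `^ c < e.
Proof.
move=> c0 e0; exists (e `^ c^-1); split; first exact: powR_gt0.
move=> x /andP[x0 xd].
have -> : e = (e `^ c^-1) `^ c by rewrite -powRrM mulVf ?gt_eqF // powRr1 // ltW.
by apply: gt0_ltr_powR => //; rewrite nnegrE // powR_ge0.
Qed.

Lemma radius_le_norm p : radius p <= 2 * `|p|.
Proof.
rewrite -[X in _ <= X]ger0_norm ?mulr_ge0 // -sqrtr_sqr ler_wsqrtr //.
have h1 : `|p.1| <= `|p| by rewrite prod_normE le_max lexx.
have h2 : `|p.2| <= `|p| by rewrite prod_normE le_max lexx orbT.
have {}h1 : p.1 ^+ 2 <= `|p| ^+ 2 by rewrite -real_normK ?num_real // lerXn2r ?nnegrE.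
have {}h2 : p.2 ^+ 2 <= `|p| ^+ 2 by rewrite -real_normK ?num_real // lerXn2r ?nnegrE.
by rewrite exprMn; have := sqr_ge0 `|p|; lra.
Qed.

Lemma powlog_continuous0 a f0 f1 : 0 < a -> smper f0 -> smper f1 ->
  {for 0, continuous (powlog a f0 f1)}.
Proof.
move=> a0 s0 s1; have [C [C0 HC]] := powlog_bound a0 s0 s1.
have a2 : 0 < a / 2 by rewrite divr_gt0.
apply/cvgrPdist_lt => e e0.
suff : \forall p \near (0 : R * R), `|powlog a f0 f1 0 - powlog a f0 f1 p| < e by [].
rewrite powlog0 ?gt_eqF //.
have C1 : 0 < C + 1 by lra.
have [d [d0 Hd]] := powR_small a2 (divr_gt0 e0 C1).
pose d' := Num.min d 1 / 2.
have d'0 : 0 < d' by rewrite divr_gt0 // lt_min d0 ltr01.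
apply: filterS (nbhs0_lt d'0) => p pd; rewrite sub0r normrN.
have : radius p < Num.min d 1.
  by apply: le_lt_trans (radius_le_norm p) _; rewrite mulrC -ltr_pdivlMr.
rewrite lt_min => /andP[rd r1].
apply: le_lt_trans (HC _ (ltW r1)) _.
apply: le_lt_trans (_ : (C + 1) * radius p `^ (a / 2) < _).
  by rewrite ler_wpM2r ?powR_ge0 // lerDl.
by rewrite mulrC -ltr_pdivlMr // Hd // radius_ge0.
Qed.

Lemma powlog_shift a f0 f1 p : 1 < a -> powlog a f0 f1 p = radius p * powlog (a - 1) f0 f1 p.
Proof.
move=> a1; rewrite /powlog mulrA; congr (_ * _).
by rewrite mulr_powRB1 ?radius_ge0 //; lra.
Qed.

(** At the origin the difference quotient is bounded by the function
    itself with exponent a - 1, which is continuous and vanishes there. *)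
Lemma powlog_is_derive a f0 f1 p v : 1 < a -> smper f0 -> smper f1 ->
  is_derive p v (powlog a f0 f1) (powlog (a - 1) (powlog_d0 a f0 f1 v) (powlog_d1 a f1 v) p).
Proof.
move=> a1 s0 s1; have [->|p0] := eqVneq p 0; last exact: powlog_is_derive_neq0.
rewrite [X in is_derive _ _ _ X]powlog0; last by rewrite subr_eq0 gt_eqF.
have a10 : 0 < a - 1 by rewrite subr_gt0.
have an0 : a != 0 by rewrite gt_eqF //; lra.
(* only the origin remains, where the derivative is 0 *)
have H : h^-1 *: ((powlog a f0 f1 \o shift (0 : R * R)) (h *: v) - powlog a f0 f1 0) @[h -->
  (0:R)^'] --> (0 : R).
  apply/cvgr0Pnorm_lt => e e0.
  have r1 : 0 < radius v + 1 by have := radius_ge0 v; lra.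
  have c : powlog (a - 1) f0 f1 (h *: v) @[h --> (0 : R)] --> (0 : R).
    have hc : h *: v @[h --> (0:R)] --> (0 : R * R).
      by rewrite -[X in _ --> X](scale0r v); apply: cvgZr_tmp; exact: cvg_id.
    rewrite -[X in _ --> X](powlog0 f0 f1 (lt0r_neq0 a10)).
    exact: (continuous_cvg _ (powlog_continuous0 a10 s0 s1) hc).
  have := cvgr0_norm_lt _ c _ (divr_gt0 e0 r1).
  move=> Hn; near=> h.
  have hn0 : h != 0 by near: h; exact: nbhs_dnbhs_neq.
  have Hh : `|powlog (a - 1) f0 f1 (h *: v)| < e / (radius v + 1).
    by near: h; apply: nbhs_dnbhs; apply: Hn.
  have -> : (powlog a f0 f1 \o shift (0 : R * R)) (h *: v) = powlog a f0 f1 (h *: v).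
    by congr (powlog _ _ _ _); exact: addr0.
  rewrite powlog0 // subr0 powlog_shift // radiusZ; move: (powlog _ _ _ _) Hh => F Hh.
  rewrite -[h^-1 *: _]/(h^-1 * _) !normrM normr_id (ger0_norm (radius_ge0 v)) normfV.
  have h0 : `|h| != 0 by rewrite normr_eq0.
  rewrite -!mulrA mulKf //.
  apply: le_lt_trans (_ : (radius v + 1) * `|F| < _).
    by rewrite ler_wpM2r // lerDl.
  by rewrite mulrC -ltr_pdivlMr.
by split; [apply/cvg_ex; exists 0|apply/cvg_lim].
Unshelve. all: by end_near. Qed.

Lemma powlog_Ck k a f0 f1 : k%:R < a -> smper f0 -> smper f1 -> Ck k setT (powlog a f0 f1).
Proof.
elim: k a f0 f1 => [|k IH] a f0 f1 ka s0 s1; split => //.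
- move=> p _; have [->|p0] := eqVneq p 0; first exact: powlog_continuous0.
  exact: powlog_continuous.
- move=> p _; have [->|p0] := eqVneq p 0; last exact: powlog_continuous.
  by apply: powlog_continuous0 => //; apply: le_lt_trans ka; exact: ler0n.
have a1 : 1 < a by apply: le_lt_trans ka; rewrite ler1n.
have Deq v : 'D_v (powlog a f0 f1) = powlog (a - 1) (powlog_d0 a f0 f1 v) (powlog_d1 a f1 v).
  by apply/funext => p; have [] := powlog_is_derive p v a1 s0 s1.
have ka' : k%:R < a - 1 by rewrite ltrBrDr natr1.
split.
- by move=> p _; split; [case: (powlog_is_derive p (ds R) a1 s0 s1)|case: (powlog_is_derive p
  (dt R) a1 s0 s1)].
- by rewrite Deq; apply: (IH _ _ _ ka'); [exact: powlog_d0_smper|exact: powlog_d1_smper].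
- by rewrite Deq; apply: (IH _ _ _ ka'); [exact: powlog_d0_smper|exact: powlog_d1_smper].
Qed.

End Polar.

(** Membership in smper by the shape of the function. The hypotheses come last
    because matching them first compares large terms by conversion. *)
Ltac smper_tac := repeat
  match goal with
  | |- smper (fun _ => ?c) => exact (smper_cst c)
  | |- smper (fun x => _ - _) => apply: smperB
  | |- smper (fun x => _ + _) => apply: smperD
  | |- smper (fun x => - _) => apply: smperN
  | |- smper (fun x => _ * _) => apply: smperM
  | |- smper (fun x => _ ^+ _) => apply: smperX
  | |- smper (fun x => cos x) => exact: smper_cos
  | |- smper (fun x => sin x) => exact: smper_sin
  | |- smper cos => exact: smper_cos
  | |- smper sin => exact: smper_sin
  | |- smper (derive1 _) => apply: smper_derive1
  | |- smper (fun x => derive1 _ x) => apply: smper_derive1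
  | H : smper ?f |- smper ?f => exact H
  | H : smper ?f |- smper (fun x => ?f x) => exact H
  end.

(** * The equations of bending in polar coordinates *)

Section Fields.
Variable R : realType.
Variables (m : R) (P : R -> R).
Hypothesis m2 : 2 <= m.
Hypothesis sP : smper P.
Hypothesis P0 : forall t, 0 < P t.
Let P1 : R -> R := derive1 P.
Let P2 : R -> R := derive1 P1.

(** The determinant of the normalised Hessian of r^m P, i.e. b^2. *)
Definition hill_weight t : R :=
  (m ^+ 2 * P t ^+ 2 + m * P t * derive1 (derive1 P) t - (m - 1) * derive1 P t ^+ 2)
  / (m ^+ 2 * (m - 1) * P t ^+ 2).

Let Pd : forall t : R, is_derive t 1 P (P1 t). Proof. exact: smper_is_derive. Qed.
Let sP1 : smper P1. Proof. exact: smper_derive1. Qed.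
Let P1d : forall t : R, is_derive t 1 P1 (P2 t). Proof. exact: smper_is_derive. Qed.
Let sP2 : smper P2. Proof. exact: smper_derive1. Qed.
Let Pn0 t : P t != 0. Proof. by rewrite gt_eqF. Qed.
Let mn0 : m != 0. Proof. by rewrite gt_eqF //; have := m2; lra. Qed.
Let m1n0 : m - 1 != 0. Proof. by rewrite gt_eqF //; have := m2; lra. Qed.

Lemma hill_weight_smper : smper hill_weight.
Proof.
apply: smperM; first by smper_tac.
apply: smperV; last by smper_tac.
by move=> t; rewrite !mulf_neq0 ?expf_neq0.
Qed.

(** What the angular equation becomes for the vertical component r^l W when
    the horizontal components have been eliminated, divided by 1 - m; W, W' and
    W'' are passed as numbers. *)
Definition bending_op (l : R) (W W' W'' : R) t : R :=
  m * P t * W'' - 2 * (l - 1) * P1 t * W' +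
  (l * (l - 1) / (m - 1) * P2 t + m * l * (l + m - 2) / (m - 1) * P t) * W.
(** The derivative of bending_op with respect to l, which a logarithm
    brings in. *)
Definition bending_op_dl (l : R) (W W' : R) t : R :=
  - 2 * P1 t * W' + ((2 * l - 1) / (m - 1) * P2 t + m * (2 * l + m - 2) / (m - 1) * P t) * W.

(** The factor P^((l - 1) / m) which removes the first order term of
    bending_op. *)
Definition liouville (l : R) t : R := expR ((l - 1) / m * ln (P t)).

Let liouville_is_derive l (t : R) : is_derive t 1 (liouville l) ((l - 1) / m * (P1 t / P t) *
  liouville l t).
Proof. by rewrite /liouville; der; [exact: P0|ring]. Qed.
Lemma liouville_smper l : smper (liouville l).
Proof. by apply: smper_expR; apply: smperM; [exact: smper_cst|exact: smper_ln]. Qed.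
Lemma liouville_neq0 l t : liouville l t != 0.
Proof. by rewrite gt_eqF // expR_gt0. Qed.

(** In W0 the term ln P / m is the derivative of the factor with respect to
    l, divided by the factor: the logarithm acts on the factor too. The coefficient
    2 l + m - 2 is the derivative of mu = (l - 1)(l + m - 1). *)
Lemma bending_op_of_hill (l : R) (h : R -> R) (y0 y1 : (R -> R) * (R -> R)) :
  smper y0.1 -> smper y1.1 ->
  hill (fun t => 1 + (l - 1) * (l + m - 1) * hill_weight t) (fun=> 0) y1 ->
  hill (fun t => 1 + (l - 1) * (l + m - 1) * hill_weight t)
    (fun t => h t / (m * P t * liouville l t) - (2 * l + m - 2) * hill_weight t * y1.1 t) y0 ->
  let W0 t := liouville l t * (y0.1 t + ln (P t) / m * y1.1 t) in
  let W1 t := liouville l t * y1.1 t in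
  [/\ smper W0, smper W1,
   forall t, bending_op l (W1 t) (derive1 W1 t) (derive1 (derive1 W1) t) t = 0 &
   forall t, bending_op l (W0 t) (derive1 W0 t) (derive1 (derive1 W0) t) t
     + bending_op_dl l (W1 t) (derive1 W1 t) t = h t].
Proof.
move=> sy0 sy1 [d1 dd1] [d0 dd0] W0 W1.
have slnP : smper (fun t => ln (P t)) by exact: smper_ln.
have spw := liouville_smper l.
have sW0 : smper W0 by rewrite /W0; smper_tac.
have sW1 : smper W1 by rewrite /W1; smper_tac.
pose s := (l - 1) / m.
have pd := liouville_is_derive l.
have W1d (t : R) : is_derive t 1 W1 (liouville l t * (s * (P1 t / P t) * y1.1 t + y1.2 t)).
  by rewrite /W1; der; rewrite /s; ring.
have W1dE : derive1 W1 = fun t => liouville l t * (s * (P1 t / P t) * y1.1 t + y1.2 t).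
  by apply/funext => t; exact: is_derive_derive1.
have W1dd (t : R) : is_derive t 1 (derive1 W1)
  (liouville l t * ((s ^+ 2 * (P1 t / P t) ^+ 2 + s * (P2 t / P t - (P1 t / P t) ^+ 2)) * y1.1 t
   + 2 * s * (P1 t / P t) * y1.2 t - (1 + (l - 1) * (l + m - 1) * hill_weight t) * y1.1 t)).
  rewrite W1dE; der; first exact: Pn0.
  by rewrite /s; field; rewrite mn0 Pn0.
have V0d (t : R) : is_derive t 1 (fun t => y0.1 t + ln (P t) / m * y1.1 t)
  (y0.2 t + (P1 t / P t) / m * y1.1 t + ln (P t) / m * y1.2 t).
  by der; [exact: P0|ring].
have W0d (t : R) : is_derive t 1 W0 (liouville l t * (s * (P1 t / P t) * (y0.1 t + ln (P t) / m
  * y1.1 t)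
   + (y0.2 t + (P1 t / P t) / m * y1.1 t + ln (P t) / m * y1.2 t))).
  by rewrite /W0; der; [exact: P0|rewrite /s; ring].
have W0dE : derive1 W0 = fun t => liouville l t * (s * (P1 t / P t) * (y0.1 t + ln (P t) / m *
  y1.1 t)
   + (y0.2 t + (P1 t / P t) / m * y1.1 t + ln (P t) / m * y1.2 t)).
  by apply/funext => t; exact: is_derive_derive1.
have W0dd (t : R) : is_derive t 1 (derive1 W0)
  (liouville l t * ((s ^+ 2 * (P1 t / P t) ^+ 2 + s * (P2 t / P t - (P1 t / P t) ^+ 2)) * (y0.1
    t + ln (P t) / m * y1.1 t)
   + 2 * s * (P1 t / P t) * (y0.2 t + (P1 t / P t) / m * y1.1 t + ln (P t) / m * y1.2 t)
   + (h t / (m * P t * liouville l t) - (2 * l + m - 2) * hill_weight t * y1.1 t - (1 + (l - 1)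
     * (l + m - 1) * hill_weight t) * y0.1 t
     + (P2 t / P t - (P1 t / P t) ^+ 2) / m * y1.1 t + 2 * (P1 t / P t) / m * y1.2 t
     - ln (P t) / m * ((1 + (l - 1) * (l + m - 1) * hill_weight t) * y1.1 t)))).
  rewrite W0dE; der.
  - exact: Pn0.
  - exact: P0.
  - exact: Pn0.
  - exact: P0.
  by rewrite /s; field; rewrite mn0 Pn0 liouville_neq0.
split => // t.
  rewrite (is_derive_derive1 (W1dd t)) W1dE /bending_op /W1 /hill_weight -/P1 -/P2 /s.
  field; by rewrite mn0 m1n0 Pn0.
rewrite (is_derive_derive1 (W0dd t)) W0dE W1dE /bending_op /bending_op_dl /W1 /W0 /hill_weight
  -/P1 -/P2 /s.
by field; rewrite mn0 m1n0 Pn0 liouville_neq0.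
Qed.

(** The first two equations define A and B, whose denominators are their
    degree l + m - 1 and this degree minus one; the third one is then the
    equation for W, after multiplication by both denominators. *)
Lemma bending_eqs_of_op (l : R) (W0 W1 e1 e2 e3 : R -> R) : 1 < l ->
  smper W0 -> smper W1 -> smper e1 -> smper e2 -> smper e3 ->
  (forall t, bending_op l (W1 t) (derive1 W1 t) (derive1 (derive1 W1) t) t = 0) ->
  (forall t, bending_op l (W0 t) (derive1 W0 t) (derive1 (derive1 W0) t) t
     + bending_op_dl l (W1 t) (derive1 W1 t) t =
     (- derive1 (derive1 e1) t + (l + m - 1) * derive1 e2 t + (l + m - 2) * e1 t
      - (l + m - 1) * (l + m - 2) * e3 t) / (m - 1)) ->
  exists A0 A1 B0 B1,
  [/\ [/\ smper A0, smper A1, smper B0 & smper B1],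
   forall t, [/\ (l + m - 1) * A1 t + m * l * P t * W1 t = 0,
                (l + m - 2) * B1 t + derive1 A1 t + m * P t * derive1 W1 t + l * P1 t * W1 t = 0 &
                derive1 B1 t + A1 t + P1 t * derive1 W1 t = 0] &
   forall t, [/\ (l + m - 1) * A0 t + A1 t + m * P t * (l * W0 t + W1 t) = e1 t,
                (l + m - 2) * B0 t + B1 t + derive1 A0 t + m * P t * derive1 W0 t
                  + P1 t * (l * W0 t + W1 t) = e2 t &
                derive1 B0 t + A0 t + P1 t * derive1 W0 t = e3 t]].
Proof.
move=> l1 sW0 sW1 s1 s2 s3 T1 T0.
have dn0 : l + m - 1 != 0 by rewrite gt_eqF //; have := m2; lra.
have d1n0 : l + m - 2 != 0 by rewrite gt_eqF //; have := m2; lra.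
set d := l + m - 1 in dn0 *; have Deq : l + m - 2 = d - 1 by rewrite /d; ring.
rewrite Deq in d1n0 *.
pose W0' : R -> R := derive1 W0; pose W1' := derive1 W1.
pose W0'' : R -> R := derive1 W0'; pose W1'' := derive1 W1'.
pose e1' : R -> R := derive1 e1; pose e1'' := derive1 e1'; pose e2' := derive1 e2.
have sW0' : smper W0' := smper_derive1 sW0; have sW1' : smper W1' := smper_derive1 sW1.
have se1' : smper e1' := smper_derive1 s1.
have sW0'' : smper W0'' := smper_derive1 sW0'; have sW1'' : smper W1'' := smper_derive1 sW1'.
have W0d := smper_is_derive sW0; have W1d := smper_is_derive sW1.
have W0'd := smper_is_derive sW0'; have W1'd := smper_is_derive sW1'.
have e1d := smper_is_derive s1; have e1'd := smper_is_derive se1'; have e2d := smper_is_derive s2.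
rewrite -/W0' -/W1' -/W0'' -/W1'' -/e1' -/e1'' -/e2' in W0d W1d W0'd W1'd e1d e1'd e2d.
pose A1 t := - (m * l / d) * (P t * W1 t).
pose A1' t := - (m * l / d) * (P1 t * W1 t + P t * W1' t).
have A1d (t : R) : is_derive t 1 A1 (A1' t) by rewrite /A1; der; rewrite /A1'; ring.
pose A0 t := d^-1 * (e1 t - A1 t - m * (P t * (l * W0 t + W1 t))).
pose A0' t := d^-1 * (e1' t - A1' t - m * (P1 t * (l * W0 t + W1 t) + P t * (l * W0' t + W1' t))).
have A0d (t : R) : is_derive t 1 A0 (A0' t) by rewrite /A0; der; rewrite /A0'; ring.
pose B1 t := - (d - 1)^-1 * (A1' t + m * (P t * W1' t) + l * (P1 t * W1 t)).
pose A1'' t := - (m * l / d) * (P2 t * W1 t + 2 * (P1 t * W1' t) + P t * W1'' t).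
have A1'd (t : R) : is_derive t 1 A1' (A1'' t) by rewrite /A1'; der; rewrite /A1''; ring.
pose B1' t := - (d - 1)^-1 * (A1'' t + m * (P1 t * W1' t + P t * W1'' t) + l * (P2 t * W1 t +
  P1 t * W1' t)).
have B1d (t : R) : is_derive t 1 B1 (B1' t) by rewrite /B1; der; rewrite /B1'; ring.
pose A0'' t := d^-1 * (e1'' t - A1'' t - m * (P2 t * (l * W0 t + W1 t) + 2 * (P1 t * (l * W0' t
  + W1' t)) + P t * (l * W0'' t + W1'' t))).
have A0'd (t : R) : is_derive t 1 A0' (A0'' t) by rewrite /A0'; der; rewrite /A0''; ring.
pose B0 t := (d - 1)^-1 * (e2 t - B1 t - A0' t - m * (P t * W0' t) - P1 t * (l * W0 t + W1 t)).
pose B0' t := (d - 1)^-1 * (e2' t - B1' t - A0'' t - m * (P1 t * W0' t + P t * W0'' t)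
   - (P2 t * (l * W0 t + W1 t) + P1 t * (l * W0' t + W1' t))).
have B0d (t : R) : is_derive t 1 B0 (B0' t) by rewrite /B0; der; rewrite /B0'; ring.
have sA1 : smper A1 by rewrite /A1; smper_tac.
have sA1' : smper A1' by rewrite /A1'; smper_tac.
have sA0 : smper A0 by rewrite /A0; smper_tac.
have sA0' : smper A0' by rewrite /A0'; smper_tac.
have sB1 : smper B1 by rewrite /B1; smper_tac.
have sB0 : smper B0 by rewrite /B0; smper_tac.
have T1' t : m * P t * W1'' t = 2 * (l - 1) * P1 t * W1' t -
  (l * (l - 1) / (m - 1) * P2 t + m * l * (l + m - 2) / (m - 1) * P t) * W1 t.
  by apply/eqP; rewrite -subr_eq0; apply/eqP; rewrite -[RHS](T1 t) /bending_op -/W1' -/W1''; ring.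
have T0' t : m * P t * W0'' t = 2 * (l - 1) * P1 t * W0' t -
  (l * (l - 1) / (m - 1) * P2 t + m * l * (l + m - 2) / (m - 1) * P t) * W0 t
  - bending_op_dl l (W1 t) (W1' t) t +
  (- e1'' t + d * e2' t + (d - 1) * e1 t - d * (d - 1) * e3 t) / (m - 1).
  have := T0 t; rewrite -/W0' -/W1' -/W0'' -/e1' -/e1'' -/e2' Deq => <-.
  by rewrite /bending_op Deq; ring.
have lE : l = d - m + 1 by rewrite /d; ring.
(* multiplied by d (d - 1), this is the equation T1' for W1 *)
have B1E t : B1' t = - (A1 t + P1 t * W1' t).
  rewrite /B1' /A1'' /A1.
  apply: (mulIf d1n0); apply: (mulIf dn0).
  transitivity (- (- l * (m * P t * W1'' t) + d * (m * P t * W1'' t) - m * l * (P2 t * W1 t + 2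
    * (P1 t * W1' t))
     + d * (m * (P1 t * W1' t) + l * (P2 t * W1 t + P1 t * W1' t)))).
    by field; rewrite dn0 d1n0.
  by rewrite T1' lE; field; rewrite m1n0 dn0.
exists A0, A1, B0, B1; split=> // t; rewrite ?(is_derive_derive1 (A1d t)) ?(is_derive_derive1
  (B1d t))
  ?(is_derive_derive1 (A0d t)) ?(is_derive_derive1 (B0d t)) -/W0' -/W1'; split.
- by rewrite /A1; field.
- by rewrite /B1; field.
- by rewrite B1E; ring.
- by rewrite /A0; field.
- by rewrite /B0; field.
- rewrite /B0' B1E /A0'' /A1'' /A0 /A1.
  apply: (mulIf d1n0); apply: (mulIf dn0).
  transitivity (d * e2' t + (- m * l * (P t * W1 t) + d * (P1 t * W1' t))
    - (e1'' t + l / d * (m * (P2 t * W1 t) + 2 * m * (P1 t * W1' t) + m * P t * W1'' t)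
       - m * (P2 t * (l * W0 t + W1 t)) - 2 * m * (P1 t * (l * W0' t + W1' t))
       - l * (m * P t * W0'' t) - m * P t * W1'' t)
    - d * (m * (P1 t * W0' t)) - d * (m * P t * W0'' t)
    - d * (P2 t * (l * W0 t + W1 t) + P1 t * (l * W0' t + W1' t))
    + (d - 1) * (e1 t + m * l / d * (P t * W1 t) - m * (P t * (l * W0 t + W1 t)))
    + d * (d - 1) * (P1 t * W0' t)).
    by field; rewrite dn0 d1n0.
  rewrite T0' T1' /bending_op_dl lE; field; by rewrite m1n0 dn0.
Qed.

Lemma smper_bounded (f : R -> R) : smper f -> exists K, forall t, f t <= K.
Proof.
move=> sf; have [B [_ HB]] := smper_angle_bounded sf; exists B => t.
rewrite -(smper_angle_polar t sf ltr01).
exact: le_trans (ler_norm _) (HB _).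
Qed.

(** The equations dR.dU = x^2 e1 + x y e2 + y^2 e3 for a field with polar
    components A, B of degree l + m - 1 and vertical component W of degree l,
    where x, y are the radial and angular components of the direction. Index 1
    marks the coefficient of log r, which has to cancel in the first line. *)
Definition bending_eqs (l : R) (A0 A1 B0 B1 W0 W1 e1 e2 e3 : R -> R) :=
  [/\ [/\ smper A0, smper A1, smper B0, smper B1 & smper W0 /\ smper W1],
   forall t, [/\ (l + m - 1) * A1 t + m * l * P t * W1 t = 0,
                (l + m - 2) * B1 t + derive1 A1 t + m * P t * derive1 W1 t + l * derive1 P t *
                  W1 t = 0 &
                derive1 B1 t + A1 t + derive1 P t * derive1 W1 t = 0] &
   forall t, [/\ (l + m - 1) * A0 t + A1 t + m * P t * (l * W0 t + W1 t) = e1 t,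
                (l + m - 2) * B0 t + B1 t + derive1 A0 t + m * P t * derive1 W0 t
                  + derive1 P t * (l * W0 t + W1 t) = e2 t &
                derive1 B0 t + A0 t + derive1 P t * derive1 W0 t = e3 t]].

Variables (a b del : R).
Hypothesis a0 : 0 <= a.
Hypothesis ab : a < b.
Hypothesis bT : b <= 2 * pi.
Hypothesis del0 : 0 < del.
Hypothesis kdel : forall t, a <= t <= b -> del <= hill_weight t.
Hypothesis k0 : forall t, 0 <= hill_weight t.

Let periodic_solution_smper mu h y : smper h -> hill (fun t => 1 + mu * hill_weight t) h y ->
  y.1 (2 * pi) = y.1 0 -> y.2 (2 * pi) = y.2 0 -> smper y.1.
Proof.
move=> sh hy e1 e2; have [K HK] := smper_bounded hill_weight_smper.
have skap := hill_weight_smper.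
split.
  apply: hill_smooth hy; last by case: sh.
  by have [] : smper (fun t => 1 + mu * hill_weight t) by smper_tac.
apply: (hill_periodic (smper_continuous skap) k0 HK skap.2 hy) => //.
by case: sh.
Qed.

(** Solvability for every right-hand side and every degree l > 1. *)
Lemma bending_eqs_solvable (l : R) (e1 e2 e3 : R -> R) : 1 < l -> smper e1 -> smper e2 -> smper
  e3 ->
  exists A0 A1 B0 B1 W0 W1, bending_eqs l A0 A1 B0 B1 W0 W1 e1 e2 e3.
Proof.
move=> l1 s1 s2 s3; have [K HK] := smper_bounded hill_weight_smper; have skap := hill_weight_smper.
pose h t := (- derive1 (derive1 e1) t + (l + m - 1) * derive1 e2 t + (l + m - 2) * e1 t
      - (l + m - 1) * (l + m - 2) * e3 t) / (m - 1).
have sh : smper h by rewrite /h; smper_tac.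
have spw := liouville_smper l.
pose g t := h t / (m * P t * liouville l t).
have sg : smper g.
  apply: smperM => //; apply: smperV; last by smper_tac.
  by move=> t; rewrite !mulf_neq0 // liouville_neq0.
have kn0 : 2 * l + m - 2 != 0 by rewrite gt_eqF //; have := m2; lra.
have [y0 [y1 [h1 h0 [e01 e02] [e11 e12]]]] :=
  hill_resonant (smper_continuous skap) k0 HK a0 ab bT del0 kdel ((l - 1) * (l + m - 1)) kn0
    (smper_continuous sg).
have sy1 : smper y1.1 by apply: periodic_solution_smper h1 _ _ => //; exact: smper_cst.
have sy0 : smper y0.1 by apply: periodic_solution_smper h0 _ _ => //; smper_tac.
have [sW0 sW1 T1 T0] := bending_op_of_hill sy0 sy1 h1 h0.
have [A0 [A1 [B0 [B1 [[? ? ? ?] H1 H0]]]]] := bending_eqs_of_op l1 sW0 sW1 s1 s2 s3 T1 T0.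
by do 6!eexists; split; [|exact: H1|exact: H0].
Qed.

(** The degree l is the root larger than 1 of
    (l - 1)(l + m - 1) = mu, for mu a large eigenvalue. *)
Lemma bending_eqs_eigen (N : R) : 1 < N -> exists l A B W, [/\ N < l,
  bending_eqs l A (fun=> 0) B (fun=> 0) W (fun=> 0) (fun=> 0) (fun=> 0) (fun=> 0) &
  exists t, W t != 0].
Proof.
move=> N1; have [K HK] := smper_bounded hill_weight_smper; have skap := hill_weight_smper.
have [mu [y [Mmu hy [e1 e2] ne]]] := periodic_eigenvalue (smper_continuous skap) k0 HK a0 ab bT
  del0 kdel
  ((N - 1) * (N + m - 1)).
have mu0 : 0 < mu.
  by apply: le_lt_trans Mmu; rewrite mulr_ge0 //; have := m2; move: N1; lra.
(* l is the positive root of a quadratic equation, s its discriminant's root *)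
pose s : R := Num.sqrt (m ^+ 2 + 4 * mu); pose l : R := (2 - m + s) / 2.
have s2 : s ^+ 2 = m ^+ 2 + 4 * mu.
  by rewrite sqr_sqrtr // addr_ge0 ?sqr_ge0 // mulr_ge0 // ltW.
have muE : (l - 1) * (l + m - 1) = mu.
  have -> : (l - 1) * (l + m - 1) = (s ^+ 2 - m ^+ 2) / 4 by rewrite /l; field.
  by rewrite s2; field.
have Nl : N < l.
  have : 2 * N + m - 2 < s.
    rewrite -(@ltr_pXn2r _ 2) ?nnegrE ?sqrtr_ge0 //; last by have := m2; move: N1; lra.
    rewrite s2; have -> : (2 * N + m - 2) ^+ 2 = m ^+ 2 + 4 * ((N - 1) * (N + m - 1)) by ring.
    by rewrite ltrD2l ltr_pM2l.
  by rewrite /l; lra.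
have sy : smper y.1 by apply: periodic_solution_smper hy _ _ => //; exact: smper_cst.
pose y1 : (R -> R) * (R -> R) := ((fun=> 0), (fun=> 0)).
have h1 : hill (fun t => 1 + (l - 1) * (l + m - 1) * hill_weight t) (fun=> 0) y1.
  by split=> t /=; der; ring.
have h0 : hill (fun t => 1 + (l - 1) * (l + m - 1) * hill_weight t)
    (fun t => 0 / (m * P t * liouville l t) - (2 * l + m - 2) * hill_weight t * y1.1 t) y.
  by rewrite muE; apply: hill_eq hy => t /=; ring.
have [sW0 _ T1 T0] := @bending_op_of_hill l (fun=> 0) y y1 sy (smper_cst 0 : smper y1.1) h1 h0.
set W0 := (fun t => liouville l t * (y.1 t + _)) in sW0 T0.
set W1 := (fun t => liouville l t * y1.1 t) in T1 T0.
have W1E : W1 = fun=> 0 by apply/funext => t; rewrite /W1 /= mulr0.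
rewrite W1E in T1 T0.
have d0 : derive1 (fun _ : R => 0 : R) = fun=> 0.
  by apply/funext => t; rewrite derive1_cst.
have T1' t : bending_op l 0 (derive1 (fun _ : R => 0 : R) t) (derive1 (derive1 (fun _ : R => 0
  : R)) t) t = 0.
  by rewrite !d0 /bending_op; ring.
have l1 : 1 < l by exact: lt_trans Nl.
have [|A0 [A1 [B0 [B1 [[sA0 sA1 sB0 sB1] H1 H0]]]]] :=
  bending_eqs_of_op l1 sW0 (smper_cst 0) (smper_cst 0) (smper_cst 0) (smper_cst 0) T1'.
  move=> t; rewrite !d0; transitivity (0 : R); last by ring.
  have := T0 t; rewrite d0 (_ : liouville l t * y1.1 t = 0) //.
  by rewrite /= mulr0.
have dn0 : l + m - 1 != 0 by rewrite gt_eqF //; have := m2; move: l1; lra.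
have d1n0 : l + m - 2 != 0 by rewrite gt_eqF //; have := m2; move: l1; lra.
have A1E : A1 = fun=> 0.
  apply/funext => t; have [/eqP h _ _] := H1 t; move: h.
  by rewrite mulr0 addr0 mulf_eq0 (negbTE dn0) => /eqP.
have B1E : B1 = fun=> 0.
  apply/funext => t; have [_ /eqP h _] := H1 t; move: h.
  by rewrite A1E !d0 !mulr0 !addr0 mulf_eq0 (negbTE d1n0) => /eqP.
rewrite A1E B1E in H1 H0.
exists l, A0, B0, W0; split=> //.
  by split; [split=> //; [exact: smper_cst|exact: smper_cst|split=> //; exact:
    smper_cst]|exact: H1|exact: H0].
apply: contrapT => /forallNP H.
have yz t : y.1 t = 0.
  have := H t; move/negP; rewrite negbK /W0 /= mulr0 addr0 mulf_eq0 => /orP[|/eqP //].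
  by rewrite (negbTE (liouville_neq0 _ _)).
apply: ne; split; first exact: yz.
apply: (@local_cst_derive R y.1 0 (y.2 0) (-1) 1) => [t _||]; first exact: yz.
  by rewrite ltrN10 ltr01.
exact: hy.1.
Qed.

End Fields.

(** * Vector fields in space *)

Section Vec3.
Variable R : realType.
Implicit Types (p v : R * R) (a b c : R * R -> R).

Lemma dot_vec3 (x y z x' y' z' : R) :
  dot (vec3 x y z) (vec3 x' y' z') = x * x' + y * y' + z * z'.
Proof. by rewrite /dot !big_ord_recl big_ord0 !mxE /= addr0 addrA. Qed.

Lemma dotC (u w : 'rV[R]_3) : dot u w = dot w u.
Proof. by apply: eq_bigr => i _; rewrite mulrC. Qed.
Lemma dotDl (u u' w : 'rV[R]_3) : dot (u + u') w = dot u w + dot u' w.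
Proof. by rewrite /dot -big_split; apply: eq_bigr => i _; rewrite mxE mulrDl. Qed.
Lemma dotZl (x : R) (u w : 'rV[R]_3) : dot (x *: u) w = x * dot u w.
Proof. by rewrite /dot mulr_sumr; apply: eq_bigr => i _; rewrite mxE mulrA. Qed.
Lemma dotDr (u u' w : 'rV[R]_3) : dot w (u + u') = dot w u + dot w u'.
Proof. by rewrite dotC dotDl !(dotC w). Qed.
Lemma dotZr (x : R) (u w : 'rV[R]_3) : dot w (x *: u) = x * dot w u.
Proof. by rewrite dotC dotZl (dotC w). Qed.

Lemma is_derive_fst p v : is_derive p v (fun p : R * R => p.1) v.1.
Proof.
apply: is_derive_line0.
change (is_derive (0 : R) 1 (fun h : R => p.1 + h * v.1) v.1).
by der; ring.
Qed.

Lemma is_derive_snd p v : is_derive p v (fun p : R * R => p.2) v.2.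
Proof.
apply: is_derive_line0.
change (is_derive (0 : R) 1 (fun h : R => p.2 + h * v.2) v.2).
by der; ring.
Qed.

Lemma is_derive_vec3 a b c p v da db dc :
  is_derive p v a da -> is_derive p v b db -> is_derive p v c dc ->
  is_derive p v (fun p => vec3 (a p) (b p) (c p)) (vec3 da db dc).
Proof.
move=> [ad aE] [bd bE] [cd cE].
have E (j : 'I_3) (i : 'I_1) : [\/ (fun p => vec3 (a p) (b p) (c p) i j) = a /\ vec3 da db dc i
  j = da,
   (fun p => vec3 (a p) (b p) (c p) i j) = b /\ vec3 da db dc i j = db |
   (fun p => vec3 (a p) (b p) (c p) i j) = c /\ vec3 da db dc i j = dc].
  case: j => [[|[|[|//]]] ?].
  - by apply: Or31; split; [apply/funext => x|]; rewrite mxE.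
  - by apply: Or32; split; [apply/funext => x|]; rewrite mxE.
  - by apply: Or33; split; [apply/funext => x|]; rewrite mxE.
have D : derivable (fun p => vec3 (a p) (b p) (c p)) p v.
  apply/derivable_mxP => i j.
  by case: (E j i) => -[-> _]; [exact: ad|exact: bd|exact: cd].
split => //; rewrite derive_mx //; apply/matrixP => i j; rewrite [LHS]mxE.
by case: (E j i) => -[-> ->].
Qed.

Lemma vec3_lin (x y z : R) :
  vec3 x y z = x *: vec3 1 0 0 + y *: vec3 0 1 0 + z *: vec3 0 0 1 :> 'rV[R]_3.
Proof.
apply/rowP => j; rewrite !mxE.
by case: j => [[|[|[|//]]] ?] /=; ring.
Qed.

Lemma vec3_continuous a b c p : {for p, continuous a} -> {for p, continuous b} ->
  {for p, continuous c} -> {for p, continuous (fun p => vec3 (a p) (b p) (c p))}.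
Proof.
move=> ac bc cc.
rewrite (_ : (fun p => _) = (fun p => a p *: vec3 1 0 0 + b p *: vec3 0 1 0 + c p *: vec3 0 0 1)).
  by apply: cvgD; [apply: cvgD|]; apply: cvgZr_tmp.
by apply/funext => q; exact: vec3_lin.
Qed.

Lemma vec3_Ck k a b c : Ck k setT a -> Ck k setT b -> Ck k setT c ->
  Ck k setT (fun p => vec3 (a p) (b p) (c p) : 'rV[R]_3).
Proof.
elim: k a b c => [|k IH] a b c /= [ac ad] [bc bd] [cc cd].
  by split=> // p Dp; apply: vec3_continuous; [exact: ac|exact: bc|exact: cc].
split; first by move=> p Dp; apply: vec3_continuous; [exact: ac|exact: bc|exact: cc].
case: ad => ad as' at'; case: bd => bd bs bt; case: cd => cd cs ct.
have ds' p : is_derive p (ds R) (fun p => vec3 (a p) (b p) (c p))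
    (vec3 ('D_(ds R) a p) ('D_(ds R) b p) ('D_(ds R) c p)).
  by apply: is_derive_vec3; apply: derivableP; [case: (ad p I)|case: (bd p I)|case: (cd p I)].
have dt' p : is_derive p (dt R) (fun p => vec3 (a p) (b p) (c p))
    (vec3 ('D_(dt R) a p) ('D_(dt R) b p) ('D_(dt R) c p)).
  by apply: is_derive_vec3; apply: derivableP; [case: (ad p I)|case: (bd p I)|case: (cd p I)].
split.
- by move=> p _; split; [case: (ds' p)|case: (dt' p)].
- rewrite (_ : 'D_(ds R) _ = fun p => vec3 ('D_(ds R) a p) ('D_(ds R) b p) ('D_(ds R) c p)).
    exact: IH.
  by apply/funext => p; case: (ds' p).
- rewrite (_ : 'D_(dt R) _ = fun p => vec3 ('D_(dt R) a p) ('D_(dt R) b p) ('D_(dt R) c p)).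
    exact: IH.
  by apply/funext => p; case: (dt' p).
Qed.

Lemma Ck_add (V : normedModType R) k (f g : R * R -> V) : Ck k setT f -> Ck k setT g ->
  Ck k setT (fun p => f p + g p).
Proof.
elim: k f g => [|k IH] f g /= [fc fd] [gc gd].
  by split=> // p Dp; apply: cvgD; [exact: fc|exact: gc].
split; first by move=> p Dp; apply: cvgD; [exact: fc|exact: gc].
case: fd => fd fs ft; case: gd => gd gs gt.
have Deq v : (forall p, derivable f p v) -> (forall p, derivable g p v) ->
  'D_v (fun p => f p + g p) = fun p => 'D_v f p + 'D_v g p.
  by move=> fv gv; apply/funext => p; exact: deriveD.
split.
- by move=> p _; have [? ?] := fd p I; have [? ?] := gd p I; split; exact: derivableD.
- by rewrite Deq; [exact: IH|move=> p; case: (fd p I)|move=> p; case: (gd p I)].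
- by rewrite Deq; [exact: IH|move=> p; case: (fd p I)|move=> p; case: (gd p I)].
Qed.

End Vec3.

(** * Polar fields along the graph *)

Section Surf.
Variable R : realType.
Variables (m : R) (P : R -> R).
Hypothesis m2 : 2 <= m.
Hypothesis sP : smper P.
Implicit Types (p v : R * R).

(** The field with polar components r^(l+m-1) (A0 + log r A1) and
    r^(l+m-1) (B0 + log r B1), written in Cartesian coordinates. *)
Definition polar_field (l : R) (A0 A1 B0 B1 W0 W1 : R -> R) (p : R * R) : 'rV[R]_3 :=
  vec3 (powlog (l + m - 1) (fun t => A0 t * cos t - B0 t * sin t) (fun t => A1 t * cos t - B1 t
    * sin t) p)
       (powlog (l + m - 1) (fun t => A0 t * sin t + B0 t * cos t) (fun t => A1 t * sin t + B1 t
         * cos t) p)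
       (powlog l W0 W1 p).

Let Z := powlog m P (fun=> 0).

Lemma polar_field_Ck k l A0 A1 B0 B1 W0 W1 : k%:R < l ->
  smper A0 -> smper A1 -> smper B0 -> smper B1 -> smper W0 -> smper W1 -> Ck k setT
    (polar_field l A0 A1 B0 B1 W0 W1).
Proof.
move=> kl *; have kd : k%:R < l + m - 1 by have := m2; lra.
by apply: vec3_Ck; apply: powlog_Ck => //; smper_tac.
Qed.

(** The radial, angular and vertical components of the derivative of a
    polar field, without their powers of r, for L = log r. *)
Definition polar_components (l : R) (A0 A1 B0 B1 W0 W1 : R -> R) (x y : R) (t L : R) : R * R * R :=
  let d := l + m - 1 in
  (x * (d * (A0 t + L * A1 t) + A1 t) + y * (derive1 A0 t + L * derive1 A1 t - (B0 t + L * B1 t)),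
   x * (d * (B0 t + L * B1 t) + B1 t) + y * (derive1 B0 t + L * derive1 B1 t + (A0 t + L * A1 t)),
   x * (l * (W0 t + L * W1 t) + W1 t) + y * (derive1 W0 t + L * derive1 W1 t)).

Lemma polar_field_is_derive l A0 A1 B0 B1 W0 W1 p v : 1 < l ->
  smper A0 -> smper A1 -> smper B0 -> smper B1 -> smper W0 -> smper W1 ->
  let t := angle p in
  let X := polar_components l A0 A1 B0 B1 W0 W1 (radial p v) (angular p v) t (ln (radius p)) in
  is_derive p v (polar_field l A0 A1 B0 B1 W0 W1)
    (vec3 (radius p `^ (l + m - 2) * (X.1.1 * cos t - X.1.2 * sin t))
          (radius p `^ (l + m - 2) * (X.1.1 * sin t + X.1.2 * cos t))
          (radius p `^ (l - 1) * X.2)).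
Proof.
move=> l1 sA0 sA1 sB0 sB1 sW0 sW1 t X.
have d1 : 1 < l + m - 1 by have := m2; lra.
have dd : l + m - 1 - 1 = l + m - 2 by ring.
have A0d := smper_is_derive sA0; have A1d := smper_is_derive sA1.
have B0d := smper_is_derive sB0; have B1d := smper_is_derive sB1.
have sc0 : smper (fun t => A0 t * cos t - B0 t * sin t) by smper_tac.
have sc1 : smper (fun t => A1 t * cos t - B1 t * sin t) by smper_tac.
have ss0 : smper (fun t => A0 t * sin t + B0 t * cos t) by smper_tac.
have ss1 : smper (fun t => A1 t * sin t + B1 t * cos t) by smper_tac.
have c0d : derive1 (fun t => A0 t * cos t - B0 t * sin t) t =
  (derive1 A0 t - B0 t) * cos t - (derive1 B0 t + A0 t) * sin t.
  by apply: is_derive_derive1; der; ring.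
have c1d : derive1 (fun t => A1 t * cos t - B1 t * sin t) t =
  (derive1 A1 t - B1 t) * cos t - (derive1 B1 t + A1 t) * sin t.
  by apply: is_derive_derive1; der; ring.
have s0d : derive1 (fun t => A0 t * sin t + B0 t * cos t) t =
  (derive1 A0 t - B0 t) * sin t + (derive1 B0 t + A0 t) * cos t.
  by apply: is_derive_derive1; der; ring.
have s1d : derive1 (fun t => A1 t * sin t + B1 t * cos t) t =
  (derive1 A1 t - B1 t) * sin t + (derive1 B1 t + A1 t) * cos t.
  by apply: is_derive_derive1; der; ring.
have h1 := powlog_is_derive p v d1 sc0 sc1.
have h2 := powlog_is_derive p v d1 ss0 ss1.
have h3 := powlog_is_derive p v l1 sW0 sW1.
have := is_derive_vec3 h1 h2 h3; rewrite /polar_field; congr is_derive.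
by rewrite /powlog /powlog_d0 /powlog_d1 -/(radial p v) -/(angular p v) -/t c0d c1d s0d s1d dd
  /X /polar_components /=;
  congr vec3; ring.
Qed.

Lemma graph_is_derive p v :
  is_derive p v (graph Z) (vec3 v.1 v.2
    (radius p `^ (m - 1) * (radial p v * (m * P (angle p)) + angular p v * derive1 P (angle p)))).
Proof.
have m1 : 1 < m by have := m2; lra.
have h3 := powlog_is_derive p v m1 sP (smper_cst 0).
have := is_derive_vec3 (is_derive_fst p v) (is_derive_snd p v) h3; rewrite /graph; congr
  is_derive; congr vec3.
by rewrite /powlog /powlog_d0 /powlog_d1 derive1_cst -/(radial p v) -/(angular p v); ring.
Qed.

Lemma radial_angularE p v : v.1 = radial p v * cos (angle p) - angular p v * sin (angle p) /\
  v.2 = radial p v * sin (angle p) + angular p v * cos (angle p).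
Proof.
rewrite /radial /angular; split.
  transitivity (v.1 * (cos (angle p) ^+ 2 + sin (angle p) ^+ 2)); last by ring.
  by rewrite cos2Dsin2 mulr1.
transitivity (v.2 * (cos (angle p) ^+ 2 + sin (angle p) ^+ 2)); last by ring.
by rewrite cos2Dsin2 mulr1.
Qed.

Lemma radius_powR p a b : a + b != 0 -> a != 0 -> radius p `^ a * radius p `^ b = radius p `^
  (a + b).
Proof.
move=> ab an0; have [->|p0] := eqVneq p 0.
  by rewrite radius0 (powR0 an0) (powR0 ab) mul0r.
by rewrite powRD // implybE (gt_eqF (radius_gt0 p0)) orbT.
Qed.

(** Powers of r factor out because l + m - 2 = (m - 1) + (l - 1); at the
    origin both sides vanish. *)
Lemma dot_graph_polar_field l A0 A1 B0 B1 W0 W1 e1 e2 e3 p v : 1 < l ->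
  bending_eqs m P l A0 A1 B0 B1 W0 W1 e1 e2 e3 ->
  let x := radial p v in let y := angular p v in let t := angle p in
  dot ('D_v (graph Z) p) ('D_v (polar_field l A0 A1 B0 B1 W0 W1) p) =
  radius p `^ (l + m - 2) * (x ^+ 2 * e1 t + x * y * e2 t + y ^+ 2 * e3 t).
Proof.
move=> l1 [[sA0 sA1 sB0 sB1 [sW0 sW1]] H1 H0] x y t.
have [_ ->] := graph_is_derive p v.
have [_ ->] := polar_field_is_derive p v l1 sA0 sA1 sB0 sB1 sW0 sW1.
rewrite dot_vec3 -/x -/y -/t; set L := ln (radius p).
have [v1 v2] := radial_angularE p v; rewrite -/x -/y -/t in v1 v2.
have rE : radius p `^ (l + m - 2) = radius p `^ (m - 1) * radius p `^ (l - 1).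
  by rewrite radius_powR; [congr (_ `^ _); ring|rewrite gt_eqF //; have := m2; move: l1; lra..].
have [z1 z2 z3] := H1 t; have [<- <- <-] := H0 t.
have cs : cos t ^+ 2 = 1 - sin t ^+ 2 by rewrite cos2sin2.
set X := polar_components _ _ _ _ _ _ _ _ _ _ _.
have -> : v.1 * (radius p `^ (l + m - 2) * (X.1.1 * cos t - X.1.2 * sin t)) +
  v.2 * (radius p `^ (l + m - 2) * (X.1.1 * sin t + X.1.2 * cos t)) =
  radius p `^ (l + m - 2) * (x * X.1.1 + y * X.1.2).
  rewrite v1 v2.
  transitivity (radius p `^ (l + m - 2) * (x * X.1.1 + y * X.1.2) * (cos t ^+ 2 + sin t ^+ 2));
    first by ring.
  by rewrite cos2Dsin2 mulr1.
rewrite {}rE; apply/eqP; rewrite -subr_eq0; apply/eqP.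
transitivity (radius p `^ (m - 1) * radius p `^ (l - 1) * L * (
   x ^+ 2 * ((l + m - 1) * A1 t + m * l * P t * W1 t) +
   x * y * ((l + m - 2) * B1 t + derive1 A1 t + m * P t * derive1 W1 t + l * derive1 P t * W1 t) +
   y ^+ 2 * (derive1 B1 t + A1 t + derive1 P t * derive1 W1 t))).
  by rewrite /X /polar_components /=; ring.
by rewrite z1 z2 z3; ring.
Qed.

(** The horizontal and the vertical parts have different degrees: these are
    the two right-hand sides of the second order problem. *)
Lemma dot_polar_field_self l A B W p v : 1 < l -> smper A -> smper B -> smper W ->
  let x := radial p v in let y := angular p v in let t := angle p in
  let U := polar_field l A (fun=> 0) B (fun=> 0) W (fun=> 0) in
  let d := l + m - 1 in
  dot ('D_v U p) ('D_v U p) =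
  radius p `^ (2 * (l + m - 2)) * (x ^+ 2 * (d ^+ 2 * (A t ^+ 2 + B t ^+ 2)) +
     x * y * (2 * d * (A t * derive1 A t + B t * derive1 B t)) +
     y ^+ 2 * ((derive1 A t - B t) ^+ 2 + (derive1 B t + A t) ^+ 2)) +
  radius p `^ (2 * (l - 1)) * (x ^+ 2 * (l ^+ 2 * W t ^+ 2) + x * y * (2 * l * (W t * derive1 W t))
     + y ^+ 2 * derive1 W t ^+ 2).
Proof.
move=> l1 sA sB sW x y t U d.
have [_ ->] := polar_field_is_derive p v l1 sA (smper_cst 0) sB (smper_cst 0) sW (smper_cst 0).
rewrite dot_vec3 -/x -/y -/t; set L := ln (radius p).
have h (a : R) : 0 < a -> radius p `^ (2 * a) = radius p `^ a * radius p `^ a.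
  move=> a0; rewrite radius_powR ?gt_eqF ?addr_gt0 //; congr (_ `^ _); ring.
rewrite !h; [|have := m2; move: l1; lra..].
rewrite /polar_components /= derive1_cst.
set r := radius p `^ (l + m - 2); set r' := radius p `^ (l - 1).
rewrite -/d.
set X := x * (d * (A t + L * 0) + 0) + _; set Y := x * (d * (B t + L * 0) + 0) + _.
transitivity (r * r * (X ^+ 2 + Y ^+ 2) * (cos t ^+ 2 + sin t ^+ 2) + r' * r' *
  (x * (l * (W t + L * 0) + 0) + y * (derive1 W t + L * 0)) ^+ 2); first by ring.
by rewrite cos2Dsin2 /X /Y; ring.
Qed.

End Surf.

(** * Bendings of order two *)

Section Bending.
Variable R : realType.

Lemma vec3_differentiable (a b c : R * R -> R) p :
  differentiable a p -> differentiable b p -> differentiable c p ->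
  differentiable (fun p => vec3 (a p) (b p) (c p) : 'rV[R]_3) p.
Proof.
move=> da db dc.
rewrite (_ : (fun p => _) = (fun p => a p *: vec3 1 0 0) + (fun p => b p *: vec3 0 1 0)
   + (fun p => c p *: vec3 0 0 1)); last by apply/funext => q; exact: vec3_lin.
by apply: differentiableD; [apply: differentiableD|]; exact: differentiableZl.
Qed.

Lemma dot_deformation (x u w : 'rV[R]_3) (e : R) :
  dot (x + 2 *: (e *: u + e ^+ 2 *: w)) (x + 2 *: (e *: u + e ^+ 2 *: w)) =
  dot x x + 4 * e * dot x u + 4 * e ^+ 2 * (dot x w + dot u u)
  + e ^+ 3 * (8 * dot u w) + e ^+ 4 * (4 * dot w w).
Proof.
rewrite !dotDl !dotDr !dotZl !dotZr !dotDl !dotDr !dotZl !dotZr.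
rewrite (dotC u x) (dotC w x) (dotC w u); ring.
Qed.

(** The terms of order 1 and 2 cancel, and what remains is a combination of
    e^3 and e^4. *)
Lemma bending_order2 (X : R * R -> 'rV[R]_3) (U : nat -> R * R -> 'rV[R]_3) :
  (forall p, differentiable X p) -> (forall p, differentiable (U 1%N) p) ->
  (forall p, differentiable (U 2%N) p) ->
  (forall p v, dot ('D_v X p) ('D_v (U 1%N) p) = 0) ->
  (forall p v, dot ('D_v X p) ('D_v (U 2%N) p) = - dot ('D_v (U 1%N) p) ('D_v (U 1%N) p)) ->
  infinitesimal_bending X 2 (deformation X 2 U).
Proof.
move=> Xdiff d1 d2 H1 H2.
have dfE e : deformation X 2 U e = X + 2 *: (e *: U 1%N + e ^+ 2 *: U 2%N).
  apply/funext => p; rewrite /deformation big_ltn // big_ltn // big_geq // addr0 expr1.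
  by [].
split.
  move=> e p; rewrite dfE.
  have h1 := differentiableZ e (d1 p); have h2 := differentiableZ (e ^+ 2) (d2 p).
  exact: (differentiableD (Xdiff p) (differentiableZ 2 (differentiableD h1 h2))).
move=> p v.
have vX := @diff_derivable _ _ _ _ _ v (Xdiff p); have v1 := @diff_derivable _ _ _ _ _ v (d1
  p); have v2 := @diff_derivable _ _ _ _ _ v (d2 p).
have DE e : 'D_v (deformation X 2 U e) p =
  'D_v X p + 2 *: (e *: 'D_v (U 1%N) p + e ^+ 2 *: 'D_v (U 2%N) p).
  rewrite dfE.
  have [] : is_derive p v (X + 2 *: (e *: U 1%N + e ^+ 2 *: U 2%N))
    ('D_v X p + 2 *: (e *: 'D_v (U 1%N) p + e ^+ 2 *: 'D_v (U 2%N) p)).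
    have h1 := is_deriveZ e (derivableP v1); have h2 := is_deriveZ (e ^+ 2) (derivableP v2).
    exact: (is_deriveD (derivableP vX) (is_deriveZ 2 (is_deriveD h1 h2))).
  by [].
pose c3 := 8 * dot ('D_v (U 1%N) p) ('D_v (U 2%N) p).
pose c4 := 4 * dot ('D_v (U 2%N) p) ('D_v (U 2%N) p).
have E (e : R) : dot ('D_v (deformation X 2 U e) p) ('D_v (deformation X 2 U e) p) -
   dot ('D_v X p) ('D_v X p) = e ^+ 3 * c3 + e ^+ 4 * c4.
  rewrite DE dot_deformation H1 H2 addNr /c3 /c4.
  move: (dot _ _) (dot _ _) (dot _ _) => d0 d1' d2'; ring.
move=> e; rewrite [X in _ = X e]littleoE // => eps eps0 /=.
have C0 : 0 < `|c3| + `|c4| + 1 by rewrite ltr_wpDl // addr_ge0.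
have N1 : \forall h \near (0 : R), `|h| < eps / (`|c3| + `|c4| + 1).
  by apply: nbhs0_lt; rewrite divr_gt0.
have N2 : \forall h \near (0 : R), `|h| < 1 by exact: nbhs0_lt.
suff : \forall h \near (0 : R), `|dot ('D_v (deformation X 2 U h) p) ('D_v (deformation X 2 U h) p)
   - dot ('D_v X p) ('D_v X p)| <= eps * `|h ^+ 2| by [].
apply: filterS2 N1 N2 => h h1 h2; rewrite E.
have -> : h ^+ 3 * c3 + h ^+ 4 * c4 = h * (c3 + h * c4) * h ^+ 2 by ring.
rewrite normrM ler_wpM2r // normrM.
apply: le_trans (_ : `|h| * (`|c3| + `|c4| + 1) <= _); last first.
  by rewrite -ler_pdivlMr // ltW.
rewrite ler_wpM2l //; apply: le_trans (ler_normD _ _) _.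
rewrite -addrA lerD2l normrM; apply: le_trans (_ : 1 * `|c4| <= _); last by rewrite mul1r lerDl.
by rewrite ler_wpM2r // ltW.
Qed.

End Bending.

(** * The graph of a homogeneous function *)

Section Graph.
Variable R : realType.
Implicit Types (p v : R * R).

Lemma homogeneous_powlog (m : R) (z : R * R -> R) : m != 0 -> homogeneous m z ->
  z = powlog m (Pz z) (fun=> 0).
Proof.
move=> m0 hz; apply/funext => p; have [->|p0] := eqVneq p 0.
  rewrite powlog0 //; have := hz 2 0 (ltr0n _ 2); rewrite scaler0 => h.
  have : (2 `^ m - 1) * z 0 = 0 by rewrite mulrBl mul1r -h subrr.
  move=> /eqP; rewrite mulf_eq0 => /orP[|/eqP //].
  rewrite subr_eq0 powR_eq1 (negbTE m0) orbF => /orP[|]; first by rewrite -subr_eq0; lra.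
  by rewrite ltNge ler0n.
have r0 := radius_gt0 p0; have [p1 p2] := radius_angleE p0.
have pE : p = radius p *: polar 1 (angle p).
  by apply: injective_projections; rewrite /= mul1r.
by rewrite {1}pE hz // /powlog mulr0 addr0.
Qed.

Lemma Pz_smper (z : R * R -> R) : (forall k, Ck k [set p | p != 0] z) -> smper (Pz z).
Proof.
move=> zs; split; first exact: polar_smooth.
by move=> t; rewrite /Pz /polar mulr_natl sinD2pi cosD2pi.
Qed.

Lemma dot_vertical (a : R) (u : 'rV[R]_3) : dot (vec3 0 0 a) u = a * dot (vec3 0 0 1) u.
Proof.
rewrite -dotZl; congr dot; apply/rowP => j; rewrite !mxE.
by case: j => [[|[|[|//]]] ?] /=; ring.
Qed.

(** Where P and P' vanish the Hessian of r^m P is a multiple of the square of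
    the angular component, so the radial direction is isotropic. *)
Lemma second_form_flat_ray (m : R) (P : R -> R) p v : 2 <= m -> smper P -> p != 0 ->
  P (angle p) = 0 -> derive1 P (angle p) = 0 -> angular p v = 0 ->
  second_form (graph (powlog m P (fun=> 0))) p v = 0.
Proof.
move=> m2 sP p0 Pp P'p vp.
have m1 : 1 < m by lra.
set Z := powlog m P (fun=> 0); set th := angle p in Pp P'p *.
have cst0 w : powlog_d1 m (fun=> 0) w = fun=> 0.
  by apply/funext => t; rewrite /powlog_d1 derive1_cst; ring.
have sf w : smper (powlog_d0 m P (fun=> 0) w) by apply: powlog_d0_smper => //; exact: smper_cst.
have ZE w q : is_derive q w Z (powlog (m - 1) (powlog_d0 m P (fun=> 0) w) (fun=> 0) q).
  by have := powlog_is_derive q w m1 sP (smper_cst 0); rewrite cst0.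
have ZdE w : 'D_w Z = powlog (m - 1) (powlog_d0 m P (fun=> 0) w) (fun=> 0).
  by apply/funext => q; case: (ZE w q).
have gE w : 'D_w (graph Z) = fun q => vec3 w.1 w.2 ('D_w Z q).
  apply/funext => q.
  have [_ h] := is_derive_vec3 (is_derive_fst q w) (is_derive_snd q w) (ZE w q).
  transitivity (vec3 w.1 w.2 (powlog (m - 1) (powlog_d0 m P (fun=> 0) w) (fun=> 0) q)); first
    exact: h.
  by case: (ZE w q) => _ ->.
have Pd := smper_is_derive sP; have P'd := smper_is_derive (smper_derive1 sP).
have fE w : derive1 (powlog_d0 m P (fun=> 0) w) th = derive1 (derive1 P) th * angular p w.
  apply: is_derive_derive1; rewrite /powlog_d0; der.
  by rewrite Pp P'p /angular -/th; ring.
have f0 w : powlog_d0 m P (fun=> 0) w th = 0.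
  by rewrite /powlog_d0 Pp P'p; ring.
pose K := radius p `^ (m - 1 - 1) * derive1 (derive1 P) th.
have ZZ u w : is_derive p w ('D_u Z) (K * (angular p u * angular p w)).
  rewrite ZdE; have := powlog_is_derive_neq0 (m - 1) w (sf u) (smper_cst 0) p0; congr is_derive.
  rewrite /powlog {1}/powlog_d0 /powlog_d1 -/th f0 fE derive1_cst -/(angular p w) /K; ring.
have gg u w : 'D_w ('D_u (graph Z)) p = vec3 0 0 (K * (angular p u * angular p w)).
  rewrite gE.
  by have [_ h] := is_derive_vec3 (der_cst u.1 p w) (der_cst u.2 p w) (ZZ u w).
pose n := dot (vec3 0 0 1) (unit_normal (graph Z) p).
have sE u w : dot ('D_w ('D_u (graph Z)) p) (unit_normal (graph Z) p) =
    K * (angular p u * angular p w) * n.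
  by rewrite /n; move: (unit_normal _ _) => N; rewrite gg dot_vertical.
have sL : sfL (graph Z) p = K * (angular p (ds R) * angular p (ds R)) * n by exact: sE.
have sM : sfM (graph Z) p = K * (angular p (ds R) * angular p (dt R)) * n by exact: sE.
have sN : sfN (graph Z) p = K * (angular p (dt R) * angular p (dt R)) * n by exact: sE.
rewrite /second_form sL sM sN; clear sL sM sN sE; clearbody n.
transitivity (K * n * (angular p (ds R) * v.1 + angular p (dt R) * v.2) ^+ 2); first by ring.
have -> : angular p (ds R) * v.1 + angular p (dt R) * v.2 = angular p v.
  by rewrite /angular /=; ring.
by rewrite vp; ring.
Qed.

(** Above a zero of P the ray itself would be an asymptotic curve. *)
Lemma Pz_gt0 (m : R) (z : R * R -> R) : 2 <= m -> (forall p, 0 <= z p) ->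
  homogeneous m z -> smper (Pz z) ->
  (forall a b g, ~ asymptotic_curve (graph z) [set p | p != 0] a b g) ->
  forall t, 0 < Pz z t.
Proof.
move=> m2 z0 hz sP na t0; rewrite lt_def z0 andbT; apply/eqP => Pt.
have m0 : m != 0 by rewrite gt_eqF //; lra.
have Pd := smper_is_derive sP.
have P't : derive1 (Pz z) t0 = 0.
  have le : t0 - 1 <= t0 + 1 by lra.
  have d x : x \in `]t0 - 1, t0 + 1[ -> derivable (Pz z) x 1 by move=> _; case: (Pd x).
  have i : t0 \in `]t0 - 1, t0 + 1[ by rewrite in_itv /=; apply/andP; split; lra.
  have mi x : x \in `]t0 - 1, t0 + 1[ -> Pz z t0 <= Pz z x by rewrite Pt z0.
  exact: is_derive_derive1 (derive1_at_min le d i mi).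
pose w := polar 1 t0; pose g (x : R) := x *: w.
have gd (x : R) : is_derive x 1 g w.
  have := is_derive_line (@id (R * R)) 0 w x w => -[H _].
  have -> : g = (fun h : R => id (0 + h *: w)) by apply/funext => h; rewrite add0r.
  by apply: H; exact: is_derive_id.
have g1 : derive1 g = fun=> w.
  by apply/funext => x; rewrite derive1E; case: (gd x).
have gn n : exists c, derive1n n.+1 g = fun=> c.
  elim: n => [|n [c IH]]; first by exists w; rewrite derive1nS derive1n0.
  by exists 0; rewrite derive1nS IH; apply/funext => x; rewrite derive1_cst.
apply: (na 1 2 g); split; first by lra.
move=> x /andP[x1 x2]; have x0 : 0 < x by lra.
have xw : x *: w = polar x t0.
  by apply: injective_projections; rewrite /= mul1r.
have p0 : g x != 0 by rewrite scaler_eq0 negb_or gt_eqF //= polar_neq0.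
split => //.
- case=> [|n]; first by case: (gd x).
  by have [c ->] := gn n; exact: derivable_cst.
- by rewrite g1; exact: polar_neq0.
have [ca sa] : cos (angle (g x)) = cos t0 /\ sin (angle (g x)) = sin t0.
  by rewrite /g xw; exact: cos_sin_angle_polar.
rewrite (homogeneous_powlog m0 hz) g1; apply: second_form_flat_ray => //.
- by rewrite (periodic_angle sP.2 ca sa).
- by rewrite (periodic_angle (smper_derive1 sP).2 ca sa).
by rewrite /angular ca sa /=; ring.
Qed.

Lemma avoid_seq (s : seq R) (a b : R) : a < b -> exists x, a < x < b /\ x \notin s.
Proof.
elim: s a b => [|y s IH] a b ab; first by exists ((a + b) / 2); split => //; lra.
have [ya|ya] := leP y a.
  have [x [/andP[ax xb] xs]] := IH _ _ ab; exists x; split; first by rewrite ax.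
  by rewrite in_cons negb_or xs andbT gt_eqF // (le_lt_trans ya).
have : a < Num.min y b by rewrite lt_min ya.
move=> /IH[x [/andP[ax]]]; rewrite lt_min => /andP[xy xb] xs; exists x; split; first by rewrite ax.
by rewrite in_cons negb_or xs andbT lt_eqF.
Qed.

End Graph.

(** * The sign of the weight and the bending itself *)

Section Curvature.
Variable R : realType.

Lemma continuous_lt_interval (f : R -> R) (t c : R) : continuous f -> c < f t ->
  exists e, 0 < e /\ forall s, `|t - s| < e -> c < f s.
Proof.
move=> fc ct.
have /nbhs_ballP[e /= e0 H] : \forall s \near t, c < f s by apply: (cvgr_gt _ (fc t)).
by exists e; split => // s ts; exact: H.
Qed.

(** A negative value would persist on an interval, hence at a point outside
    the finite exceptional set. The weight is bounded below near any point where
    it is positive. *)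
Lemma hill_weight_ge0 (m : R) (P : R -> R) (s : seq R) : 2 <= m -> smper P -> (forall t, 0 < P t) ->
  (forall t, 0 <= t < 2 * pi -> t \notin s ->
    0 < m ^+ 2 * P t ^+ 2 + m * P t * derive1 (derive1 P) t - (m - 1) * derive1 P t ^+ 2) ->
  (forall t, 0 <= hill_weight m P t) /\
  exists a b del, [/\ 0 <= a, a < b, b <= 2 * pi, 0 < del &
    forall t, a <= t <= b -> del <= hill_weight m P t].
Proof.
move=> m2 sP P0 H.
have p2 : 0 < 2 * pi :> R by rewrite mulr_gt0 // pi_gt0.
have sk := hill_weight_smper m2 sP P0; have kc := smper_continuous sk.
have kpos t : 0 <= t < 2 * pi -> t \notin s -> 0 < hill_weight m P t.
  move=> tp ts; rewrite /hill_weight divr_gt0 //; first exact: H.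
  by rewrite !mulr_gt0 ?exprn_gt0 //; have := m2; lra.
have k0 t : 0 <= t < 2 * pi -> 0 <= hill_weight m P t.
  move=> /andP[t0 tp]; rewrite leNgt; apply/negP => kt.
  have kt' : 0 < - hill_weight m P t by rewrite oppr_gt0.
  have [|e [e0 He]] := @continuous_lt_interval (fun t => - hill_weight m P t) t 0 _ kt'.
    by move=> u; apply: cvgN; exact: kc.
  have : t < Num.min (t + e) (2 * pi) by rewrite lt_min tp ltrDl e0.
  move=> /(avoid_seq s)[x [/andP[tx]]]; rewrite lt_min => /andP[xe xp] xs.
  have x0 : 0 <= x < 2 * pi by rewrite xp andbT ltW // (le_lt_trans t0).
  have := kpos x x0 xs; have := He x; rewrite distrC gtr0_norm ?subr_gt0 // => h1 h2.
  have : 0 < - hill_weight m P x by apply: h1; lra.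
  lra.
split.
  move=> t; pose n := Num.floor (t / (2 * pi)).
  rewrite -(subrK (n%:~R * (2 * pi)) t) (periodic_int _ _ sk.2); apply: k0.
  rewrite subr_ge0 -ler_pdivlMr // floor_le /=.
  rewrite ltrBlDl -[X in _ + X]mul1r -mulrDl -ltr_pdivrMr //.
  by have := floorD1_gt (t / (2 * pi)); rewrite intrD.
have [t [/andP[t0 tp] ts]] := avoid_seq s p2.
have kt : 0 < hill_weight m P t by apply: kpos => //; rewrite ltW.
have k2 : hill_weight m P t / 2 < hill_weight m P t by lra.
have [e [e0 He]] := continuous_lt_interval kc k2.
exists t, (Num.min (t + e / 2) (2 * pi)), (hill_weight m P t / 2); split.
- exact: ltW.
- by rewrite lt_min tp ltrDl divr_gt0.
- by rewrite ge_min lexx orbT.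
- by rewrite divr_gt0.
move=> x /andP[tx]; rewrite le_min => /andP[xe _].
by apply: ltW; apply: He; rewrite distrC ger0_norm ?subr_ge0 //; lra.
Qed.

Lemma polar_field_differentiable (m l : R) (A0 A1 B0 B1 W0 W1 : R -> R) p : 2 <= m -> 1 < l ->
  smper A0 -> smper A1 -> smper B0 -> smper B1 -> smper W0 -> smper W1 ->
  differentiable (polar_field m l A0 A1 B0 B1 W0 W1) p.
Proof.
move=> m2 l1 sA0 sA1 sB0 sB1 sW0 sW1.
have d1 : 1 < l + m - 1 by lra.
have H a f0 f1 : 1 < a -> smper f0 -> smper f1 -> differentiable (powlog a f0 f1) p.
  move=> a1 s0 s1; have c : Ck 1 setT (powlog a f0 f1) by exact: powlog_Ck.
  by have [] := @C1_differentiable R _ setT p openT I c.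
by apply: vec3_differentiable; apply: H => //; smper_tac.
Qed.

Lemma lin_form_differentiable (a b : R) p : differentiable (lin_form a b) p.
Proof.
have lc : continuous (lin_form a b).
  move=> v; apply: cvgD; (apply: cvgM; first exact: cvg_cst).
    exact: cvg_fst.
  exact: cvg_snd.
have [] // := @differentiableI R _ _ (lin_form a b) (lin_form a b) p lc.
move=> e e0; near=> h; rewrite linearD [X in X - _]addrC subrr normr0.
by rewrite mulr_ge0 // ltW.
Unshelve. all: by end_near. Qed.

Lemma graph_differentiable (m : R) (P : R -> R) p : 2 <= m -> smper P ->
  differentiable (graph (powlog m P (fun=> 0))) p.
Proof.
move=> m2 sP; have m1 : 1 < m by lra.
have f1 : (fun p : R * R => p.1) = lin_form 1 0 by apply/funext => q; rewrite /lin_form; ring.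
have f2 : (fun p : R * R => p.2) = lin_form 0 1 by apply/funext => q; rewrite /lin_form; ring.
have h1 : differentiable (fun p : R * R => p.1) p by rewrite f1; exact: lin_form_differentiable.
have h2 : differentiable (fun p : R * R => p.2) p by rewrite f2; exact: lin_form_differentiable.
have c : Ck 1 setT (powlog m P (fun=> 0)) by apply: powlog_Ck => //; exact: smper_cst.
have [h3 _] := @C1_differentiable R _ setT p openT I c.
exact: vec3_differentiable h1 h2 h3.
Qed.

(** The vertical component of a trivial field is affine on every ray, whereas
    that of the field is r^l W with l > 1; radii 0, 1 and 2 suffice to tell them
    apart. *)
Lemma polar_field_nontrivial (z : R * R -> R) (m l : R) (A B W : R -> R) (t0 : R) :
  1 < l -> smper W -> W t0 != 0 ->
  ~ trivial_field (graph z) (polar_field m l A (fun=> 0) B (fun=> 0) W (fun=> 0)).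
Proof.
move=> l1 sW Wt0 [C [D HC]].
pose c0 := C 0 (inord 0); pose c1 := C 0 (inord 1); pose d2 := D 0 (inord 2).
have third p : powlog l W (fun=> 0) p = c0 * p.2 - c1 * p.1 + d2.
  have := congr1 (fun u : 'rV[R]_3 => u 0 (inord 2)) (HC p).
  by rewrite /polar_field /cross /graph /= !mxE /= !inordK.
have ray (r : R) : 0 < r -> powlog l W (fun=> 0) (polar r t0) = r `^ l * W t0.
  move=> r0; have rE : radius (polar r t0) = r by rewrite radius_polar // ltW.
  by rewrite /powlog rE mulr0 addr0 smper_angle_polar.
have d20 : d2 = 0.
  have := third 0; rewrite powlog0; last by rewrite gt_eqF // (lt_trans ltr01).
  by rewrite /= !mulr0 subrr add0r.
have h1 := third (polar 1 t0); have h2 := third (polar 2 t0).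
rewrite !ray // d20 addr0 /= powR1 !mul1r in h1 h2.
have : (2 `^ l - 2) * W t0 = 0 by rewrite mulrBl h2 h1; ring.
move=> /eqP; rewrite mulf_eq0 (negbTE Wt0) orbF subr_eq0 => /eqP h.
have : ln (2 `^ l) = ln 2 :> R by rewrite h.
rewrite ln_powR => /eqP; rewrite -subr_eq0 -{2}[ln 2]mul1r -mulrBl mulf_eq0.
have ln2 : 0 < ln 2 :> R by rewrite ln_gt0 // ltr1n.
by rewrite !gt_eqF ?subr_gt0.
Qed.

End Curvature.

Theorem theorem4p2 (R : realType) (m : R) (z : R * R -> R) (thetas : seq R)
  (m_ge2 : 2 <= m)
  (z_ge0 : forall p, 0 <= z p)
  (z_hom : homogeneous m z)
  (z_smooth : forall k, Ck k [set p | p != 0] z)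
  (curvature_ge0 : forall p, p != 0 -> 0 <= gauss_curvature (graph z) p)
  (no_asymptotic : forall a b g,
     ~ asymptotic_curve (graph z) [set p | p != 0] a b g)
  (strict : forall th : R, 0 <= th < 2 * pi -> th \notin thetas ->
     0 < m ^+ 2 * Pz z th ^+ 2 + m * Pz z th * derive1n 2 (Pz z) th
         - (m - 1) * derive1 (Pz z) th ^+ 2)
  (c1_L1 : L1_circle (c1 m z))
  (c2_L1 : L1_circle (c2 m z))
  (nonres1 : forall n : int, b1 m z - b2 m z <> n%:~R * pi)
  (nonres2 : forall n : int, (2 * m - 1) * b1 m z - b2 m z <> n%:~R * pi) :
  forall k : nat, exists U : nat -> R * R -> 'rV[R]_3,
    [/\ Ck k setT (U 1%N), Ck k setT (U 2%N) &
        nontrivial_bending (graph z) 2 U].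
Proof.
move=> k.
have m0 : m != 0 by rewrite gt_eqF //; have := m_ge2; lra.
have sP := Pz_smper z_smooth.
have P0 := Pz_gt0 m_ge2 z_ge0 z_hom sP no_asymptotic.
have [k0 [a [b [del [a0 ab bT del0 kdel]]]]] := hill_weight_ge0 m_ge2 sP P0 strict.
have zE := homogeneous_powlog m0 z_hom.
set P := Pz z in sP P0 k0 kdel zE.
have kk : 0 <= k%:R :> R by exact: ler0n.
have N1 : 1 < m + k%:R + 2 by have := m_ge2; lra.
have [l [A [B [W [Nl lf [t0 Wt0]]]]]] := bending_eqs_eigen m_ge2 sP P0 a0 ab bT del0 kdel k0 N1.
have l1 : 1 < l by exact: lt_trans Nl.
have [[sA _ sB _ [sW _]] _ _] := lf.
have [[sA' sB'] sW'] := (smper_derive1 sA, smper_derive1 sB, smper_derive1 sW).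
pose d := l + m - 1.
have [la1 lb1] : 1 < 2 * l + m - 2 /\ 1 < 2 * l - m by have := m_ge2; split; lra.
have s1 : smper (fun t => - (d ^+ 2 * (A t ^+ 2 + B t ^+ 2))) by smper_tac.
have s2 : smper (fun t => - (2 * d * (A t * derive1 A t + B t * derive1 B t))) by smper_tac.
have s3 : smper (fun t => - ((derive1 A t - B t) ^+ 2 + (derive1 B t + A t) ^+ 2)) by smper_tac.
have s4 : smper (fun t => - (l ^+ 2 * W t ^+ 2)) by smper_tac.
have s5 : smper (fun t => - (2 * l * (W t * derive1 W t))) by smper_tac.
have s6 : smper (fun t => - (derive1 W t ^+ 2)) by smper_tac.
have [Aa0 [Aa1 [Ba0 [Ba1 [Wa0 [Wa1 fa]]]]]] :=
  bending_eqs_solvable m_ge2 sP P0 a0 ab bT del0 kdel k0 la1 s1 s2 s3.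
have [Ab0 [Ab1 [Bb0 [Bb1 [Wb0 [Wb1 fb]]]]]] :=
  bending_eqs_solvable m_ge2 sP P0 a0 ab bT del0 kdel k0 lb1 s4 s5 s6.
have [[sAa0 sAa1 sBa0 sBa1 [sWa0 sWa1]] _ _] := fa.
have [[sAb0 sAb1 sBb0 sBb1 [sWb0 sWb1]] _ _] := fb.
pose U1 := polar_field m l A (fun=> 0) B (fun=> 0) W (fun=> 0).
pose Ua := polar_field m (2 * l + m - 2) Aa0 Aa1 Ba0 Ba1 Wa0 Wa1.
pose Ub := polar_field m (2 * l - m) Ab0 Ab1 Bb0 Bb1 Wb0 Wb1.
(* Ua and Ub correct the horizontal and vertical parts of dU^1.dU^1 *)
pose U2 p := Ua p + Ub p.
have ck : [/\ k%:R < l, k%:R < 2 * l + m - 2 & k%:R < 2 * l - m].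
  by have := m_ge2; split; lra.
have [ck1 cka ckb] := ck.
have U1C n : n%:R < l -> Ck n setT U1 by move=> nl; apply: (polar_field_Ck m_ge2) => //; exact:
  smper_cst.
have UaC n : n%:R < 2 * l + m - 2 -> Ck n setT Ua by move=> nl; exact: (polar_field_Ck m_ge2).
have UbC n : n%:R < 2 * l - m -> Ck n setT Ub by move=> nl; exact: (polar_field_Ck m_ge2).
have dfl l' X0 X1 Y0 Y1 Z0 Z1 p : 1 < l' -> smper X0 -> smper X1 -> smper Y0 -> smper Y1 ->
  smper Z0 -> smper Z1 ->
    differentiable (polar_field m l' X0 X1 Y0 Y1 Z0 Z1) p.
  exact: polar_field_differentiable.
have dU1 p : differentiable U1 p by apply: dfl => //; exact: smper_cst.
have dUa p : differentiable Ua p by exact: dfl.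
have dUb p : differentiable Ub p by exact: dfl.
have dU2 p : differentiable U2 p by exact: differentiableD.
have Xdiff p : differentiable (graph z) p by rewrite zE; exact: graph_differentiable.
exists (fun n => if n is 1%N then U1 else U2); split.
- exact: U1C.
- by apply: Ck_add; [exact: UaC|exact: UbC].
split.
  apply: bending_order2 => //= p v.
    by rewrite zE (dot_graph_polar_field m_ge2 sP p v l1 lf); ring.
  have -> : 'D_v U2 p = 'D_v Ua p + 'D_v Ub p.
    by apply: deriveD; exact: diff_derivable.
  rewrite dotDr zE (dot_graph_polar_field m_ge2 sP p v la1 fa) (dot_graph_polar_field m_ge2 sP
    p v lb1 fb).
  rewrite /U1 (dot_polar_field_self m_ge2 p v l1 sA sB sW) -/d.
  have -> : 2 * l + m - 2 + m - 2 = 2 * (l + m - 2) by ring.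
  have -> : 2 * l - m + m - 2 = 2 * (l - 1) by ring.
  ring.
exact: polar_field_nontrivial l1 sW Wt0.
Qed.
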